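(* There exists a constant $c>0$ such that for all positive integers $n$ we have \[ \breve{\breve w}_3(B_2^n)\le c\log(n+1), \] \[ \breve{\breve w}_3(K)\le 2n\,w_3(K)\le c\,n^{3/2}\log(n+1)\quad\text{for any centrally symmetric } K\in\mathcal{K}^n, \] \[ \breve{\breve w}_3(K)\le 2n^2\,w_3(K)\quad\text{for any } K\in\mathcal{K}^n. \]
   Context: $\mathcal{K}^n$ denotes the class of $n$-dimensional convex bodies, i.e. compact convex subsets of $\mathbb{R}^n$ with nonempty interior. $B_2^n$ is the closed Euclidean unit ball of $\mathbb{R}^n$. For $K\in\mathcal{K}^n$, $C(K)$ is the space of continuous real-valued functions on $K$ with norm $\|f\|_K=\max_{x\in K}|f(x)|$, and $\breve C(K)$ is the set of those $f\in C(K)$ that are convex on $K$, i.e. satisfy $f(x)+f(y)\ge 2f((x+y)/2)$ for all $x,y\in K$. $\mathcal{P}_{m,n}$ is the space of real algebraic polynomials of total degree $\le m$ in $n$ variables; $\mathcal{P}_{m,n}\cap\breve C(K)$ consists of those whose restriction to $K$ is convex. For $f\in C(K)$, resp. $f\in\breve C(K)$, \[ E_m(f;K)=\inf_{P\in\mathcal{P}_{m,n}}\|f-P\|_K,\qquad \breve E_m(f;K)=\inf_{P\in\mathcal{P}_{m,n}\cap\breve C(K)}\|f-P\|_K . \] The $m$-th modulus of smoothness is \[ \omega_m(f;K)=\max_{x,x+h,\dots,x+mh\in K}|\Delta_h^m(f;x)|,\qquad \Delta_h^m(f;x)=\sum_{j=0}^m(-1)^j\binom mj f(x+jh), \] the maximum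 being over all $x,h\in\mathbb{R}^n$ with $x,x+h,\dots,x+mh\in K$. The Whitney constant and the convexity preserving Whitney constant are, respectively, \[ w_m(K)=\sup\{E_{m-1}(f;K): f\in C(K),\ \omega_m(f;K)\le 1\}, \] \[ \breve{\breve w}_m(K)=\sup\{\breve E_{m-1}(f;K): f\in\breve C(K),\ \omega_m(f;K)\le 1\}. \] *)

(* Defs.v *)
From mathcomp Require Import all_boot all_order all_algebra.
From mathcomp Require Import all_classical all_reals all_analysis.
(* Only partially imported: the notations of mpoly clash with those of analysis. *)
From mathcomp Require mpoly.
Import (canonicals, coercions) mpoly.

Set Implicit Arguments.
Unset Strict Implicit.
Unset Printing Implicit Defensive.

Import Order.TTheory GRing.Theory Num.Theory.
Import numFieldNormedType.Exports.

Local Open Scope classical_set_scope.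
Local Open Scope ring_scope.

(* Points of R^n are row vectors.  The library topology on 'rV[R]_n is given by
   the max norm, which is the usual topology; the Euclidean norm is separate. *)
Definition convex_body (R : realType) (n : nat) (K : set 'rV[R]_n) : Prop :=
  [/\ compact K, convex_set K & K° !=set0].

(* The centre of symmetry need not be the origin. *)
Definition centrally_symmetric (R : realType) (n : nat) (K : set 'rV[R]_n) :
    Prop :=
  exists c : 'rV[R]_n, forall x, K x -> K (2 *: c - x).

Definition euclidean_norm (R : realType) (n : nat) (x : 'rV[R]_n) : R :=
  Num.sqrt (\sum_(i < n) x ord0 i ^+ 2).

Definition euclidean_unit_ball (R : realType) (n : nat) : set 'rV[R]_n :=
  [set x | euclidean_norm x <= 1].
Arguments euclidean_unit_ball : clear implicits.

(* Functions on K are represented by total functions on R^n; every notion below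
   depends only on their values on K. *)
Definition continuous_on (R : realType) (n : nat) (K : set 'rV[R]_n)
    (f : 'rV[R]_n -> R) : Prop :=
  {within K, continuous f}.

Definition midpoint_convex_on (R : realType) (n : nat) (K : set 'rV[R]_n)
    (f : 'rV[R]_n -> R) : Prop :=
  forall x y, K x -> K y -> 2 * f (2^-1 *: (x + y)) <= f x + f y.

(* Norms, errors, moduli and Whitney constants take values in \bar R, so that
   every supremum and infimum is meaningful without a boundedness proof. *)
Definition sup_norm (R : realType) (n : nat) (K : set 'rV[R]_n)
    (f : 'rV[R]_n -> R) : \bar R :=
  ereal_sup [set `|f x|%:E | x in K].

Definition mpoly_fun (R : realType) (n : nat) (p : mpoly.mpoly n R) :
    'rV[R]_n -> R :=
  fun x => mpoly.meval (fun i => x ord0 i) p.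

(* msize is the total degree plus one, and is 0 for the zero polynomial. *)
Definition poly_le (R : realType) (m n : nat) : set (mpoly.mpoly n R) :=
  [set p : mpoly.mpoly n R | (mpoly.msize p <= m.+1)%N].
Arguments poly_le : clear implicits.

Definition approx_error (R : realType) (m n : nat) (K : set 'rV[R]_n)
    (f : 'rV[R]_n -> R) : \bar R :=
  ereal_inf [set sup_norm K (fun x => f x - mpoly_fun p x) |
             p in poly_le R m n].

Definition convex_approx_error (R : realType) (m n : nat) (K : set 'rV[R]_n)
    (f : 'rV[R]_n -> R) : \bar R :=
  ereal_inf [set sup_norm K (fun x => f x - mpoly_fun p x) |
             p in poly_le R m n `&` [set p | midpoint_convex_on K (mpoly_fun p)]].

Definition finite_diff (R : realType) (m n : nat) (h : 'rV[R]_n)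
    (f : 'rV[R]_n -> R) (x : 'rV[R]_n) : R :=
  \sum_(j < m.+1) (-1) ^+ j * 'C(m, j)%:R * f (x + j%:R *: h).

Definition modulus (R : realType) (m n : nat) (K : set 'rV[R]_n)
    (f : 'rV[R]_n -> R) : \bar R :=
  ereal_sup [set `|finite_diff m xh.2 f xh.1|%:E |
             xh in [set xh : 'rV[R]_n * 'rV[R]_n |
                    forall j : nat, (j <= m)%N -> K (xh.1 + j%:R *: xh.2)]].

Definition whitney (R : realType) (m n : nat) (K : set 'rV[R]_n) : \bar R :=
  ereal_sup [set approx_error m.-1 K f |
             f in [set f : 'rV[R]_n -> R |
                   continuous_on K f /\ (modulus m K f <= 1)%E]].

Definition convex_whitney (R : realType) (m n : nat) (K : set 'rV[R]_n) :
    \bar R :=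
  ereal_sup [set convex_approx_error m.-1 K f |
             f in [set f : 'rV[R]_n -> R |
                   [/\ continuous_on K f, midpoint_convex_on K f &
                       (modulus m K f <= 1)%E]]].

(* Main.v *)
Require Import Defs.
From mathcomp Require Import all_boot all_order all_algebra.
From mathcomp Require Import all_classical all_reals all_analysis.
From mathcomp Require Import perm ring lra zify.
From mathcomp Require mpoly.
Import (canonicals, coercions) mpoly.
Import Order.TTheory GRing.Theory Num.Theory.
Import numFieldNormedType.Exports.
Local Open Scope classical_set_scope.
Local Open Scope ring_scope.
Set Implicit Arguments.
Unset Strict Implicit.
Unset Printing Implicit Defensive.

(** The statement combines two independent facts: a quadratic polynomial near a
convex function can be made convex at a bounded cost, and functions with small
third differences are near quadratic polynomials.

Convexity.  Let f be convex on K and let P be a quadratic polynomial with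
|f - P| <= E.  Second differences of f are nonnegative and those of P differ
from them by at most 4 E, so the quadratic form q of P satisfies q >= - 2 E on
the half differences H = (K - K) / 2.  Take a nonnegative form M such that
rho M <= 1 forces membership in H and M (x - x0) <= 1 for x in K.  By
homogeneity q + 2 E rho M >= 0 everywhere, so P + 2 E rho M (x - x0) - E rho is
convex, and it is within (1 + rho) E of f (convex_correction).  On the ball
rho = 1 works.  In general M comes from the theorem of John for the symmetric
body H (john): if K is symmetric, rho can be taken arbitrarily close to n, and
1 + n <= 2 n; otherwise rho can be taken close to 3 n, with x0 the midpoint of a
nearly longest chord of K, and 1 + 3 n <= 2 n ^ 2 as soon as n >= 2.

Near-quadraticity, after Brudnyi and Kalton.  Put the centre of K at 0 and split
f into its odd and even parts.  By an identity of Kemperman the mixed third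
differences of f are bounded on a fixed fraction of K (sdiff_var).  Hence the
odd part is nearly affine there, and so is the polarization
B (x, y) = (f (x + y) - f (x - y)) / 4 of the even part, in each variable.  A
nearly affine function is within O(log n) of an affine one
(near_affine_approx): by linear duality it is enough to compare the values of
the function on two convex combinations of at most n + 2 points with the same
barycentre, and the Jensen inequality loses only a constant each time the number
of points doubles.

This gives maps L with B (x, y) = <x, L y> up to O(log n), and L has to be
replaced by a linear map.  If the points u_i with weights p_i form a D-optimal
design of K, then x = \sum_i p_i <x M^-1, u_i> u_i, where M is the moment matrix
and the coefficients have absolute sum O(sqrt n).  The bilinear form
\sum_i p_i <x M^-1, u_i> <y, L u_i> is therefore within O(sqrt n log n) of B
(even_approx), which is the bound on the Whitney constant of K.

On the Euclidean ball the factor sqrt n disappears.  Make the even part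
homogeneous of degree 2, and call it F.  By duality again one has to bound
\sum_i F (x_i) - \sum_i F (y_i) when \sum_i x_i^T x_i = \sum_i y_i^T y_i, for
O(n ^ 2) vectors.  The approximate parallelogram law shows that \sum_i F (x_i) is
the mean of F over the random sums \sum_i (+-) x_i, up to O(log n) (rademacher).
So the function phi (V) = \sum_k F (row k of V X) of an orthogonal matrix V
satisfies that phi (W) is close to the mean over signs of phi (U D W), for all
orthogonal U and W.  Averaging over U makes the right-hand side nearly
independent of W, whence phi is nearly constant (orth_invariant); and two
families with the same Gram matrix are exchanged by an orthogonal matrix, after
adding a few vectors to both (orth_extension). *)

(** * Linear selections with small uniform error *)

Definition fam_cat (T : Type) (N M : nat) (a : 'I_N -> T) (b : 'I_M -> T)
    (i : 'I_(N + M)) : T :=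
  match fintype.split i with inl j => a j | inr k => b k end.

Lemma sum_fam_cat (R : realType) (S T : Type) (N M : nat) (a : 'I_N -> S)
    (b : 'I_M -> S) (x : 'I_N -> T) (y : 'I_M -> T) (g : S -> T -> R) :
  \sum_i g (fam_cat a b i) (fam_cat x y i) =
  \sum_i g (a i) (x i) + \sum_i g (b i) (y i).
Proof.
rewrite big_split_ord /=; congr (_ + _); apply: eq_bigr => i _; rewrite /fam_cat.
  by rewrite (unsplitK (inl i)).
by rewrite (unsplitK (inr i)).
Qed.

Lemma sum_fam_cat1 (R : realType) (S : Type) (N M : nat) (a : 'I_N -> S)
    (b : 'I_M -> S) (g : S -> R) :
  \sum_i g (fam_cat a b i) = \sum_i g (a i) + \sum_i g (b i).
Proof. exact: (sum_fam_cat a b (fun=> tt) (fun=> tt) (fun u _ => g u)). Qed.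

(** Theorem of the alternative for the system |f - \sum_j l_j v_j| <= D: the only
obstructions to solving it are finite combinations of points that annihilate all
the v_j.  The unknowns l_j are eliminated one at a time, as in the
Fourier-Motzkin method: combinations on which v_0 is positive bound l_0 from
below, those on which it is negative bound it from above, and a pair of such
combinations can be rescaled so as to annihilate v_0, which makes the bounds
compatible. *)
Lemma linear_selection (R : realType) (d : nat) (T : Type)
    (v : 'I_d -> T -> R) (f : T -> R) (D : R) :
  (forall N (c : 'I_N -> R) (x : 'I_N -> T),
     (forall j, \sum_i c i * v j (x i) = 0) ->
     \sum_i c i * f (x i) <= D * \sum_i `|c i|) ->
  exists l : 'I_d -> R, forall x, `|f x - \sum_j l j * v j x| <= D.
Proof.
elim: d v f => [|d IHd] v f H.
  exists (fun=> 0) => x; rewrite big_ord0 subr0 ler_norml.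
  have := H 1%N (fun=> 1) (fun=> x) (fun j => match j with Ordinal _ h =>
    match notF h with end end).
  have := H 1%N (fun=> -1) (fun=> x) (fun j => match j with Ordinal _ h =>
    match notF h with end end).
  by rewrite !big_ord1 normrN !normr1; lra.
pose good N (c : 'I_N -> R) (x : 'I_N -> T) :=
  forall j, \sum_i c i * v (lift ord0 j) (x i) = 0.
pose tau N (c : 'I_N -> R) (x : 'I_N -> T) := \sum_i c i * v ord0 (x i).
pose L : set R := [set a | exists N (c : 'I_N -> R) (x : 'I_N -> T),
  [/\ good N c x, 0 < tau N c x &
   a = (\sum_i c i * f (x i) - D * \sum_i `|c i|) / tau N c x]].
have LU a N (c : 'I_N -> R) x : L a -> good N c x -> 0 < tau N c x ->
    a <= (\sum_i c i * f (x i) + D * \sum_i `|c i|) / tau N c x.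
  move=> [M [e [y [ge te ->]]]] gc tc.
  set s := tau M e y in te *; set t := tau N c x in tc *.
  have := H (M + N)%N (fam_cat (fun i => s^-1 * e i) (fun i => - t^-1 * c i))
    (fam_cat y x).
  rewrite (sum_fam_cat _ _ _ _ (fun a z => a * f z)).
  rewrite (sum_fam_cat1 _ _ (fun a => `|a|)).
  rewrite (_ : \sum_i s^-1 * _ * _ = s^-1 * \sum_i e i * f (y i)); last first.
    by rewrite mulr_sumr; apply: eq_bigr => i _; rewrite mulrA.
  rewrite (_ : \sum_i - t^-1 * _ * _ = - t^-1 * \sum_i c i * f (x i)); last first.
    by rewrite mulr_sumr; apply: eq_bigr => i _; rewrite mulrA.
  rewrite (_ : \sum_i `|s^-1 * _| = s^-1 * \sum_i `|e i|); last first.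
    rewrite mulr_sumr; apply: eq_bigr => i _; rewrite normrM (gtr0_norm (x := s^-1)) ?invr_gt0//.
  rewrite (_ : \sum_i `|- t^-1 * _| = t^-1 * \sum_i `|c i|); last first.
    rewrite mulr_sumr; apply: eq_bigr => i _; rewrite normrM normrN (gtr0_norm (x := t^-1)) ?invr_gt0//.
  have hj (j : 'I_d.+1) : \sum_i fam_cat (fun i => s^-1 * e i)
      (fun i => - t^-1 * c i) i * v j (fam_cat y x i) = 0.
    rewrite (sum_fam_cat _ _ _ _ (fun a z => a * v j z)).
    rewrite (_ : \sum_i s^-1 * _ * _ = s^-1 * \sum_i e i * v j (y i)); last first.
      by rewrite mulr_sumr; apply: eq_bigr => i _; rewrite mulrA.
    rewrite (_ : \sum_i - t^-1 * _ * _ = - t^-1 * \sum_i c i * v j (x i));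
      last first.
      by rewrite mulr_sumr; apply: eq_bigr => i _; rewrite mulrA.
    case: (unliftP ord0 j) => [k ->|->]; first by rewrite ge gc !mulr0 addr0.
    by rewrite -/(tau M e y) -/(tau N c x) -/s -/t mulNr !mulVf ?subrr ?gt_eqF.
  by move=> /(_ hj); rewrite !(mulrC _^-1) mulNr; lra.
have [l0 [hl hu]] : exists l0, (forall a, L a -> a <= l0) /\
    (forall N (c : 'I_N -> R) x, good N c x -> 0 < tau N c x ->
    l0 <= (\sum_i c i * f (x i) + D * \sum_i `|c i|) / tau N c x).
  have [L0|/set0P/negP/negPn/eqP L0] := pselect (L !=set0).
    exists (sup L); split.
      move=> a La; apply: sup_upper_bound => //; split => //.
      case: L0 => b [N [c [x [gc tc _]]]].
      exists ((\sum_i c i * f (x i) + D * \sum_i `|c i|) / tau N c x) => z Lz.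
      exact: LU.
    by move=> N c x gc tc; apply: ge_sup => // a La; exact: LU.
  exists 0; split; first by rewrite L0.
  move=> N c x gc tc; exfalso.
  have : L ((\sum_i c i * f (x i) - D * \sum_i `|c i|) / tau N c x).
    by exists N, c, x.
  by rewrite L0.
have [N c x gc|l hlx] := IHd (fun j => v (lift ord0 j)) (fun x => f x - l0 * v ord0 x).
  rewrite (_ : \sum_i _ = \sum_i c i * f (x i) - l0 * tau N c x); last first.
    rewrite /tau mulr_sumr -sumrB; apply: eq_bigr => i _; ring.
  have [t0|t0|t0] := ltrgtP 0 (tau N c x).
  - have : L ((\sum_i c i * f (x i) - D * \sum_i `|c i|) / tau N c x).
      by exists N, c, x.
    by move=> /hl; rewrite ler_pdivrMr//; lra.
  - have := hu N (fun i => - c i) x.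
    have -> : tau N (fun i => - c i) x = - tau N c x.
      by rewrite /tau -sumrN; apply: eq_bigr => i _; rewrite mulNr.
    rewrite oppr_gt0 t0 => /(_ _ isT).
    rewrite ler_pdivlMr ?oppr_gt0//.
    have -> : \sum_i - c i * f (x i) = - \sum_i c i * f (x i).
      by rewrite -sumrN; under eq_bigr do rewrite mulNr.
    have -> : \sum_i `|- c i| = \sum_i `|c i|.
      by apply: eq_bigr => i _; rewrite normrN.
    have g' : good N (fun i => - c i) x.
      by move=> j; under eq_bigr do rewrite mulNr; rewrite sumrN gc oppr0.
    by move=> /(_ g'); lra.
  - rewrite -t0 mulr0 subr0; apply: H => j.
    by case: (unliftP ord0 j) => [k ->|->] //; exact: gc.
exists (fun j => if unlift ord0 j is Some k then l k else l0) => x.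
rewrite big_ord_recl unlift_none.
under eq_bigr do rewrite liftK.
by rewrite opprD addrA; exact: hlx.
Qed.

(** The combinations that have to be tested can be taken with at most d + 1 points.
The vectors (sign (c_i) v (x_i), 1) of more points are linearly dependent;
moving the coefficients along a dependency preserves \sum_i |c_i| as long as no
sign changes, and one can move in the direction in which the left-hand side
does not decrease until some coefficient vanishes. *)
Lemma annihilator_caratheodory (R : realType) (d : nat) (T : Type)
    (v : 'I_d -> T -> R) (f : T -> R) (D : R) :
  (forall N (c : 'I_N -> R) (x : 'I_N -> T), (N <= d.+1)%N ->
     (forall j, \sum_i c i * v j (x i) = 0) ->
     \sum_i c i * f (x i) <= D * \sum_i `|c i|) ->
  forall N (c : 'I_N -> R) (x : 'I_N -> T),
     (forall j, \sum_i c i * v j (x i) = 0) ->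
     \sum_i c i * f (x i) <= D * \sum_i `|c i|.
Proof.
move=> H N; elim: N => [|N IHN] c x hv; first exact: H.
have [Nd|dN] := leqP N.+1 d.+1; first exact: H.
have drop (a : 'I_N.+1 -> R) (i0 : 'I_N.+1) : a i0 = 0 ->
    (forall j, \sum_i a i * v j (x i) = 0) ->
    \sum_i a i * f (x i) <= D * \sum_i `|a i|.
  move=> ai ha.
  rewrite (bigD1_ord i0) //= [X in D * X](bigD1_ord i0) //= ai normr0 mul0r !add0r.
  apply: (IHN (fun i => a (lift i0 i)) (fun i => x (lift i0 i))) => j.
  by have := ha j; rewrite (bigD1_ord i0) //= ai mul0r add0r.
have [[i0 ci0]|c0] := pselect (exists i, c i = 0); first exact: (drop c i0).
have {}c0 i : c i != 0 by apply/eqP => ci; apply: c0; exists i.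
pose s i := Num.sg (c i); pose a i : R := `|c i|.
have sa i : s i * a i = c i by rewrite -numEsg.
have a0 i : 0 < a i by rewrite normr_gt0.
pose A : 'M[R]_(N.+1, d.+1) := \matrix_(i, j)
  if unlift ord0 j is Some k then s i * v k (x i) else 1.
have /rowV0Pn[b bk b0] : kermx A != 0.
  rewrite -mxrank_eq0 -lt0n mxrank_ker subn_gt0.
  by rewrite (leq_ltn_trans (rank_leq_col _)).
have bA : b *m A = 0 by apply/sub_kermxP.
have b1 : \sum_i b ord0 i = 0.
  have := congr1 (fun M : 'rV[R]_d.+1 => M ord0 ord0) bA; rewrite !mxE => {2}<-.
  by apply: eq_bigr => i _; rewrite mxE unlift_none mulr1.
have bv j : \sum_i s i * b ord0 i * v j (x i) = 0.
  have := congr1 (fun M : 'rV[R]_d.+1 => M ord0 (lift ord0 j)) bA; rewrite !mxE => {2}<-.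
  by apply: eq_bigr => i _; rewrite mxE liftK; ring.
have [e [e0 e1 ev ef]] : exists e : 'I_N.+1 -> R, [/\ exists i, e i != 0,
    \sum_i e i = 0, forall j, \sum_i s i * e i * v j (x i) = 0 &
    0 <= \sum_i s i * e i * f (x i)].
  have [k bk0] : exists i, b ord0 i != 0.
    apply: contrapT => /forallNP hb; apply/negP: b0; apply/negPn/eqP/rowP => i.
    by rewrite mxE; apply/eqP; have /negP := hb i; rewrite negbK.
  have [|/ltW] := leP 0 (\sum_i s i * b ord0 i * f (x i)) => hs.
    by exists (fun i => b ord0 i); split => //; exists k.
  exists (fun i => - b ord0 i); split; first by exists k; rewrite oppr_eq0.
  - by rewrite sumrN b1 oppr0.
  - move=> j; under eq_bigr do rewrite mulrN mulNr.
    by rewrite sumrN bv oppr0.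
  - rewrite -oppr_le0 -sumrN; apply: le_trans hs; apply: ler_sum => i _.
    by rewrite mulrN !mulNr opprK.
have [i1 ei1] : exists i, e i < 0.
  apply: contrapT => /forallNP he.
  have {}he i : 0 <= e i by rewrite leNgt; apply/negP/he.
  case: e0 => i; move/eqP; apply.
  by move/eqP: e1; rewrite psumr_eq0// => /allP/(_ i (mem_index_enum _))/eqP.
pose i0 := [arg min_(i < i1 | e i < 0) (a i / - e i)]%O.
have [ei0 mi0] : e i0 < 0 /\ forall i, e i < 0 -> a i0 / - e i0 <= a i / - e i.
  by rewrite /i0; case: Order.TotalTheory.arg_minP.
set t := a i0 / - e i0 in mi0.
have t0 : 0 <= t by rewrite divr_ge0// ?ltW// oppr_gt0.
have ate i : 0 <= a i + t * e i.
  have [ei|ei] := ltP (e i) 0.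
    by have := mi0 i ei; rewrite ler_pdivlMr ?oppr_gt0//; lra.
  by apply: addr_ge0; [exact: ltW|exact: mulr_ge0].
have az : a i0 + t * e i0 = 0.
  by rewrite /t; field; rewrite lt_eqF.
have := drop (fun i => s i * (a i + t * e i)) i0.
rewrite az mulr0 => /(_ erefl).
have hv' j : \sum_i s i * (a i + t * e i) * v j (x i) = 0.
  rewrite [LHS](_ : _ = \sum_i c i * v j (x i) + t * \sum_i s i * e i * v j (x i)).
    by rewrite hv ev mulr0 addr0.
  rewrite mulr_sumr -big_split /=; apply: eq_bigr => i _; rewrite -[c i]sa; ring.
move=> /(_ hv') h.
have h1 : \sum_i s i * (a i + t * e i) * f (x i) =
    \sum_i c i * f (x i) + t * \sum_i s i * e i * f (x i).
  rewrite mulr_sumr -big_split /=; apply: eq_bigr => i _; rewrite -[c i]sa; ring.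
have h2 : \sum_i `|s i * (a i + t * e i)| = \sum_i `|c i|.
  rewrite [RHS](_ : _ = \sum_i `|c i| + t * \sum_i e i); last first.
    by rewrite e1 mulr0 addr0.
  rewrite mulr_sumr -big_split /=; apply: eq_bigr => i _.
  by rewrite normrM normr_sg c0 mul1r ger0_norm.
rewrite h1 h2 in h; apply: le_trans h; rewrite lerDl mulr_ge0//.
Qed.

(** * Nearly affine functions *)

(** Closure under convex combinations with real weights; the weights of convex_set
are packed in an interval type. *)
Definition cvx (R : realType) (V : lmodType R) (K : set V) : Prop :=
  forall x y t, K x -> K y -> 0 <= t -> t <= 1 -> K ((1 - t) *: x + t *: y).

Definition nearly_affine (R : realType) (V : lmodType R) (K : set V)
    (g : V -> R) (d : R) : Prop :=
  forall x y, K x -> K y -> `|g x + g y - 2 * g (2^-1 *: (x + y))| <= 2 * d.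

(** A midpoint defect d gives a defect 2 d for all convex combinations: since the
point of ratio t is the midpoint of x and of the point of ratio 2 t, the best
constant e satisfies e <= e / 2 + d.  Boundedness of g makes e finite. *)
Lemma affine_defect (R : realType) (V : lmodType R) (K : set V) (g : V -> R)
    (d S : R) : cvx K -> (forall x, K x -> `|g x| <= S) -> nearly_affine K g d ->
  forall x y t, K x -> K y -> 0 <= t -> t <= 1 ->
  `|g ((1 - t) *: x + t *: y) - ((1 - t) * g x + t * g y)| <= 2 * d.
Proof.
move=> cK gS gd x0 y0 t0 Kx0 Ky0 t00 t01.
pose e x y t := `|g ((1 - t) *: x + t *: y) - ((1 - t) * g x + t * g y)|.
have half M : (forall x y t, K x -> K y -> 0 <= t -> t <= 1 -> e x y t <= M) ->
    forall x y t, K x -> K y -> 0 <= t -> t <= 2^-1 -> e x y t <= M / 2 + d.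
  move=> eM x y t Kx Ky t1 t2.
  have t3 : 2 * t <= 1 by lra.
  have t4 : 0 <= 2 * t by lra.
  have := eM x y (2 * t) Kx Ky t4 t3; rewrite /e.
  have := gd x ((1 - 2 * t) *: x + (2 * t) *: y) Kx (cK _ _ _ Kx Ky t4 t3).
  have -> : 2^-1 *: (x + ((1 - 2 * t) *: x + (2 * t) *: y)) = (1 - t) *: x + t *: y.
    rewrite addrA -{1}(scale1r x) -scalerDl scalerDr !scalerA.
    by congr (_ *: _ + _ *: _); field.
  by rewrite !ler_norml; lra.
have half2 M : (forall x y t, K x -> K y -> 0 <= t -> t <= 1 -> e x y t <= M) ->
    forall x y t, K x -> K y -> 0 <= t -> t <= 1 -> e x y t <= M / 2 + d.
  move=> eM x y t Kx Ky t1 t2; have [th|/ltW th] := leP t 2^-1; first exact: half.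
  have -> : e x y t = e y x (1 - t).
    rewrite /e subKr; congr (`|g _ - _|); rewrite 1?[in LHS]addrC //.
  by apply: half => //; lra.
pose A : set R := [set a | exists x y t, [/\ K x, K y, 0 <= t, t <= 1 & a = e x y t]].
have A0 : has_sup A.
  split; first by exists (e x0 y0 t0), x0, y0, t0.
  exists (2 * S) => _ [x [y [t [Kx Ky t1 t2 ->]]]]; rewrite /e.
  have := gS _ (cK _ _ _ Kx Ky t1 t2); have := gS _ Kx; have := gS _ Ky.
  rewrite !ler_norml => /andP[a1 a2] /andP[b1 b2] /andP[c1 c2].
  by nra.
have eA x y t : K x -> K y -> 0 <= t -> t <= 1 -> e x y t <= sup A.
  by move=> *; apply: sup_upper_bound => //; exists x, y, t.
have : sup A <= sup A / 2 + d.
  apply: ge_sup; first by case: A0.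
  by move=> _ [x [y [t [Kx Ky t1 t2 ->]]]]; exact: half2.
by have := eA x0 y0 t0 Kx0 Ky0 t00 t01; rewrite /e; lra.
Qed.

Lemma ex_subset_card (T : finType) (A : {set T}) (m : nat) :
  (m <= #|A|)%N -> exists2 B : {set T}, B \subset A & #|B| = m.
Proof.
move=> mA; exists [set x in take m (enum A)].
  by apply/fintype.subsetP => x; rewrite inE => /mem_take; rewrite mem_enum.
rewrite cardsE; have /card_uniqP -> : uniq (take m (enum A)).
  by rewrite take_uniq// enum_uniq.
by rewrite size_takel// -cardE.
Qed.

(** Splitting a family of at most 2 ^ k.+1 points into two halves reduces the
combination to one of two points, which costs 2 d, so the defect is proportional
to the logarithm of the number of points. *)
Lemma jensen_defect (R : realType) (V : lmodType R) (K : set V) (g : V -> R)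
    (d S : R) : cvx K -> (forall x, K x -> `|g x| <= S) -> nearly_affine K g d ->
  forall (k N : nat) (a : 'I_N -> R) (x : 'I_N -> V) (A : {set 'I_N}),
  (#|A| <= 2 ^ k)%N -> (0 < #|A|)%N ->
  (forall i, i \in A -> 0 < a i) -> (forall i, K (x i)) ->
  let m := \sum_(i in A) a i in
  let z := m^-1 *: \sum_(i in A) a i *: x i in
  K z /\ `|m * g z - \sum_(i in A) a i * g (x i)| <= 2 * d * k%:R * m.
Proof.
move=> cK gS gd; elim=> [|k IHk] N a x A.
  move=> A1 A0 a0 Kx; have /cards1P[i Ai] : #|A| == 1%N by rewrite eqn_leq A1.
  have ai : 0 < a i by apply: a0; rewrite Ai inE.
  rewrite /= Ai !big_set1 scalerA mulVf ?gt_eqF// scale1r subrr normr0.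
  by split => //; rewrite mulr0 mul0r.
move=> Ak A0 a0 Kx.
have d0 : 0 <= d.
  have [i iA] : exists i, i \in A by apply/card_gt0P.
  have := gd _ _ (Kx i) (Kx i) => h.
  by have := le_trans (normr_ge0 _) h; lra.
have [Ak1|Ak1] := leqP #|A| (2 ^ k).
  have [Kz gz] := IHk N a x A Ak1 A0 a0 Kx; split=> //; apply: (le_trans gz).
  apply: ler_wpM2r; first by apply: sumr_ge0 => i /a0/ltW.
  by apply: ler_wpM2l; [exact: mulr_ge0|rewrite ler_nat].
have [B BA cB] := ex_subset_card (ltnW Ak1).
have AB : A :&: B = B by apply/finset.setIidPr.
have cC : #|A :\: B| = (#|A| - 2 ^ k)%N by rewrite cardsD AB cB.
have [|||KB gB] := IHk N a x B _ _ _ Kx; [by rewrite cB|by rewrite cB expn_gt0| |].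
  by move=> i iB; apply: a0; exact: (fintype.subsetP BA).
have [|||KC gC] := IHk N a x (A :\: B) _ _ _ Kx.
- by rewrite cC leq_subLR addnn -mul2n -expnS.
- by rewrite cC subn_gt0.
- by move=> i /finset.setDP[iA _]; apply: a0.
have E (W : nmodType) (F : 'I_N -> W) :
    \sum_(i in A) F i = \sum_(i in B) F i + \sum_(i in A :\: B) F i.
  by rewrite (big_setID B) AB.
have mpos (C : {set 'I_N}) : (0 < #|C|)%N -> C \subset A -> 0 < \sum_(i in C) a i.
  move=> /card_gt0P[i iC] CA; rewrite (bigD1 i)//= ltr_pwDl//.
    by apply/a0/(fintype.subsetP CA).
  by rewrite sumr_ge0// => j /andP[jC _]; apply/ltW/a0/(fintype.subsetP CA).
have := mpos B; rewrite cB expn_gt0 => /(_ isT BA).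
have := mpos (A :\: B); rewrite cC subn_gt0 Ak1 finset.subsetDl => /(_ isT isT).
rewrite /= !E.
move: KB gB KC gC.
set mB := \sum_(i in B) a i; set mC := \sum_(i in A :\: B) a i.
set gB := \sum_(i in B) _ * _; set gC := \sum_(i in A :\: B) _ * _.
set zB := \sum_(i in B) _; set zC := \sum_(i in A :\: B) _ *: _.
move=> /= KB hB KC hC C0 B0.
have t0 : 0 <= mC / (mB + mC) by rewrite divr_ge0 ?addr_ge0 ?ltW.
have t1 : mC / (mB + mC) <= 1 by rewrite ler_pdivrMr ?addr_gt0// mul1r lerDr ltW.
have m0 : mB + mC != 0 by rewrite gt_eqF ?addr_gt0.
have := affine_defect cK gS gd KB KC t0 t1.
have := cK _ _ _ KB KC t0 t1.
have -> : (1 - mC / (mB + mC)) *: (mB^-1 *: zB) + (mC / (mB + mC)) *: (mC^-1 *: zC)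
    = (mB + mC)^-1 *: (zB + zC).
  by rewrite scalerDr !scalerA; congr (_ *: _ + _ *: _); field;
    rewrite m0 gt_eqF.
move=> Kz hz; split => //.
have := ler_wpM2l (ltW (addr_gt0 B0 C0)) hz.
have e1 : (mB + mC) * (1 - mC / (mB + mC)) = mB by field.
have e2 : (mB + mC) * (mC / (mB + mC)) = mC by field.
rewrite -{1}(gtr0_norm (addr_gt0 B0 C0)) -normrM mulrBr mulrDr.
rewrite (mulrA (mB + mC) (1 - _)) e1 (mulrA (mB + mC) (mC / _) (g _)) e2.
rewrite -natr1; move: hB hC.
by rewrite !ler_norml; lra.
Qed.

(** An annihilating combination of at most n + 2 points splits into its positive and
negative parts, which have the same mass and the same barycentre; by
jensen_defect both parts nearly give the value of g at this barycentre. *)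
Lemma near_affine_approx (R : realType) (n : nat) (K : set 'rV[R]_n)
    (g : 'rV[R]_n -> R) (d S : R) (k : nat) :
  cvx K -> (forall x, K x -> `|g x| <= S) -> nearly_affine K g d ->
  (n.+2 <= 2 ^ k)%N ->
  exists l : 'I_n -> R, exists b, forall x, K x ->
    `|g x - (b + \sum_j l j * x ord0 j)| <= 2 * d * k%:R.
Proof.
move=> cK gS gd nk.
pose T := {x | K x}.
pose v (j : 'I_n.+1) (x : T) : R :=
  if unlift ord0 j is Some i then sval x ord0 i else 1.
have [l hl] : exists l : 'I_n.+1 -> R, forall x : T,
    `|g (sval x) - \sum_j l j * v j x| <= 2 * d * k%:R.
  apply: (@linear_selection R n.+1 T v (fun x => g (sval x))).
  apply: (@annihilator_caratheodory R n.+1 T v (fun x => g (sval x))) => N c x Nn hv.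
  have c1 : \sum_i c i = 0.
    have := hv ord0; rewrite /v unlift_none => {2}<-.
    by apply: eq_bigr => i _; rewrite mulr1.
  have cx : \sum_i c i *: sval (x i) = 0.
    apply/rowP => j; rewrite summxE mxE; have := hv (lift ord0 j).
    rewrite /v liftK => {2}<-; by apply: eq_bigr => i _; rewrite mxE.
  pose P := [set i | 0 < c i]%SET; pose Q := [set i | c i < 0]%SET.
  have E (W : zmodType) (F : 'I_N -> W) : (forall i, c i = 0 -> F i = 0) ->
      \sum_i F i = \sum_(i in P) F i + \sum_(i in Q) F i.
    move=> F0; rewrite (bigID (mem P)) /=; congr (_ + _).
    rewrite (bigID (mem Q)) /= [X in _ + X]big1 ?addr0.
      apply: eq_bigl => i; rewrite !inE; case: ltrgtP => //.
    move=> i; rewrite !inE -!leNgt => /andP[h1 h2]; apply: F0.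
    by apply/eqP; rewrite eq_le h1 h2.
  have Kx i : K (sval (x i)) by exact: svalP.
  have [c0|/existsNP[i0 /eqP ci0]] := pselect (forall i, c i = 0).
    rewrite big1; last by move=> i _; rewrite c0 mul0r.
    by rewrite big1 ?mulr0// => i _; rewrite c0 normr0.
  have abs : \sum_i `|c i| = \sum_(i in P) c i - \sum_(i in Q) c i.
    rewrite E; last by move=> i ->; rewrite normr0.
    rewrite -sumrN; congr (_ + _); apply: eq_bigr => i; rewrite inE => ci.
      by rewrite gtr0_norm.
    by rewrite ltr0_norm.
  have abs0 : 0 < \sum_i `|c i|.
    by rewrite (bigD1 i0)//= ltr_pwDl ?normr_gt0// sumr_ge0.
  move: (c1) (cx); rewrite E // E; last by move=> i ->; rewrite scale0r.
  move=> c1' cx'.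
  have mP : 0 < \sum_(i in P) c i by move: abs0; rewrite abs; lra.
  have nP : (0 < #|P|)%N.
    rewrite lt0n; apply/eqP => /fintype.card0_eq P0; move: mP.
    by rewrite (eq_bigl _ _ P0) big_pred0_eq ltxx.
  have nQ : (0 < #|Q|)%N.
    rewrite lt0n; apply/eqP => /fintype.card0_eq Q0; move: mP c1'.
    by rewrite (eq_bigl _ _ Q0) big_pred0_eq addr0 => /[swap] ->; rewrite ltxx.
  have cardle (A : {set 'I_N}) : (#|A| <= 2 ^ k)%N.
    by rewrite (leq_trans (max_card _))// card_ord (leq_trans Nn).
  have [|_] := @jensen_defect _ _ K g d S cK gS gd k N c (fun i => sval (x i)) P
    (cardle _) nP _ Kx; first by move=> i; rewrite inE.
  have [|_] := @jensen_defect _ _ K g d S cK gS gd k N (fun i => - c i)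
    (fun i => sval (x i)) Q (cardle _) nQ _ Kx.
    by move=> i; rewrite inE oppr_gt0.
  have -> : \sum_(i in Q) - c i = \sum_(i in P) c i by rewrite sumrN; lra.
  have -> : \sum_(i in Q) - c i *: sval (x i) = \sum_(i in P) c i *: sval (x i).
    under eq_bigr do rewrite scaleNr.
    by rewrite sumrN; apply/eqP; rewrite eq_sym -subr_eq0 opprK cx'.
  under [X in `|_ - X| <= _ -> _]eq_bigr do rewrite mulNr.
  rewrite sumrN [in X in _ -> _ -> X]E; last by move=> i ->; rewrite mul0r.
  rewrite abs !ler_norml.
  have -> : \sum_(i in Q) c i = - \sum_(i in P) c i by lra.
  by lra.
exists (fun j => l (lift ord0 j)), (l ord0) => x Kx.
have := hl (exist _ x Kx); rewrite big_ord_recl /v unlift_none mulr1 /=.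
by under eq_bigr do rewrite liftK.
Qed.

(** * Mixed third differences *)

Definition symm (R : realType) (V : lmodType R) (K : set V) : Prop :=
  forall x, K x -> K (- x).

Definition third_diff_le1 (R : realType) (V : lmodType R) (K : set V)
    (f : V -> R) : Prop :=
  forall x h, K x -> K (x + h) -> K (x + 2 *: h) -> K (x + 3 *: h) ->
  `|f x - 3 * f (x + h) + 3 * f (x + 2 *: h) - f (x + 3 *: h)| <= 1.

Lemma mem_scale (R : realType) (V : lmodType R) (K : set V) :
  cvx K -> symm K -> forall a x, `|a| <= 1 -> K x -> K (a *: x).
Proof.
move=> cK sK a x; rewrite ler_norml => /andP[a1 a2] Kx.
have := cK (- x) x ((1 + a) / 2) (sK _ Kx) Kx.
have -> : (1 - (1 + a) / 2) *: - x + ((1 + a) / 2) *: x = a *: x.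
  by rewrite scalerN -scaleNr -scalerDl; congr (_ *: _); field.
by apply; lra.
Qed.

Lemma mem_comb2 (R : realType) (V : lmodType R) (K : set V) :
  cvx K -> symm K -> forall a b x y, `|a| + `|b| <= 1 -> K x -> K y ->
  K (a *: x + b *: y).
Proof.
move=> cK sK a b x y ab Kx Ky.
have [->|b0] := eqVneq b 0.
  rewrite scale0r addr0; apply: mem_scale => //.
  by have := normr_ge0 b; lra.
have [a0|a0] := eqVneq a 0.
  rewrite a0 scale0r add0r; apply: mem_scale => //.
  by have := normr_ge0 a; lra.
have pa : 0 < `|a| by rewrite normr_gt0.
have pb : 0 < `|b| by rewrite normr_gt0.
have b1 : 0 < 1 - `|b| by lra.
have := cK ((a / (1 - `|b|)) *: x) ((b / `|b|) *: y) `|b|.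
rewrite !scalerA (mulrC (1 - _)) divfK ?gt_eqF// (mulrC `|b| (b / _)) divfK ?gt_eqF//.
apply; [| |lra|lra]; apply: mem_scale => //.
  rewrite normrM normfV (gtr0_norm b1) ler_pdivrMr//; lra.
by rewrite normrM normfV normr_id mulfV// gt_eqF.
Qed.

Lemma mem_comb3 (R : realType) (V : lmodType R) (K : set V) :
  cvx K -> symm K -> forall a b c x y z, `|a| + `|b| + `|c| <= 1 ->
  K x -> K y -> K z -> K (a *: x + b *: y + c *: z).
Proof.
move=> cK sK a b c x y z abc Kx Ky Kz.
have [s0|s0] := eqVneq (`|a| + `|b|) 0.
  have := normr_ge0 a; have := normr_ge0 b => h1 h2.
  have -> : a = 0 by apply: normr0_eq0; lra.
  have -> : b = 0 by apply: normr0_eq0; lra.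
  rewrite !scale0r !add0r; apply: mem_scale => //; lra.
have s1 : 0 < `|a| + `|b| by rewrite lt_neqAle eq_sym s0 addr_ge0.
set s := `|a| + `|b| in s0 s1 abc.
have -> : a *: x + b *: y = s *: ((a / s) *: x + (b / s) *: y).
  by rewrite scalerDr !scalerA !(mulrC s) !divfK.
apply: mem_comb2 => //; first by rewrite (gtr0_norm s1).
apply: mem_comb2 => //.
by rewrite !normrM !normfV (gtr0_norm s1) -mulrDl mulfV.
Qed.

Definition sdiff (R : realType) (V : lmodType R) (f : V -> R) (p h : V) : R :=
  f (p + h) - 2 * f p + f (p - h).

(** The identity of Kemperman writes a mixed difference with steps h1, h2, h3 as a
signed sum over subsets A of {1, 2, 3} of third differences with step
- \sum_(j in A) h_j / j, started at the sum of the h_j for j in A: the later terms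
of these differences cancel in pairs.  Here h1 = h2 is the second coordinate
direction and h3 the first one, and the empty subset contributes nothing, which
leaves seven differences. *)
Lemma kemperman_grid (R : realType) (G : R -> R -> R) :
  (forall s e a b,
    forall s1 e1 s2 e2 s3 e3, s1 = s + a -> e1 = e + b ->
    s2 = s + 2 * a -> e2 = e + 2 * b -> s3 = s + 3 * a -> e3 = e + 3 * b ->
    0 <= s <= 1 -> 0 <= s3 <= 1 -> - (7 / 2) <= e <= 1 -> - (7 / 2) <= e3 <= 1 ->
    `|G s e - 3 * G s1 e1 + 3 * G s2 e2 - G s3 e3| <= 1) ->
  `|(G 1 1 - 2 * G 1 0 + G 1 (-1)) - (G 0 1 - 2 * G 0 0 + G 0 (-1))| <= 7.
Proof.
move=> GP.
have /andP[u0 v0] : - 1 <= G 0 0 - 3 * G 0 (-1) +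
    3 * G 0 (-2) - G 0 (-3) <= 1.
  by rewrite -ler_norml; apply: (GP _ _ 0 (-1)); lra.
have /andP[u1 v1] : - 1 <= G 0 0 - 3 * G 0 (-(1/2)) +
    3 * G 0 (-1) - G 0 (-(3/2)) <= 1.
  by rewrite -ler_norml; apply: (GP _ _ 0 (-(1/2))); lra.
have /andP[u2 v2] : - 1 <= G 0 1 - 3 * G 0 (-(1/2)) +
    3 * G 0 (-2) - G 0 (-(7/2)) <= 1.
  by rewrite -ler_norml; apply: (GP _ _ 0 (-(3/2))); lra.
have /andP[u3 v3] : - 1 <= G 1 (-1) - 3 * G (2/3) (-1) +
    3 * G (1/3) (-1) - G 0 (-1) <= 1.
  by rewrite -ler_norml; apply: (GP _ _ (-(1/3)) 0); lra.
have /andP[u4 v4] : - 1 <= G 1 0 - 3 * G (2/3) (-1) +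
    3 * G (1/3) (-2) - G 0 (-3) <= 1.
  by rewrite -ler_norml; apply: (GP _ _ (-(1/3)) (-1)); lra.
have /andP[u5 v5] : - 1 <= G 1 0 - 3 * G (2/3) (-(1/2)) +
    3 * G (1/3) (-1) - G 0 (-(3/2)) <= 1.
  by rewrite -ler_norml; apply: (GP _ _ (-(1/3)) (-(1/2))); lra.
have /andP[u6 v6] : - 1 <= G 1 1 - 3 * G (2/3) (-(1/2)) +
    3 * G (1/3) (-2) - G 0 (-(7/2)) <= 1.
  by rewrite -ler_norml; apply: (GP _ _ (-(1/3)) (-(3/2))); lra.
clear GP; rewrite ler_norml; apply/andP; split; lra.
Qed.

(** The values at the affine combinations (1 - s) q + s p + e h form a grid to which
kemperman_grid applies; the factor 8 keeps all the points of the identity in K,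
because its coefficients satisfy |1 - s| + |s| + |e| <= 9 / 2. *)
Lemma sdiff_var (R : realType) (n : nat) (K : set 'rV[R]_n)
    (f : 'rV[R]_n -> R) :
  cvx K -> symm K -> third_diff_le1 K f ->
  forall p q h, K (8 *: p) -> K (8 *: q) -> K (8 *: h) ->
  `|sdiff f p h - sdiff f q h| <= 7.
Proof.
move=> cK sK f3 p q h Kp Kq Kh.
pose P s e := (1 - s) *: q + s *: p + e *: h.
have KP s e : 0 <= s -> s <= 1 -> - (7 / 2) <= e -> e <= 1 -> K (P s e).
  move=> s0 s1 e0 e1.
  have -> : P s e = ((1 - s) / 8) *: (8 *: q) + (s / 8) *: (8 *: p) + (e / 8) *: (8 *: h).
    by rewrite !scalerA !divfK// pnatr_eq0.
  apply: mem_comb3 => //.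
  rewrite (ger0_norm (x := (1 - s) / 8)) ?divr_ge0 ?subr_ge0//.
  rewrite (ger0_norm (x := s / 8)) ?divr_ge0//.
  have : `|e / 8| <= 7 / 16 by rewrite ler_norml; lra.
  by lra.
pose G s e := f (P s e).
have GP s e a b : forall s1 e1 s2 e2 s3 e3, s1 = s + a -> e1 = e + b ->
    s2 = s + 2 * a -> e2 = e + 2 * b -> s3 = s + 3 * a -> e3 = e + 3 * b ->
    0 <= s <= 1 -> 0 <= s3 <= 1 -> - (7 / 2) <= e <= 1 -> - (7 / 2) <= e3 <= 1 ->
    `|G s e - 3 * G s1 e1 + 3 * G s2 e2 - G s3 e3| <= 1.
  move=> s1 e1 s2 e2 s3 e3 -> -> -> -> -> -> /andP[u1 u2] /andP[u3 u4]
    /andP[u5 u6] /andP[u7 u8].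
  pose k := a *: (p - q) + b *: h.
  have P1 : P s e + k = P (s + a) (e + b).
    by apply/rowP => i; rewrite /P /k !mxE; ring.
  have P2 : P s e + 2 *: k = P (s + 2 * a) (e + 2 * b).
    by apply/rowP => i; rewrite /P /k !mxE; ring.
  have P3 : P s e + 3 *: k = P (s + 3 * a) (e + 3 * b).
    by apply/rowP => i; rewrite /P /k !mxE; ring.
  have := f3 (P s e) k; rewrite P1 P2 P3; apply; apply: KP; lra.
have -> : sdiff f p h = G 1 1 - 2 * G 1 0 + G 1 (-1).
  by rewrite /sdiff /G; congr (f _ - 2 * f _ + f _); apply/rowP => i;
    rewrite /P !mxE; ring.
have -> : sdiff f q h = G 0 1 - 2 * G 0 0 + G 0 (-1).
  by rewrite /sdiff /G; congr (f _ - 2 * f _ + f _); apply/rowP => i;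
    rewrite /P !mxE; ring.
exact: kemperman_grid.
Qed.

(** * Polarization on symmetric bodies *)

Definition dot (R : realType) (n : nat) (x y : 'rV[R]_n) : R :=
  \sum_j x ord0 j * y ord0 j.

Lemma dotC (R : realType) (n : nat) (x y : 'rV[R]_n) : dot x y = dot y x.
Proof. by apply: eq_bigr => j _; rewrite mulrC. Qed.

Lemma dotDl (R : realType) (n : nat) (x y z : 'rV[R]_n) :
  dot (x + y) z = dot x z + dot y z.
Proof. by rewrite -big_split; apply: eq_bigr => j _; rewrite mxE mulrDl. Qed.

Lemma dotZl (R : realType) (n : nat) (a : R) (x z : 'rV[R]_n) :
  dot (a *: x) z = a * dot x z.
Proof. by rewrite mulr_sumr; apply: eq_bigr => j _; rewrite mxE mulrA. Qed.

Lemma dotNl (R : realType) (n : nat) (x z : 'rV[R]_n) : dot (- x) z = - dot x z.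
Proof. by rewrite -scaleN1r dotZl mulN1r. Qed.

Lemma dotDr (R : realType) (n : nat) (x y z : 'rV[R]_n) :
  dot z (x + y) = dot z x + dot z y.
Proof. by rewrite ![dot z _]dotC dotDl. Qed.

Lemma dotZr (R : realType) (n : nat) (a : R) (x z : 'rV[R]_n) :
  dot z (a *: x) = a * dot z x.
Proof. by rewrite ![dot z _]dotC dotZl. Qed.

Lemma dotNr (R : realType) (n : nat) (x z : 'rV[R]_n) : dot z (- x) = - dot z x.
Proof. by rewrite ![dot z _]dotC dotNl. Qed.

Lemma dot0l (R : realType) (n : nat) (z : 'rV[R]_n) : dot 0 z = 0.
Proof. by rewrite -(scale0r 0) dotZl mul0r. Qed.

Lemma dot0r (R : realType) (n : nat) (z : 'rV[R]_n) : dot z 0 = 0.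
Proof. by rewrite dotC dot0l. Qed.

Lemma dot_suml (R : realType) (n : nat) (I : Type) (r : seq I) (P : pred I)
    (F : I -> 'rV[R]_n) z :
  dot (\sum_(i <- r | P i) F i) z = \sum_(i <- r | P i) dot (F i) z.
Proof.
exact: (big_morph (fun x => dot x z) (fun x y => dotDl x y z) (dot0l z)).
Qed.

Lemma dot_mulmx (R : realType) (m n : nat) (x : 'rV[R]_m) (A : 'M[R]_(m, n))
    (y : 'rV[R]_n) : dot (x *m A) y = dot x (y *m A^T).
Proof.
rewrite /dot; under eq_bigr do rewrite mxE mulr_suml.
rewrite exchange_big; apply: eq_bigr => i _; rewrite mxE mulr_sumr.
by apply: eq_bigr => j _; rewrite mxE -mulrA (mulrC (A _ _)).
Qed.

Lemma dot_ge0 (R : realType) (n : nat) (x : 'rV[R]_n) : 0 <= dot x x.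
Proof. by apply: sumr_ge0 => j _; rewrite -expr2 sqr_ge0. Qed.

Lemma dot_eq0 (R : realType) (n : nat) (x : 'rV[R]_n) : dot x x = 0 -> x = 0.
Proof.
move=> h; apply/rowP => j; rewrite mxE; apply/eqP; rewrite -sqrf_eq0 expr2.
have /eqP := h; rewrite psumr_eq0; last by move=> i _; rewrite -expr2 sqr_ge0.
by move=> /allP/(_ j (mem_index_enum _)).
Qed.

Lemma cvx_dilate (R : realType) (V : lmodType R) (K : set V) (a : R) :
  cvx K -> cvx [set x | K (a *: x)].
Proof.
move=> cK x y t /= Kx Ky t0 t1.
by rewrite scalerDr !scalerA !(mulrC a) -!scalerA; exact: cK.
Qed.

Lemma symm_dilate (R : realType) (V : lmodType R) (K : set V) (a : R) :
  symm K -> symm [set x | K (a *: x)].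
Proof. by move=> sK x /= Kx; rewrite scalerN; exact: sK. Qed.

Lemma near_linear_approx (R : realType) (n : nat) (K : set 'rV[R]_n)
    (g : 'rV[R]_n -> R) (d S : R) (k : nat) :
  cvx K -> symm K -> (forall x, K x -> `|g x| <= S) -> nearly_affine K g d ->
  (forall x, g (- x) = - g x) -> (n.+2 <= 2 ^ k)%N ->
  exists l : 'rV[R]_n, forall x, K x -> `|g x - dot x l| <= 2 * d * k%:R.
Proof.
move=> cK sK gS gd go nk.
have [l [b hl]] := near_affine_approx cK gS gd nk.
exists (\row_j l j) => x Kx.
have E (y : 'rV[R]_n) : \sum_j l j * y ord0 j = dot y (\row_j l j).
  by apply: eq_bigr => j _; rewrite mxE mulrC.
have := hl _ Kx; have := hl _ (sK _ Kx).
by rewrite !E dotNl go !ler_norml; lra.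
Qed.

(** An odd function has no second difference at 0, so sdiff_var bounds all its
second differences. *)
Lemma odd_nearly_affine (R : realType) (n : nat) (K : set 'rV[R]_n)
    (f : 'rV[R]_n -> R) :
  cvx K -> symm K -> third_diff_le1 K f -> (forall x, f (- x) = - f x) ->
  nearly_affine [set x | K (8 *: x)] f (7 / 2).
Proof.
move=> cK sK f3 fo x y /= Kx Ky.
set m := 2^-1 *: (x + y); pose h := 2^-1 *: (x - y).
have Kc a b : `|a| + `|b| <= 1 -> K (8 *: (a *: x + b *: y)).
  move=> ab; rewrite scalerDr !scalerA !(mulrC 8) -!scalerA.
  exact: mem_comb2.
have h2 : `|2^-1 : R| = 2^-1 by rewrite ger0_norm// invr_ge0.
have Km : K (8 *: m) by rewrite /m scalerDr; apply: Kc; rewrite h2; lra.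
have Kh : K (8 *: h).
  by rewrite /h scalerDr scalerN -scaleNr; apply: Kc; rewrite normrN h2; lra.
have K0 : K (8 *: (0 : 'rV[R]_n)).
  by have := Kc 0 0; rewrite !scale0r addr0 normr0 addr0; apply.
have := sdiff_var cK sK f3 Km K0 Kh.
have -> : sdiff f 0 h = 0.
  have f0 : f 0 = 0 by have := fo 0; rewrite oppr0; lra.
  by rewrite /sdiff add0r sub0r fo f0; lra.
rewrite subr0 /sdiff.
have -> : m + h = x by apply/rowP => i; rewrite /m /h !mxE; field.
have -> : m - h = y by apply/rowP => i; rewrite /m /h !mxE; field.
have -> : 2 * (7 / 2) = 7 :> R by field.
by rewrite addrAC.
Qed.

(** For odd f a third difference centred at 0 reads 2 (f (3 x) - 3 f x) up to sign, so
a bound valid on a ninth of K spreads to K after two dilations. *)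
Lemma odd_approx (R : realType) (n : nat) (K : set 'rV[R]_n)
    (f : 'rV[R]_n -> R) (S : R) (k : nat) :
  cvx K -> symm K -> third_diff_le1 K f -> (forall x, K x -> `|f x| <= S) ->
  (forall x, f (- x) = - f x) -> (n.+2 <= 2 ^ k)%N ->
  exists l : 'rV[R]_n, forall x, K x -> `|f x - dot x l| <= 63 * k%:R + 2.
Proof.
move=> cK sK f3 fS fo nk.
have Ks a x : `|a| <= 1 -> K x -> K (a *: x) by exact: mem_scale.
have [l hl] : exists l : 'rV[R]_n, forall x, K (8 *: x) ->
    `|f x - dot x l| <= 7 * k%:R.
  have -> : 7 = 2 * (7 / 2) :> R by field.
  apply: (@near_linear_approx _ _ [set x | K (8 *: x)] f (7 / 2) S) => //.
  - exact: cvx_dilate.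
  - exact: symm_dilate.
  - move=> x /= Kx; apply: fS; have := Ks (8^-1) _ _ Kx.
    by rewrite scalerA mulVf// scale1r; apply; rewrite ger0_norm ?invr_ge0//; lra.
  - exact: odd_nearly_affine.
have dil x : K (3 *: x) -> `|f (3 *: x) - 3 * f x| <= 1 / 2.
  move=> Kx.
  have K1 a : `|a| <= 3 -> K (a *: x).
    move=> a3; have := Ks (a / 3) _ _ Kx; rewrite scalerA divfK//; apply.
    by rewrite normrM normfV (ger0_norm (x := 3))// ler_pdivrMr//; lra.
  have := f3 (- (3 *: x)) (2 *: x).
  have -> : - (3 *: x) + 2 *: x = - x by apply/rowP => i; rewrite !mxE; ring.
  have -> : - (3 *: x) + 2 *: (2 *: x) = x by apply/rowP => i; rewrite !mxE; ring.
  have -> : - (3 *: x) + 3 *: (2 *: x) = 3 *: x by apply/rowP => i; rewrite !mxE; ring.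
  rewrite !fo => h; have {h} := h (sK _ Kx).
  have Kx1 : K x by rewrite -(scale1r x); apply: K1; rewrite normr1; lra.
  by move=> /(_ (sK _ Kx1) Kx1 Kx); rewrite !ler_norml; lra.
exists l => x Kx; pose z := 9^-1 *: x.
have ez : x = 3 *: (3 *: z) by rewrite /z !scalerA (_ : _ * _ = 1) ?scale1r//; field.
have Kz a : 0 <= a <= 9 -> K (a *: z).
  move=> a9; rewrite /z scalerA; apply: Ks => //.
  by rewrite ger0_norm; lra.
have h1 := dil (3 *: z); rewrite -ez in h1; have {}h1 := h1 Kx.
have h2 := dil z (Kz 3 ltac:(lra)).
have h3 := hl z (Kz 8 ltac:(lra)).
have -> : dot x l = 9 * dot z l by rewrite ez !dotZl; ring.
by move: h1 h2 h3; rewrite !ler_norml; lra.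
Qed.

(** The symmetric bilinear form of f, when f is a quadratic form. *)
Definition polarization (R : realType) (n : nat) (f : 'rV[R]_n -> R) (x y : 'rV[R]_n) :=
  (f (x + y) - f (x - y)) / 4.

(** A second difference of the polarization in x is a difference of second
differences of f with the same step, at x + y and at x - y. *)
Lemma polarization_nearly_affine (R : realType) (n : nat) (K : set 'rV[R]_n)
    (f : 'rV[R]_n -> R) :
  cvx K -> symm K -> third_diff_le1 K f ->
  forall y, K (16 *: y) ->
  nearly_affine [set x | K (16 *: x)] (fun x => polarization f x y) (7 / 8).
Proof.
move=> cK sK f3 y Ky x x' /= Kx Kx'.
set m := 2^-1 *: (x + x'); pose h := 2^-1 *: (x - x').
have h2 : `|2^-1 : R| = 2^-1 by rewrite ger0_norm// invr_ge0.
have h4 : `|4^-1 : R| = 4^-1 by rewrite ger0_norm// invr_ge0.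
have Kp a : `|a| <= 1 -> K (8 *: (m + a *: y)).
  move=> a1.
  have -> : 8 *: (m + a *: y) = 4^-1 *: (16 *: x) + 4^-1 *: (16 *: x') +
      (a / 2) *: (16 *: y) by apply/rowP => i; rewrite /m !mxE; field.
  by apply: mem_comb3 => //; rewrite normrM h4 h2; lra.
have Kh : K (8 *: h).
  have -> : 8 *: h = 4^-1 *: (16 *: x) + (- 4^-1) *: (16 *: x').
    by apply/rowP => i; rewrite /h !mxE; field.
  by apply: mem_comb2 => //; rewrite normrN h4; lra.
have := sdiff_var cK sK f3 (Kp 1 _) (Kp (-1) _) Kh.
rewrite normrN normr1 => /(_ (lexx _) (lexx _)).
rewrite scale1r scaleN1r /sdiff /polarization.
have -> : m + y + h = x + y by apply/rowP => i; rewrite /m /h !mxE; field.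
have -> : m + y - h = x' + y by apply/rowP => i; rewrite /m /h !mxE; field.
have -> : m - y + h = x - y by apply/rowP => i; rewrite /m /h !mxE; field.
have -> : m - y - h = x' - y by apply/rowP => i; rewrite /m /h !mxE; field.
by rewrite !ler_norml; lra.
Qed.

Lemma polarization_bounded (R : realType) (n : nat) (K : set 'rV[R]_n)
    (f : 'rV[R]_n -> R) (S : R) :
  cvx K -> symm K -> (forall x, K x -> `|f x| <= S) ->
  forall x y, K (16 *: x) -> K (16 *: y) -> `|polarization f x y| <= S / 2.
Proof.
move=> cK sK fS x y Kx Ky.
have Ka a : `|a| <= 1 -> K (x + a *: y).
  move=> a1.
  have -> : x + a *: y = 16^-1 *: (16 *: x) + (a / 16) *: (16 *: y).
    by apply/rowP => i; rewrite !mxE; field.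
  apply: mem_comb2 => //; rewrite normrM.
  by rewrite (ger0_norm (x := 16^-1)) ?invr_ge0//; lra.
have := fS _ (Ka 1 _); have := fS _ (Ka (-1) _).
rewrite normrN normr1 scale1r scaleN1r => /(_ (lexx _)) h1 /(_ (lexx _)) h2.
by move: h1 h2; rewrite /polarization !ler_norml; lra.
Qed.

Lemma polarizationC (R : realType) (n : nat) (f : 'rV[R]_n -> R) (x y : 'rV[R]_n) :
  (forall x, f (- x) = f x) -> polarization f x y = polarization f y x.
Proof. by move=> fe; rewrite /polarization (addrC x y) -(fe (y - x)) opprB. Qed.

Lemma polarization_near_linear (R : realType) (n : nat) (K : set 'rV[R]_n)
    (f : 'rV[R]_n -> R) (S : R) (k : nat) :
  cvx K -> symm K -> third_diff_le1 K f -> (forall x, K x -> `|f x| <= S) ->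
  (forall x, f (- x) = f x) -> (n.+2 <= 2 ^ k)%N ->
  exists L : 'rV[R]_n -> 'rV[R]_n, forall x y, K (16 *: x) -> K (16 *: y) ->
    `|polarization f x y - dot x (L y)| <= 7 / 4 * k%:R.
Proof.
move=> cK sK f3 fS fe nk.
have h (y : 'rV[R]_n) : exists l : 'rV[R]_n, K (16 *: y) -> forall x, K (16 *: x) ->
    `|polarization f x y - dot x l| <= 7 / 4 * k%:R.
  have [Ky|nKy] := pselect (K (16 *: y)); last by exists 0.
  have [|||||l hl] := @near_linear_approx _ _ [set x | K (16 *: x)]
    (fun x => polarization f x y) (7 / 8) (S / 2) k _ _ _ _ _ nk.
  - exact: cvx_dilate.
  - exact: symm_dilate.
  - by move=> x Kx; exact: (polarization_bounded cK sK fS).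
  - exact: polarization_nearly_affine.
  - move=> x; rewrite /polarization -(fe (- x + y)) -(fe (- x - y)) !opprD !opprK.
    by rewrite -mulNr opprB.
  exists l => _ x Kx; have := hl x Kx.
  by rewrite (_ : 2 * (7 / 8) = 7 / 4)//; field.
have [L hL] := choice h.
by exists L => x y Kx Ky; exact: hL.
Qed.

(** * Optimal designs *)

(** For M = 1 the two block triangular factorizations of the matrix with rows (1, v)
and (- u, 1) give the two sides; the general case follows by factoring M out. *)
Lemma det_rank_one (R : comUnitRingType) (n : nat) (M : 'M[R]_n)
    (u : 'cV[R]_n) (v : 'rV[R]_n) :
  M \in unitmx ->
  \det (M + u *m v) = \det M * (1 + (v *m invmx M *m u) ord0 ord0).
Proof.
move=> Mu.
have key (w : 'cV[R]_n) : \det (1%:M + w *m v) = 1 + (v *m w) ord0 ord0.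
  have e1 : block_mx 1%:M v (- w) 1%:M =
      block_mx 1%:M 0 (- w) 1%:M *m block_mx 1%:M v 0 (1%:M + w *m v).
    rewrite mulmx_block !mulmx0 !mul0mx !mul1mx ?mulmx1 !addr0.
    by rewrite mulNmx addrCA addNr addr0.
  have e2 : block_mx 1%:M v (- w) 1%:M =
      block_mx (1%:M + v *m w) v 0 1%:M *m block_mx 1%:M 0 (- w) 1%:M.
    rewrite mulmx_block ?mulmx0 ?mul0mx ?mul1mx ?mulmx1 ?addr0 ?add0r.
    by rewrite mulmxN -addrA subrr addr0.
  have := congr1 determinant (etrans (esym e1) e2).
  rewrite !det_mulmx !det_lblock !det_ublock !det1 !mul1r !mulr1 => ->.
  by rewrite det_mx11 !mxE eqxx.
have -> : M + u *m v = M *m (1%:M + invmx M *m u *m v).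
  by rewrite mulmxDr mulmx1 !mulmxA mulmxV// mul1mx.
by rewrite det_mulmx key mulmxA.
Qed.

(** A crude bound, term by term in the Leibniz formula.  It makes the set of the
determinants of moment matrices bounded, so that a nearly maximal one exists. *)
Lemma det_le (R : realDomainType) (n : nat) (A : 'M[R]_n) (S : R) :
  (forall i j, `|A i j| <= S) -> \det A <= (n`!)%:R * S ^+ n.
Proof.
move=> AS; rewrite (le_trans (ler_norm _))// (le_trans (ler_norm_sum _ _ _))//.
rewrite (_ : n`!%:R * S ^+ n = \sum_(s : 'S_n) S ^+ n); last first.
  by rewrite sumr_const card_Sn mulr_natl.
apply: ler_sum => s _; rewrite normrM normrX normrN1 expr1n mul1r normr_prod.
rewrite -[X in S ^+ X](card_ord n) -prodr_const.
by apply: ler_prod => i _; rewrite normr_ge0 AS.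
Qed.

Definition design (R : realType) (n : nat) (P : set 'rV[R]_n) (N : nat)
    (p : 'I_N -> R) (u : 'I_N -> 'rV[R]_n) : Prop :=
  [/\ forall i, 0 <= p i, \sum_i p i = 1 & forall i, P (u i)].

Definition moment (R : realType) (n N : nat) (p : 'I_N -> R)
    (u : 'I_N -> 'rV[R]_n) : 'M[R]_n := \sum_i p i *: ((u i)^T *m u i).

(** A design whose moment matrix nearly maximizes the determinant satisfies the
inequality of Kiefer and Wolfowitz up to 1 + e: moving a mass t to a point x
multiplies the determinant by (1 - t) ^ n (1 + t q / (1 - t)), where
q = <x M^-1, x>, and for q > n (1 + e) and a suitable t this is at least a fixed
constant larger than 1.  The hypotheses on coordinates make the supremum of the
determinants finite and positive. *)
Lemma optimal_design (R : realType) (n : nat) (P : set 'rV[R]_n) (S t0 e : R) :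
  (0 < n)%N -> (forall x j, P x -> `|x ord0 j| <= S) ->
  0 < t0 -> (forall i, P (t0 *: delta_mx ord0 i)) -> 0 < e ->
  exists N (p : 'I_N -> R) (u : 'I_N -> 'rV[R]_n), [/\ design P p u,
    moment p u \in unitmx &
    forall x, P x -> dot (x *m invmx (moment p u)) x <= n%:R * (1 + e)].
Proof.
move=> n0 PS t00 Pt e0.
have n0R : 0 < n%:R :> R by rewrite ltr0n.
pose D : set R := [set a | exists N (p : 'I_N -> R) (u : 'I_N -> 'rV[R]_n),
  design P p u /\ a = \det (moment p u)].
have [a0 Da0 a00] : exists2 a, D a & 0 < a.
  exists (\det ((t0 ^+ 2 / n%:R)%:M : 'M[R]_n)); last first.
    by rewrite det_scalar exprn_gt0// divr_gt0// exprn_gt0.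
  exists n, (fun=> n%:R^-1), (fun i => t0 *: delta_mx ord0 i); split.
    split; [by move=> i; rewrite invr_ge0 ltW| |exact: Pt].
    by rewrite sumr_const card_ord -[LHS]mulr_natr mulVf ?gt_eqF.
  congr (\det _); rewrite /moment; apply/matrixP => i j.
  rewrite summxE (bigD1 i)//= big1 ?addr0.
    rewrite !mxE big_ord1 !mxE !eqxx /= eq_sym.
    by case: eqP => _; rewrite ?mulr0 ?mulr0n ?mulr1n //; field; rewrite gt_eqF.
  move=> k ki; rewrite !mxE big_ord1 !mxE /=.
  by rewrite [i == k]eq_sym (negbTE ki) mulr0 mul0r mulr0.
have supD : has_sup D.
  split; first by exists a0.
  exists (n`!%:R * (S ^+ 2) ^+ n) => _ [N [p [u [[p0 p1 Pu] ->]]]].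
  apply: det_le => i j; rewrite summxE (le_trans (ler_norm_sum _ _ _))//.
  rewrite -[S ^+ 2]mul1r -p1 mulr_suml; apply: ler_sum => k _.
  rewrite !mxE big_ord1 !mxE normrM (ger0_norm (p0 k)) ler_wpM2l//.
  by rewrite normrM expr2 ler_pM ?PS.
(* With n t = y the gain is at least (1 - y) (1 + y (1 + e)) = 1 + y e / 2 = g. *)
pose y := e / (2 * (1 + e)); pose t := y / n%:R; pose g := 1 + y * e / 2.
have y0 : 0 < y by rewrite divr_gt0//; lra.
have y1 : y * (2 * (1 + e)) = e by rewrite /y divfK// gt_eqF//; lra.
have g1 : 1 < g by rewrite /g ltrDl divr_gt0// mulr_gt0.
have t1 : 0 < t by rewrite divr_gt0.
have tn : n%:R * t = y by rewrite /t mulrC divfK// gt_eqF.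
have sup0 : 0 < sup D by rewrite (lt_le_trans a00)// sup_upper_bound.
have [_ [N [p [u [dpu ->]]]] hM] : exists2 a, D a & sup D / g < a.
  have := sup_adherent (eps := sup D - sup D / g) _ supD.
  rewrite subKr; apply; rewrite subr_gt0 ltr_pdivrMr; last lra.
  by rewrite ltr_pMr.
have Mpos : 0 < \det (moment p u).
  by apply: le_lt_trans hM; rewrite divr_ge0// ?ltW//; lra.
have Mu : moment p u \in unitmx by rewrite unitmxE unitfE gt_eqF.
exists N, p, u; split => // x Px.
rewrite leNgt; apply/negP => hq.
set q := dot _ _ in hq.
have nle1 : t <= 1 / 2.
  have y2 : y <= 1 / 2 by rewrite /y ler_pdivrMr; lra.
  by rewrite (le_trans _ y2)// -tn ler_peMl ?ler1n// ltW.
pose p' := fam_cat (fun i => (1 - t) * p i) (fun _ : 'I_1 => t).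
pose u' := fam_cat u (fun _ : 'I_1 => x).
have [p0 p1 Pu] := dpu.
have d' : design P p' u'.
  split.
  - move=> i; rewrite /p' /fam_cat; case: (fintype.split i) => k; last exact: ltW.
    by rewrite mulr_ge0//; lra.
  - by rewrite (sum_fam_cat1 _ _ id) -mulr_sumr p1 big_ord1; lra.
  - by move=> i; rewrite /u' /fam_cat; case: (fintype.split i).
have M' : moment p' u' = (1 - t) *: (moment p u + (t / (1 - t)) *: x^T *m x).
  have t2 : 1 - t != 0 by rewrite gt_eqF//; lra.
  apply/matrixP => i j; rewrite /moment summxE.
  under eq_bigr do rewrite mxE.
  rewrite (sum_fam_cat _ _ _ _ (fun a z => a * (z^T *m z) i j)) big_ord1.
  rewrite !mxE !big_ord1 !mxE summxE mulrDr mulr_sumr; congr (_ + _); last by field.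
  by apply: eq_bigr => k _; rewrite !mxE mulrA.
have : D (\det (moment p' u')) by exists (N + 1)%N, p', u'.
move=> /(sup_upper_bound supD).
rewrite M' detZ det_rank_one// -scalemxAr.
have -> : (x *m invmx (moment p u) *m x^T) = q%:M.
  apply/matrixP => i j; rewrite !ord1 !mxE eqxx mulr1n /q /dot.
  by apply: eq_bigr => k _; rewrite !mxE.
rewrite !mxE eqxx mulr1n.
have bern : 1 - n%:R * t <= (1 - t) ^+ n.
  have : forall m, 1 - m%:R * t <= (1 - t) ^+ m.
    elim=> [|m IH]; first by rewrite mul0r subr0 expr0.
    rewrite exprS -natr1; have := ler_wpM2l (_ : 0 <= 1 - t) IH.
    have m0 : 0 <= m%:R :> R by [].
    have : 0 <= m%:R * t ^+ 2 by rewrite mulr_ge0 ?sqr_ge0.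
    by move=> h1 /(_ ltac:(lra)); nra.
  exact.
have h1 : t <= t / (1 - t) by rewrite ler_pdivlMr; nra.
have h2 : 1 + t * q <= 1 + t / (1 - t) * q.
  by rewrite lerD2l ler_wpM2r//; apply: le_trans (ltW hq); rewrite mulr_ge0//; lra.
have h3 : g <= (1 - y) * (1 + t * q).
  have : y * (1 + e) <= t * q.
    rewrite -tn (_ : n%:R * t * (1 + e) = t * (n%:R * (1 + e))); last by ring.
    by apply: ler_wpM2l; exact: ltW.
  rewrite /g; nra.
rewrite tn in bern.
have h4 : g <= (1 - t) ^+ n * (1 + t / (1 - t) * q).
  by rewrite (le_trans h3)// ler_pM//; nra.
rewrite leNgt => /negP; apply.
rewrite mulrCA; rewrite ltr_pdivrMr in hM; last lra.
by rewrite (lt_le_trans hM)// ler_pM2l.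
Qed.

(** * Even functions on symmetric bodies *)

(** This is the identity x = x M^-1 M, with M expanded. *)
Lemma design_reconstruct (R : realType) (n N : nat) (p : 'I_N -> R)
    (u : 'I_N -> 'rV[R]_n) :
  moment p u \in unitmx -> forall x : 'rV[R]_n,
  x = \sum_i (p i * dot (x *m invmx (moment p u)) (u i)) *: u i.
Proof.
move=> Mu x; rewrite -{1}[x]mulmx1 -(mulVmx Mu) mulmxA {2}/moment mulmx_sumr.
apply: eq_bigr => i _; rewrite -scalemxAr mulmxA -scalerA; congr (_ *: _).
apply/rowP => j; rewrite !mxE big_ord1 !mxE; congr (_ * _).
by apply: eq_bigr => k _; rewrite !mxE.
Qed.

Lemma moment_sym (R : realType) (n N : nat) (p : 'I_N -> R)
    (u : 'I_N -> 'rV[R]_n) : (moment p u)^T = moment p u.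
Proof.
rewrite /moment linear_sum; apply: eq_bigr => i _ /=.
by rewrite linearZ /= trmx_mul trmxK.
Qed.

(** The squares of the coefficients average to <x M^-1, x>, so their absolute values
average to at most its square root. *)
Lemma design_l1_bound (R : realType) (n N : nat) (P : set 'rV[R]_n)
    (p : 'I_N -> R) (u : 'I_N -> 'rV[R]_n) (s : R) :
  design P p u -> moment p u \in unitmx -> 0 < s ->
  forall x, dot (x *m invmx (moment p u)) x <= s ^+ 2 ->
  \sum_i p i * `|dot (x *m invmx (moment p u)) (u i)| <= s.
Proof.
move=> [p0 p1 _] Mu s0 x hx; set z := x *m _ in hx *.
have Q : \sum_i p i * dot z (u i) ^+ 2 <= s ^+ 2.
  apply: le_trans hx; rewrite {1}(design_reconstruct Mu x) -/z dotC dot_suml.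
  by apply: ler_sum => i _; rewrite dotZl (dotC (u i)) expr2 mulrA.
(* From 2 |a| s <= a ^ 2 + s ^ 2. *)
have young i : p i * `|dot z (u i)| <= p i * (dot z (u i) ^+ 2 / s + s) / 2.
  rewrite -mulrA ler_wpM2l// -(real_normK (num_real _)).
  set a := `|_|; have e : a ^+ 2 / s * s = a ^+ 2 by rewrite divfK ?gt_eqF.
  have : 0 <= (a - s) ^+ 2 / s by rewrite divr_ge0 ?sqr_ge0 ?ltW.
  rewrite sqrrB mulrDl mulrBl expr2 (expr2 s) mulfK ?gt_eqF// mulr2n mulrDl.
  by rewrite mulfK ?gt_eqF//; lra.
apply: (le_trans (ler_sum _ (fun i _ => young i))).
rewrite -mulr_suml; under eq_bigr do rewrite mulrDr mulrA.
rewrite big_split /= -!mulr_suml p1 mul1r ler_pdivrMr// mulr_natr mulr2n lerD2r.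
by rewrite ler_pdivrMr// -expr2.
Qed.

(** For even f with f 0 = 0 a third difference at - x with step x reads
4 f x - f (2 x), so the error is multiplied by 4, up to an additive constant, when
the domain is doubled; this is done three times. *)
Lemma even_dilate (R : realType) (n : nat) (K : set 'rV[R]_n)
    (f : 'rV[R]_n -> R) (A : 'M[R]_n) (E : R) :
  cvx K -> symm K -> third_diff_le1 K f -> (forall x, f (- x) = f x) -> f 0 = 0 ->
  (forall x, K (8 *: x) -> `|f x - dot (x *m A) x| <= E) ->
  forall x, K x -> `|f x - dot (x *m A) x| <= 64 * E + 21.
Proof.
move=> cK sK f3 fe f0 hE x Kx.
have Ks a z : `|a| <= 1 -> K z -> K (a *: z) by exact: mem_scale.
have dil z : K (2 *: z) -> `|f (2 *: z) - 4 * f z| <= 1.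
  move=> Kz.
  have K1 : K z.
    have := Ks (2^-1) _ _ Kz; rewrite scalerA mulVf// scale1r; apply.
    by rewrite ger0_norm; lra.
  have K0 : K 0 by have := Ks 0 _ _ Kz; rewrite scale0r normr0; apply.
  have := f3 (- z) z (sK _ K1).
  have -> : - z + 2 *: z = z by apply/rowP => i; rewrite !mxE; ring.
  have -> : - z + 3 *: z = 2 *: z by apply/rowP => i; rewrite !mxE; ring.
  rewrite addNr fe f0 => /(_ K0 K1 Kz); rewrite !ler_norml; lra.
pose z := 8^-1 *: x.
have e4 : x = 2 *: (4 *: z) by rewrite /z !scalerA (_ : _ * _ = 1) ?scale1r//; field.
have e2 : 4 *: z = 2 *: (2 *: z) by rewrite !scalerA; congr (_ *: _); ring.
have Kz a : 0 <= a <= 8 -> K (a *: z).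
  move=> a8; rewrite /z scalerA; apply: Ks => //.
  by rewrite ger0_norm; lra.
have h1 := dil (4 *: z); rewrite -e4 in h1; have {}h1 := h1 Kx.
have h2 := dil (2 *: z); rewrite -e2 in h2; have {}h2 := h2 (Kz 4 ltac:(lra)).
have h3 := dil z (Kz 2 ltac:(lra)).
have h4 := hE z (Kz 8 ltac:(lra)).
have -> : dot (x *m A) x = 64 * dot (z *m A) z.
  rewrite e4 e2 -!scalemxAl !dotZl !dotZr; ring.
by move: h1 h2 h3 h4; rewrite !ler_norml; lra.
Qed.

(** The map L of polarization_near_linear is linear in one variable only.  Its values
at the points of an optimal design are extended linearly by the reconstruction
formula.  Since B (x, y) is also nearly linear in the other variable, the error is
multiplied only by the absolute sum of the coefficients of x. *)
Lemma even_approx (R : realType) (n : nat) (K : set 'rV[R]_n)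
    (f : 'rV[R]_n -> R) (S S' t : R) (k : nat) :
  (0 < n)%N -> cvx K -> symm K -> third_diff_le1 K f ->
  (forall x, K x -> `|f x| <= S) ->
  (forall x j, K x -> `|x ord0 j| <= S') ->
  0 < t -> (forall i, K (t *: delta_mx ord0 i)) ->
  (forall x, f (- x) = f x) -> f 0 = 0 -> (n.+2 <= 2 ^ k)%N ->
  exists A : 'M[R]_n, forall x, K x ->
    `|f x - dot (x *m A) x| <= 448 * k%:R * (1 + 4 * Num.sqrt n%:R) + 21.
Proof.
move=> n0 cK sK f3 fS KS' t0 Kt fe f0 nk.
have n0R : 0 < n%:R :> R by rewrite ltr0n.
have [L hL] := polarization_near_linear cK sK f3 fS fe nk.
have [||||N [p [u [dpu Mu hM]]]] := @optimal_design R n [set x | K (16 *: x)] (S' / 16) (t / 16) 1 n0.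
- move=> x j /= /KS'; move=> /(_ j); rewrite mxE normrM ger0_norm//.
  by rewrite ler_pdivlMr// mulrC.
- exact: divr_gt0.
- by move=> i /=; rewrite scalerA mulrCA divff// mulr1.
- exact: ltr01.
pose A := \sum_i p i *: (invmx (moment p u) *m (u i)^T *m L (u i)).
have [p0 p1 Pu] := dpu.
have AE x : dot (x *m A) x =
    \sum_i p i * dot (x *m invmx (moment p u)) (u i) * dot x (L (u i)).
  rewrite mulmx_sumr dot_suml; apply: eq_bigr => i _.
  rewrite -scalemxAr dotZl !mulmxA -mulrA; congr (_ * _).
  have -> : x *m invmx (moment p u) *m (u i)^T = (dot (x *m invmx (moment p u)) (u i))%:M.
    apply/matrixP => a b; rewrite !ord1 !mxE eqxx mulr1n /dot.
    by apply: eq_bigr => j _; rewrite !mxE.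
  by rewrite mul_scalar_mx dotZl (dotC x).
set ka := 7 / 4 * k%:R in hL.
have ka0 : 0 <= ka by rewrite /ka mulr_ge0// divr_ge0.
exists A.
have -> : 448 * k%:R * (1 + 4 * Num.sqrt n%:R) + 21 =
    64 * (4 * (ka + 2 * ka * (2 * Num.sqrt n%:R))) + 21 :> R.
  by rewrite /ka; field.
apply: even_dilate => // w Kw.
pose x := 2^-1 *: w.
have wx : w = x + x.
  by apply/rowP => i; rewrite /x !mxE; field.
have Kx : K (16 *: x).
  by rewrite /x scalerA (_ : 16 * 2^-1 = 8)//; field.
have -> : dot (w *m A) w = 4 * dot (x *m A) x.
  rewrite wx mulmxDl !dotDl !dotDr; ring.
have fw : f w = 4 * polarization f x x.
  by rewrite /polarization -wx subrr f0 subr0 mulrC divfK.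
rewrite fw -mulrBr normrM ger0_norm// ler_pM2l//.
have sq : 0 < Num.sqrt n%:R :> R by rewrite sqrtr_gt0.
have l1 := design_l1_bound (s := 2 * Num.sqrt n%:R) dpu Mu _ (x := x).
have {}l1 : \sum_i p i * `|dot (x *m invmx (moment p u)) (u i)| <= 2 * Num.sqrt n%:R.
  apply: l1; first by rewrite mulr_gt0.
  rewrite exprMn sqr_sqrtr ?ler0n//; apply: (le_trans (hM _ _)) => //=.
  by rewrite mulrC ler_pM2r//; lra.
have xE := design_reconstruct Mu x.
have h1 : `|dot x (L x) - dot (x *m A) x| <= 2 * ka * (2 * Num.sqrt n%:R).
  rewrite AE {1}xE dot_suml -sumrB (le_trans (ler_norm_sum _ _ _))//.
  apply: (@le_trans _ _ (\sum_i p i * `|dot (x *m invmx (moment p u)) (u i)| * (2 * ka))).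
    apply: ler_sum => i _; rewrite dotZl -mulrBr !normrM (ger0_norm (p0 i)).
    apply: ler_wpM2l; first by rewrite mulr_ge0.
    have := hL _ _ (Pu i) Kx; have := hL _ _ Kx (Pu i).
    by rewrite (polarizationC (u i) x fe) !ler_norml; lra.
  rewrite -mulr_suml mulrC ler_wpM2l//; lra.
have := hL _ _ Kx Kx; move: h1; rewrite !ler_norml; lra.
Qed.

(** * Random signs *)

Definition signs (N : nat) := {ffun 'I_N -> bool}.

Definition rsign (R : realType) (N : nat) (e : signs N) (i : 'I_N) : R := (-1) ^+ e i.

Definition expect (R : realType) (N : nat) (g : signs N -> R) : R :=
  (2 ^+ N)^-1 * \sum_e g e.

Lemma expect_cst (R : realType) (N : nat) (a : R) :
  expect (fun _ : signs N => a) = a.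
Proof.
rewrite /expect sumr_const card_ffun card_bool card_ord -[X in _ * X]mulr_natr natrX.
by rewrite mulrC mulfK// expf_neq0.
Qed.

Lemma expectD (R : realType) (N : nat) (g h : signs N -> R) :
  expect (fun e => g e + h e) = expect g + expect h.
Proof. by rewrite /expect big_split mulrDr. Qed.

Lemma expectZ (R : realType) (N : nat) (a : R) (g : signs N -> R) :
  expect (fun e => a * g e) = a * expect g.
Proof. by rewrite /expect -mulr_sumr mulrCA. Qed.

Lemma expect_sum (R : realType) (N : nat) (I : finType) (g : I -> signs N -> R) :
  expect (fun e => \sum_i g i e) = \sum_i expect (g i).
Proof. by rewrite /expect exchange_big mulr_sumr. Qed.

Lemma expect_le (R : realType) (N : nat) (g h : signs N -> R) :
  (forall e, g e <= h e) -> expect g <= expect h.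
Proof.
by move=> gh; rewrite ler_wpM2l ?invr_ge0 ?exprn_ge0// ler_sum.
Qed.

Lemma expect_dist (R : realType) (N : nat) (g h : signs N -> R) (d : signs N -> R) :
  (forall e, `|g e - h e| <= d e) -> `|expect g - expect h| <= expect d.
Proof.
move=> gh; rewrite ler_norml; apply/andP; split.
  rewrite lerNl opprB -[- _]mulN1r -expectZ -expectD; apply: expect_le => e.
  by have := gh e; rewrite ler_norml; lra.
rewrite -[- _]mulN1r -expectZ -expectD; apply: expect_le => e.
by have := gh e; rewrite ler_norml; lra.
Qed.

Lemma expect_flip (R : realType) (N : nat) (B : {set 'I_N}) (g : signs N -> R) :
  expect (fun e => g [ffun i => e i (+) (i \in B)]) = expect g.
Proof.
rewrite /expect; congr (_ * _); pose h (e : signs N) := [ffun i => e i (+) (i \in B)].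
have hK : involutive h by move=> e; apply/ffunP => i; rewrite !ffunE addbK.
by rewrite [RHS](reindex_inj (inv_inj hK)).
Qed.

Definition rsum (R : realType) (n N : nat) (x : 'I_N -> 'rV[R]_n)
    (A : {set 'I_N}) (e : signs N) : 'rV[R]_n := \sum_(i in A) rsign R e i *: x i.

(** Changing the signs outside B turns the sum s + s' into s - s', so the mean of
F (s + s') is the mean of (F (s + s') + F (s - s')) / 2. *)
Lemma rademacher_split (R : realType) (n N : nat) (F : 'rV[R]_n -> R) (d : R)
    (x : 'I_N -> 'rV[R]_n) (A B : {set 'I_N}) :
  (forall x y, `|F (x + y) + F (x - y) - 2 * F x - 2 * F y| <=
     d * (dot x x + dot y y)) -> B \subset A ->
  `|expect (fun e => F (rsum x A e)) - (expect (fun e => F (rsum x B e)) +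
      expect (fun e => F (rsum x (A :\: B) e)))| <=
  d / 2 * (expect (fun e => dot (rsum x B e) (rsum x B e)) +
      expect (fun e => dot (rsum x (A :\: B) e) (rsum x (A :\: B) e))).
Proof.
move=> Fd BA; pose C := A :\: B.
have AE e : rsum x A e = rsum x B e + rsum x C e.
  by rewrite /rsum (big_setID B) (finset.setIidPr BA).
have AE' (e : signs N) : rsum x A ([ffun i => e i (+) (i \in C)] : signs N) = rsum x B e - rsum x C e.
  rewrite AE; congr (_ + _).
    apply: eq_bigr => i iB; rewrite /rsign ffunE finset.inE iB /=.
    by rewrite addbF.
  rewrite -sumrN; apply: eq_bigr => i iC; rewrite /rsign ffunE iC addbT signrN.
  by rewrite scaleNr.
have -> : expect (fun e => F (rsum x A e)) =
    expect (fun e => 2^-1 * (F (rsum x B e + rsum x C e) + F (rsum x B e - rsum x C e))).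
  rewrite expectZ expectD.
  rewrite (_ : expect (fun e => F (_ - _)) = expect (fun e => F (rsum x A e))).
    rewrite (_ : expect (fun e => F (_ + _)) = expect (fun e => F (rsum x A e))).
      by field.
    by congr expect; apply: funext => e; rewrite AE.
  rewrite -[RHS](expect_flip C); congr expect; apply: funext => e; congr F.
  by rewrite AE'.
rewrite -!expectD -expectZ; apply: expect_dist => e.
by have := Fd (rsum x B e) (rsum x C e); rewrite /C !ler_norml; lra.
Qed.

Lemma rsum0 (R : realType) (n N : nat) (x : 'I_N -> 'rV[R]_n) (e : signs N) :
  rsum x finset.set0 e = 0.
Proof. by rewrite /rsum big_set0. Qed.

Lemma rsign_sqr (R : realType) (N : nat) (e : signs N) i : rsign R e i ^+ 2 = 1.
Proof. by rewrite /rsign sqrr_sign. Qed.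

Lemma rsum1 (R : realType) (n N : nat) (F : 'rV[R]_n -> R) (x : 'I_N -> 'rV[R]_n) i :
  (forall a x, F (a *: x) = a ^+ 2 * F x) ->
  expect (fun e => F (rsum x [set i]%SET e)) = F (x i).
Proof.
move=> FZ; rewrite -[RHS](expect_cst N); congr expect; apply: funext => e.
by rewrite /rsum big_set1 FZ rsign_sqr mul1r.
Qed.

(** The parallelogram law is exact for the square of the norm, so rademacher_split
applies with defect 0. *)
Lemma rademacher_norm (R : realType) (n N : nat) (x : 'I_N -> 'rV[R]_n)
    (A : {set 'I_N}) :
  expect (fun e => dot (rsum x A e) (rsum x A e)) = \sum_(i in A) dot (x i) (x i).
Proof.
move: {2}#|A| (erefl #|A|) => m; elim: m A => [|m IH] A Am.
  have -> : A = finset.set0 by apply: cards0_eq.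
  rewrite big_set0 -[RHS](expect_cst N); congr expect; apply: funext => e.
  by rewrite rsum0 dot0l.
have [i iA] : exists i, i \in A by apply/card_gt0P; rewrite Am.
have Bm : #|A :\: [set i]| = m by have := cardsD1 i A; rewrite iA Am => -[].
have := @rademacher_split R n N (fun z : 'rV[R]_n => dot z z) 0 x A [set i]%SET _ _.
rewrite (rsum1 (F := fun z : 'rV[R]_n => dot z z)); last by move=> a z; rewrite dotZl dotZr; ring.
rewrite !mul0r (IH _ Bm) -(big_setD1 (F := fun j => dot (x j) (x j)) i iA) /= => h.
apply/eqP; rewrite -subr_eq0 -normr_le0.
apply: h; last by rewrite finset.sub1set.
move=> y z; rewrite mul0r normr_le0; apply/eqP.
rewrite !(dotDl, dotDr, dotNl, dotNr) (dotC z y); ring.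
Qed.

(** Splitting the index set in halves costs d / 2 times the sum of the squared norms
on each of the k levels. *)
Lemma rademacher (R : realType) (n : nat) (F : 'rV[R]_n -> R) (d : R) :
  (forall a x, F (a *: x) = a ^+ 2 * F x) ->
  (forall x y, `|F (x + y) + F (x - y) - 2 * F x - 2 * F y| <=
     d * (dot x x + dot y y)) -> 0 <= d ->
  forall k N (x : 'I_N -> 'rV[R]_n) (A : {set 'I_N}), (#|A| <= 2 ^ k)%N ->
  `|expect (fun e => F (rsum x A e)) - \sum_(i in A) F (x i)| <=
    d / 2 * k%:R * \sum_(i in A) dot (x i) (x i).
Proof.
move=> FZ Fd d0; elim=> [|k IH] N x A.
  rewrite expn0 leq_eqVlt ltnS leqn0 => /orP[/cards1P[i ->]|]; last first.
    move=> /eqP/cards0_eq ->; rewrite !big_set0 mulr0.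
    rewrite (_ : expect _ = 0) ?subrr ?normr0// -[RHS](expect_cst N).
    congr expect; apply: funext => e; rewrite rsum0.
    by rewrite -(scale0r 0) FZ expr0n mul0r.
  by rewrite rsum1// !big_set1 subrr normr0 mulr0 mul0r.
move=> Ak.
have [B BA [Bk Ck]] : exists2 B : {set 'I_N}, B \subset A &
    (#|B| <= 2 ^ k)%N /\ (#|A :\: B| <= 2 ^ k)%N.
  have [Ak1|/ltnW /ex_subset_card[B BA Bk]] := leqP #|A| (2 ^ k).
    by exists A => //; rewrite finset.setDv cards0.
  exists B => //; split; first by rewrite Bk.
  by rewrite cardsD (finset.setIidPr BA) Bk leq_subLR addnn -mul2n -expnS.
have := rademacher_split x Fd BA; rewrite !rademacher_norm.
have := IH _ x _ Bk; have := IH _ x _ Ck.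
rewrite !(big_setID B (A := A)) /= !(finset.setIidPr BA) -natr1.
move: (\sum_(i in B) _) (\sum_(i in B) _) (\sum_(i in _ :\: B) _)
  (\sum_(i in _ :\: B) _).
by move=> a b a' b'; rewrite !ler_norml; lra.
Qed.

(** * Mean values over the orthogonal group *)

Definition orth (R : realType) (N : nat) (V : 'M[R]_N) : Prop := V^T *m V = 1%:M.

Definition frob2 (R : realType) (m n : nat) (A : 'M[R]_(m, n)) : R :=
  \sum_i dot (row i A) (row i A).

Lemma frob2E (R : realType) (m n : nat) (A : 'M[R]_(m, n)) :
  frob2 A = \tr (A^T *m A).
Proof.
rewrite mxtrace_mulC /mxtrace; apply: eq_bigr => i _; rewrite mxE.
by apply: eq_bigr => j _; rewrite !mxE.
Qed.

Lemma orthM (R : realType) (N : nat) (U V : 'M[R]_N) :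
  orth U -> orth V -> orth (U *m V).
Proof.
by rewrite /orth trmx_mul mulmxA -(mulmxA V^T) => -> ; rewrite mulmx1.
Qed.

Lemma orthT (R : realType) (N : nat) (U : 'M[R]_N) : orth U -> orth U^T.
Proof. by rewrite /orth trmxK => /mulmx1C. Qed.

Lemma orth1 (R : realType) (N : nat) : orth (1%:M : 'M[R]_N).
Proof. by rewrite /orth trmx1 mulmx1. Qed.

Lemma frob2_orth (R : realType) (N n : nat) (U : 'M[R]_N) (A : 'M[R]_(N, n)) :
  orth U -> frob2 (U *m A) = frob2 A.
Proof.
by move=> hU; rewrite !frob2E trmx_mul mulmxA -(mulmxA A^T) hU mulmx1.
Qed.

Lemma orth_entry (R : realType) (N : nat) (U : 'M[R]_N) i j :
  orth U -> `|U i j| <= 1.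
Proof.
move=> hU; have := congr1 (fun A : 'M[R]_N => A j j) hU.
rewrite !mxE eqxx (bigD1 i)//= mxE => h.
rewrite -(ler_pXn2r (n := 2))// ?nnegrE// expr1n -normrX ger0_norm ?sqr_ge0//.
rewrite expr2 -[leRHS]h lerDl sumr_ge0// => k _.
by rewrite mxE -expr2 sqr_ge0.
Qed.

(** The orthogonal group is totally bounded: the entries lie in [-1, 1], and two
matrices are close when their entries lie in the same cells of a fine grid.  A
net of orthogonal matrices is obtained by choosing one in each cell that meets
the group. *)
Lemma orth_net (R : realType) (N : nat) (r : R) : 0 < r ->
  exists (C : finType) (g : C -> 'M[R]_N), (forall c, orth (g c)) /\
    forall V, orth V -> exists c, frob2 (V - g c) <= r.
Proof.
move=> r0.
have [m m0 hm] : exists2 m : nat, (0 < m)%N & N%:R ^+ 2 <= r * m%:R ^+ 2 :> R.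
  pose m := (Num.truncn (N%:R ^+ 2 / r)).+1; exists m => //.
  have : N%:R ^+ 2 / r <= m%:R :> R by apply/ltW/truncnS_gt.
  rewrite ler_pdivrMr// => /le_trans; apply.
  by rewrite mulrC ler_pM2l// ler_eXnr// ler1n.
have m0R : 0 < m%:R :> R by rewrite ltr0n.
pose L := (2 * m)%N.
pose cell (V : 'M[R]_N) : {ffun 'I_N * 'I_N -> 'I_L.+1} :=
  [ffun p => inord (Num.truncn ((V p.1 p.2 + 1) * m%:R))].
have cellP V V' : orth V -> orth V' -> cell V = cell V' -> frob2 (V - V') <= r.
  move=> hV hV' e.
  have b (W : 'M[R]_N) i j : orth W -> 0 <= (W i j + 1) * m%:R <= L%:R.
    move=> /(orth_entry i j); rewrite ler_norml => /andP[w1 w2].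
    by rewrite /L natrM ler_pM2r// mulr_ge0//; lra.
  have entry i j : `|V i j - V' i j| <= m%:R^-1.
    have /andP[v1 v2] := b V i j hV; have /andP[w1 w2] := b V' i j hV'.
    have := congr1 (fun h : {ffun 'I_N * 'I_N -> 'I_L.+1} => val (h (i, j))) e.
    rewrite /cell !ffunE /= !inordK; last 2 first.
    - by rewrite ltnS truncn_le_nat; apply: le_lt_trans w2 _; rewrite ltr_nat.
    - by rewrite ltnS truncn_le_nat; apply: le_lt_trans v2 _; rewrite ltr_nat.
    move=> et; have := truncn_itv v1; have := truncn_itv w1; rewrite et.
    move=> /andP[a1 a2] /andP[b1 b2].
    rewrite -(ler_pM2r m0R) mulVf ?gt_eqF// -{1}(gtr0_norm m0R) -normrM mulrBl.
    by rewrite ler_norml; rewrite -natr1 in a2 b2; lra.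
  rewrite /frob2 /dot.
  apply: (@le_trans _ _ (\sum_(i < N) \sum_(j < N) m%:R^-1 ^+ 2)).
    apply: ler_sum => i _; apply: ler_sum => j _; rewrite !mxE -expr2.
    rewrite -[leLHS]real_normK ?num_real//; apply: lerXn2r; last exact: entry.
      by rewrite nnegrE.
    by rewrite nnegrE invr_ge0.
  rewrite !sumr_const card_ord -mulrnA -[leLHS]mulr_natr natrM -expr2 exprVn mulrC.
  by rewrite ler_pdivrMr ?exprn_gt0.
have hG (c : {ffun 'I_N * 'I_N -> 'I_L.+1}) : exists G : 'M[R]_N,
    orth G /\ forall V, orth V -> cell V = c -> cell G = c.
  have [[V [hV cV]]|nV] := pselect (exists V, orth V /\ cell V = c).
    by exists V.
  exists 1%:M; split; first exact: orth1.
  by move=> V hV cV; exfalso; apply: nV; exists V.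
have [g hg] := choice hG.
exists {ffun 'I_N * 'I_N -> 'I_L.+1}, g; split; first by move=> c; have [] := hg c.
move=> V hV; exists (cell V); have [h1 h2] := hg (cell V).
by apply: cellP => //; rewrite (h2 V).
Qed.

Definition mean (R : realType) (I : finType) (g : I -> R) : R :=
  #|I|%:R^-1 * \sum_i g i.

(** Averages of left translates of phi nearly reach a constant, as in the
construction of the mean value by von Neumann.  Among such averages choose one
whose supremum is nearly the least possible value s.  If it took a value below
s - 2 g at V0, then averaging its translates by V0 h^-1, for h in a finite net of
the group, would decrease the supremum by a definite amount, since every V is
close to some h. *)
Lemma orth_mean (R : realType) (N : nat) (phi : 'M[R]_N -> R) (S r g : R) :
  (forall V, orth V -> `|phi V| <= S) -> 0 < r -> 0 < g ->
  (forall V V', orth V -> orth V' -> frob2 (V - V') <= r -> phi V <= phi V' + g) ->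
  exists (I : finType) (U : I -> 'M[R]_N) (s : R), [/\ (0 < #|I|)%N,
    forall i, orth (U i) &
    forall V, orth V -> s - 2 * g <= mean (fun i => phi (U i *m V)) <= s + g].
Proof.
move=> phiS r0 g0 phic.
pose A : set R := [set a | exists (I : finType) (U : I -> 'M[R]_N), [/\ (0 < #|I|)%N,
    forall i, orth (U i) &
    forall V, orth V -> mean (fun i => phi (U i *m V)) <= a]].
have meanS (I : finType) (h : I -> R) a : (0 < #|I|)%N ->
    (forall i, h i <= a) -> mean h <= a.
  move=> I0 hS; rewrite /mean mulrC ler_pdivrMr ?ltr0n//.
  by rewrite (le_trans (ler_sum _ (fun i _ => hS i)))// sumr_const mulr_natr.
have meanN (I : finType) (h : I -> R) : mean (fun i => - h i) = - mean h.
  by rewrite /mean sumrN mulrN.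
have phi1 V : orth V -> phi V <= S by move=> /phiS; rewrite ler_norml => /andP[].
have phi2 V : orth V -> - phi V <= S.
  by move=> /phiS; rewrite ler_norml lerNl => /andP[].
have infA : has_inf A.
  split.
    exists S, unit, (fun=> 1%:M); split; rewrite ?card_unit//.
      by move=> _; exact: orth1.
    move=> V hV; apply: meanS => [|i]; first by rewrite card_unit.
    by rewrite mul1mx phi1.
  exists (- S) => a [I [U [I0 hU /(_ _ (orth1 R N))]]]; apply: le_trans.
  rewrite lerNl -meanN; apply: meanS => // i; rewrite mulmx1; exact: phi2.
have [C [h [hC net]]] := @orth_net R N r r0.
have C0 : (0 < #|C|)%N.
  by have [c _] := net _ (orth1 R N); apply/card_gt0P; exists c.
have C0R : 0 < #|C|%:R :> R by rewrite ltr0n.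
set s := inf A.
have [a [I [U [I0 hU ha]]] as_] : exists2 a, A a & a < s + g / #|C|%:R.
  by apply: inf_adherent => //; rewrite divr_gt0.
exists I, U, s; split => // V0 hV0; apply/andP; split; last first.
  rewrite (le_trans (ha _ hV0))// (le_trans (ltW as_))// lerD2l ler_pdivrMr//.
  by rewrite ler_peMr ?ler1n// ltW.
rewrite leNgt; apply/negP => low.
pose a' := a - (a - (s - g)) / #|C|%:R.
have : A a'.
  exists (C * I)%type, (fun p => U p.2 *m V0 *m (h p.1)^T); split.
  - by rewrite card_prod muln_gt0 C0.
  - by move=> p; apply: orthM (orthT (hC _)); exact: orthM.
  move=> V hV; have [c hc] := net V hV.
  pose W d := V0 *m (h d)^T *m V.
  have hW d : orth (W d) by apply: orthM => //; apply: orthM => //; exact: orthT.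
  have -> : mean (fun p : C * I => phi (U p.2 *m V0 *m (h p.1)^T *m V)) =
      mean (fun d => mean (fun i => phi (U i *m W d))).
    rewrite /mean card_prod natrM invfM -mulrA; congr (_ * _).
    rewrite -mulr_sumr; congr (_ * _).
    rewrite pair_bigA /=; apply: eq_bigr => p _.
    by rewrite /W !mulmxA.
  have Wc : mean (fun i => phi (U i *m W c)) <= s - g.
    suff : mean (fun i => phi (U i *m W c)) <= mean (fun i => phi (U i *m V0)) + g.
      by move: low; lra.
    rewrite -lerBlDl /mean -mulrBr -sumrB; apply: meanS => // i.
    rewrite lerBlDl; apply: phic; [exact: orthM|exact: orthM|].
    rewrite -mulmxBr frob2_orth//.
    have -> : W c - V0 = V0 *m (h c)^T *m (V - h c).
      by rewrite mulmxBr /W -(mulmxA V0 _ (h c)) hC mulmx1.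
    by rewrite frob2_orth//; apply: orthM => //; exact: orthT.
  rewrite /mean (bigD1 c)//=.
  have rest : \sum_(d | d != c) mean (fun i => phi (U i *m W d)) <= (#|C|%:R - 1) * a.
    apply: (@le_trans _ _ (\sum_(d | d != c) a)); first by apply: ler_sum => d _; exact: ha.
    rewrite sumr_const (_ : #|_| = #|C|.-1); last by rewrite cardC1.
    by rewrite -[leLHS]mulr_natl -subn1 natrB.
  rewrite mulrC ler_pdivrMr// /a' mulrBl divfK ?gt_eqF//.
  by move: rest Wc; rewrite /mean mulrBl; lra.
move=> /(ge_inf infA.2).
have as2 : (a - s) * #|C|%:R < g by rewrite -ltr_pdivlMr//; lra.
rewrite -/s -(ler_pM2r C0R) /a' mulrBl divfK ?gt_eqF//.
have : 1 <= #|C|%:R :> R by rewrite ler1n.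
have sa : s <= a.
  by apply: ge_inf; [exact: infA.2|exists I, U].
nra.
Qed.

(** Averaging the hypothesis over the translations U of orth_mean replaces the mean
over signs by the constant s, which does not depend on W. *)
Lemma orth_invariant (R : realType) (N : nat) (phi : 'M[R]_N -> R) (S r g ka : R) :
  (forall V, orth V -> `|phi V| <= S) -> 0 < r -> 0 < g ->
  (forall V V', orth V -> orth V' -> frob2 (V - V') <= r -> phi V <= phi V' + g) ->
  (forall U W, orth U -> orth W ->
    `|expect (fun e => phi (U *m diag_mx (\row_i rsign R e i) *m W)) - phi W| <= ka) ->
  forall W, orth W -> `|phi W - phi 1%:M| <= 2 * ka + 4 * g.
Proof.
move=> phiS r0 g0 phic hka.
have [I [U [s [I0 hU hs]]]] := orth_mean phiS r0 g0 phic.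
have I0R : 0 < #|I|%:R :> R by rewrite ltr0n.
have main W : orth W -> s - 2 * g - ka <= phi W <= s + g + ka.
  move=> hW; pose D (e : signs N) : 'M[R]_N := diag_mx (\row_i rsign R e i).
  have hD e : orth (D e).
    rewrite /orth /D tr_diag_mx mulmx_diag; apply/matrixP => i j.
    by rewrite !mxE -expr2 rsign_sqr.
  pose psi V := mean (fun i => phi (U i *m V)).
  have h1 : `|expect (fun e => psi (D e *m W)) - phi W| <= ka.
    have -> : expect (fun e => psi (D e *m W)) =
        mean (fun i => expect (fun e => phi (U i *m D e *m W))).
      rewrite /psi /mean expectZ expect_sum; congr (_ * _); apply: eq_bigr => i _.
      by congr expect; apply: funext => e; rewrite mulmxA.
    have -> : phi W = #|I|%:R^-1 * \sum_(i : I) phi W.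
      by rewrite sumr_const -[X in _ * X]mulr_natl mulKf ?gt_eqF.
    rewrite /mean -mulrBr -sumrB normrM gtr0_norm ?invr_gt0// mulrC ler_pdivrMr//.
    rewrite (le_trans (ler_norm_sum _ _ _))//.
    rewrite (le_trans (ler_sum _ (fun i _ => hka _ _ (hU i) hW)))//.
    by rewrite sumr_const mulr_natr.
  have h2 : expect (fun e => psi (D e *m W)) <= s + g.
    rewrite -[leRHS](expect_cst N); apply: expect_le => e.
    by have /andP[] := hs _ (orthM (hD e) hW).
  have h3 : s - 2 * g <= expect (fun e => psi (D e *m W)).
    rewrite -[leLHS](expect_cst N); apply: expect_le => e.
    by have /andP[] := hs _ (orthM (hD e) hW).
  by move: h1; rewrite ler_norml; lra.
move=> W hW; have := main _ hW; have := main _ (orth1 R N).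
by rewrite ler_norml; lra.
Qed.

(** * Nearly quadratic functions and rotations *)

Definition near_quadratic (R : realType) (n : nat) (F : 'rV[R]_n -> R)
    (d S : R) : Prop :=
  [/\ forall a x, F (a *: x) = a ^+ 2 * F x,
      forall x y, `|F (x + y) + F (x - y) - 2 * F x - 2 * F y| <=
        d * (dot x x + dot y y) &
      forall x, `|F x| <= S * dot x x].

Lemma dot_add_le (R : realType) (n : nat) (x y : 'rV[R]_n) :
  dot (x + y) (x + y) <= 2 * dot x x + 2 * dot y y.
Proof.
have := dot_ge0 (x - y); rewrite !(dotDl, dotDr, dotNl, dotNr) (dotC y x); lra.
Qed.

(** A near quadratic function is continuous up to its own defect: on the segment
from x to x + la h, with la large and la h small, F is nearly affine with a defect
close to d |x| ^ 2, and x + h divides it in the ratio 1 / la. *)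
Lemma near_quadratic_continuity (R : realType) (n : nat) (F : 'rV[R]_n -> R)
    (d S T g : R) : near_quadratic F d S -> 0 <= d -> 0 <= S -> 0 <= T -> 0 < g ->
  exists2 r, 0 < r & forall x h, dot x x <= T -> dot h h <= r ->
    `|F (x + h) - F x| <= 2 * d * dot x x + g.
Proof.
move=> [FZ Fd FS] d0 S0 T0 g0.
pose e := g / (g + S + 5 * d).
have den : 0 < g + S + 5 * d by lra.
have e0 : 0 < e by rewrite divr_gt0.
have e1 : e <= 1 by rewrite ler_pdivrMr//; lra.
have eden : e * (g + S + 5 * d) = g by rewrite /e divfK ?gt_eqF.
have eC : (S / 2 + 9 / 4 * d) * e <= g / 2 by nra.
pose la := 1 + 2 * S * (3 * T + 2) / g.
have la1 : 1 <= la by rewrite /la lerDl !mulr_ge0// ?invr_ge0 ?ltW//; lra.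
have la0 : 0 < la by lra.
have laC : S * (3 * T + 2) / la <= g / 2.
  rewrite ler_pdivrMr// /la [leRHS]mulrDr mulr1.
  rewrite (_ : g / 2 * (_ / g) = S * (3 * T + 2)); last by field; rewrite gt_eqF.
  by rewrite lerDr; lra.
(* With this radius, |h| <= r gives |la h| ^ 2 <= e <= 1. *)
exists (e / la ^+ 2); first by rewrite divr_gt0// exprn_gt0.
move=> x h xT hr.
have hq : la ^+ 2 * dot h h <= e by rewrite mulrC -ler_pdivlMr// exprn_gt0.
pose y := x + la *: h.
pose K : set 'rV[R]_n := [set z | exists2 s, 0 <= s <= 1 & z = x + s *: (la *: h)].
have cK : cvx K.
  move=> _ _ t [a /andP[a0 a1] ->] [b /andP[b0 b1] ->] t0 t1.
  exists ((1 - t) * a + t * b); last by apply/rowP => i; rewrite !mxE; ring.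
  by apply/andP; split; nra.
have q0 : 0 <= dot x x by exact: dot_ge0.
have lq : dot (la *: h) (la *: h) <= e by rewrite dotZl dotZr mulrA -expr2.
have l0 : 0 <= dot (la *: h) (la *: h) by exact: dot_ge0.
have Kq z : K z -> dot z z <= 2 * dot x x + 2 * e.
  move=> [s /andP[s0 s1] ->]; apply: (le_trans (dot_add_le _ _)).
  rewrite lerD2l ler_pM2l// dotZl dotZr mulrA.
  have : s * s <= 1 by nra.
  have : 0 <= s * s by nra.
  nra.
pose m := S * e / 4 + d / 2 * (2 * dot x x + 2 * e + e / 4).
have gK : forall z, K z -> `|F z| <= S * (2 * dot x x + 2 * e).
  by move=> z Kz; rewrite (le_trans (FS z))// ler_wpM2l// Kq.
have nK : nearly_affine K F m.
  move=> u v Ku Kv.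
  have Km : K (2^-1 *: (u + v)).
    rewrite (_ : _ *: _ = (1 - 2^-1) *: u + 2^-1 *: v).
      by apply: cK => //; lra.
    by apply/rowP => i; rewrite !mxE; field.
  pose w := 2^-1 *: (u - v).
  have wq : dot w w <= e / 4.
    move: Ku Kv => [a /andP[a0 a1] ua] [b /andP[b0 b1] vb].
    have -> : w = ((a - b) / 2) *: (la *: h).
      by apply/rowP => i; rewrite /w ua vb !mxE; field.
    rewrite dotZl dotZr mulrA.
    have : (a - b) / 2 * ((a - b) / 2) <= 1 / 4 by nra.
    have : 0 <= (a - b) / 2 * ((a - b) / 2) by rewrite -expr2 sqr_ge0.
    nra.
  have := Fd (2^-1 *: (u + v)) w.
  have -> : 2^-1 *: (u + v) + w = u by apply/rowP => i; rewrite /w !mxE; field.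
  have -> : 2^-1 *: (u + v) - w = v by apply/rowP => i; rewrite /w !mxE; field.
  have := Kq _ Km; have := FS w; have := dot_ge0 w.
  set mid := 2^-1 *: (u + v); move: (dot w w) wq (dot mid mid) (F w) => a wa b c a0 c1 b1.
  have S1 : S * a <= S * (e / 4) by rewrite ler_wpM2l.
  have S2 : d * (b + a) <= d * (2 * dot x x + 2 * e + e / 4).
    by rewrite ler_wpM2l//; lra.
  by move: c1; rewrite /m !ler_norml; lra.
have Kx : K x by exists 0; rewrite ?lexx ?ler01// scale0r addr0.
have Ky : K y by exists 1; rewrite ?lexx ?ler01// scale1r.
have il0 : 0 <= la^-1 by rewrite invr_ge0 ltW.
have il1 : la^-1 <= 1 by rewrite invf_le1.
have := affine_defect cK gK nK Kx Ky il0 il1.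
have -> : (1 - la^-1) *: x + la^-1 *: y = x + h.
  by apply/rowP => i; rewrite /y !mxE; field; rewrite gt_eqF.
have : `|(F y - F x) / la| <= g / 2.
  rewrite normrM (gtr0_norm (x := la^-1)) ?invr_gt0//.
  apply: le_trans laC; rewrite ler_pM2r ?invr_gt0//.
  have := gK _ Ky; have := FS x; rewrite !ler_norml => /andP[u1 u2] /andP[u3 u4].
  have h1 : S * dot x x <= S * T by rewrite ler_wpM2l.
  have h2 : S * e <= S * 1 by rewrite ler_wpM2l.
  have E1 : S * (2 * dot x x + 2 * e) = 2 * (S * dot x x) + 2 * (S * e) by ring.
  have E2 : S * (3 * T + 2) = 3 * (S * T) + 2 * S by ring.
  rewrite E1 in u3 u4; rewrite E2; apply/andP; split; lra.
by rewrite /m !ler_norml mulrBl; lra.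
Qed.

Definition rowsum (R : realType) (n N : nat) (F : 'rV[R]_n -> R)
    (X : 'M[R]_(N, n)) : R := \sum_i F (row i X).

Lemma frob2_ge0 (R : realType) (m n : nat) (A : 'M[R]_(m, n)) : 0 <= frob2 A.
Proof. by apply: sumr_ge0 => i _; exact: dot_ge0. Qed.

Lemma row_le_frob2 (R : realType) (m n : nat) (A : 'M[R]_(m, n)) i :
  dot (row i A) (row i A) <= frob2 A.
Proof.
rewrite /frob2 (bigD1 i)//= lerDl; apply: sumr_ge0 => j _; exact: dot_ge0.
Qed.

Lemma dot_cs (R : realType) (n : nat) (x y : 'rV[R]_n) :
  dot x y ^+ 2 <= dot x x * dot y y.
Proof.
have [y0|y0] := eqVneq (dot y y) 0.
  by rewrite (dot_eq0 y0) !dot0r expr0n mulr0.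
have yp : 0 < dot y y by rewrite lt_neqAle eq_sym y0 dot_ge0.
have := dot_ge0 (dot y y *: x - dot x y *: y).
rewrite !(dotDl, dotDr, dotNl, dotNr, dotZl, dotZr) (dotC y x) => h.
rewrite -(ler_pM2l yp); nra.
Qed.

Lemma frob2_mul (R : realType) (m n p : nat) (A : 'M[R]_(m, n)) (B : 'M[R]_(n, p)) :
  frob2 (A *m B) <= frob2 A * frob2 B.
Proof.
have -> : frob2 B = \sum_(j < p) dot (row j B^T) (row j B^T).
  rewrite /frob2 /dot exchange_big; apply: eq_bigr => j _; apply: eq_bigr => i _.
  by rewrite !mxE.
rewrite {2}/frob2 mulr_suml; apply: ler_sum => i _.
rewrite mulr_sumr [leLHS]/dot; apply: ler_sum => j _.
rewrite -expr2 (_ : row i _ _ _ = dot (row i A) (row j B^T)) ?dot_cs//.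
by rewrite !mxE; apply: eq_bigr => k _; rewrite !mxE.
Qed.

(** Row k of U D (V X) is the sum of the vectors U k i (V X)_i with random signs, so
rademacher compares the mean of F there with \sum_i U k i ^ 2 F ((V X)_i); summing
over k restores \sum_i F ((V X)_i), because the columns of U have norm 1. *)
Lemma rowsum_orth (R : realType) (n N k : nat) (F : 'rV[R]_n -> R) (d S T : R)
    (X : 'M[R]_(N, n)) (W : 'M[R]_N) :
  near_quadratic F d S -> 0 <= d -> 0 <= S -> (N <= 2 ^ k)%N -> orth W ->
  frob2 X <= T -> 0 < T ->
  `|rowsum F (W *m X) - rowsum F X| <= (d * k%:R + 8 * d + 4) * T.
Proof.
move=> nq d0 S0 Nk hW XT T0; have [FZ Fd FS] := nq.
pose phi (V : 'M[R]_N) := rowsum F (V *m X).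
have X0 := frob2_ge0 X.
have rowsumS (Y : 'M[R]_(N, n)) : `|rowsum F Y| <= S * frob2 Y.
  rewrite (le_trans (ler_norm_sum _ _ _))// mulr_sumr; apply: ler_sum => i _.
  exact: FS.
have phiS V : orth V -> `|phi V| <= S * frob2 X.
  by move=> hV; rewrite (le_trans (rowsumS _))// frob2_orth.
have [N0|N0] := posnP N.
  rewrite /rowsum; move: X W {hW phi X0 rowsumS phiS} XT; rewrite N0 => X W _.
  rewrite !big_ord0 subrr normr0 mulr_ge0// ?ltW//.
  have : 0 <= d * k%:R by rewrite mulr_ge0.
  lra.
have N0R : 0 < N%:R :> R by rewrite ltr0n.
have TN : 0 < T / N%:R by rewrite divr_gt0.
have [r r0 hr] := near_quadratic_continuity nq d0 S0 (ltW T0) TN.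
pose g := (2 * d + 1) * T.
have g0 : 0 < g by rewrite mulr_gt0//; lra.
have phic V V' : orth V -> orth V' -> frob2 (V - V') <= r / T -> phi V <= phi V' + g.
  move=> hV hV' VV'; rewrite -lerBlDl /phi /rowsum -sumrB.
  apply: (@le_trans _ _ (\sum_i (2 * d * dot (row i (V' *m X)) (row i (V' *m X)) + T / N%:R))).
    apply: ler_sum => i _; apply: (le_trans (ler_norm _)).
    have -> : row i (V *m X) = row i (V' *m X) + row i ((V - V') *m X).
      by rewrite mulmxBl !linearB /= addrC subrK.
    apply: hr.
      by rewrite (le_trans (row_le_frob2 _ _))// frob2_orth.
    rewrite (le_trans (row_le_frob2 _ _))// (le_trans (frob2_mul _ _))//.
    rewrite ler_pdivlMr// in VV'; apply: le_trans VV'.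
    by rewrite ler_wpM2l// frob2_ge0.
  rewrite big_split /= -mulr_sumr sumr_const card_ord -[X in _ + X]mulr_natr.
  rewrite divfK ?gt_eqF// -[\sum_i _]/(frob2 (V' *m X)) frob2_orth// /g.
  have : 2 * d * frob2 X <= 2 * d * T by rewrite ler_wpM2l// mulr_ge0.
  lra.
pose ka := d / 2 * k%:R * T.
have hka U V : orth U -> orth V ->
    `|expect (fun e => phi (U *m diag_mx (\row_i rsign R e i) *m V)) - phi V| <= ka.
  move=> hU hV; pose Y := V *m X.
  have YT : frob2 Y <= T by rewrite frob2_orth.
  pose x l i := U l i *: row i Y.
  have E e l : row l (U *m diag_mx (\row_i rsign R e i) *m V *m X) =
      rsum (x l) finset.setT e.
    rewrite /rsum -!mulmxA -/Y row_mul; apply/rowP => j.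
    rewrite !mxE summxE; apply: eq_big => [i|i _]; first by rewrite finset.inE.
    rewrite !mxE (bigD1 i)//= big1 => [|b bi].
      by rewrite !mxE eqxx mulr1n addr0; ring.
    by rewrite !mxE eq_sym (negbTE bi) mulr0n mul0r.
  rewrite {1}/phi /rowsum expect_sum.
  have -> : phi V = \sum_l \sum_i F (x l i).
    rewrite exchange_big; apply: eq_bigr => i _ /=.
    rewrite (eq_bigr (fun l => U l i ^+ 2 * F (row i Y))); last by move=> l _; exact: FZ.
    rewrite -mulr_suml; have := congr1 (fun A : 'M[R]_N => A i i) hU.
    rewrite !mxE eqxx => h; rewrite -[LHS]mul1r; congr (_ * _); rewrite -[LHS]h.
    by apply: eq_bigr => l _; rewrite mxE expr2.
  rewrite -sumrB (le_trans (ler_norm_sum _ _ _))//.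
  apply: (@le_trans _ _ (\sum_l d / 2 * k%:R * \sum_i dot (x l i) (x l i))).
    apply: ler_sum => l _.
    have := @rademacher R n F d FZ Fd d0 k N (x l) finset.setT.
    rewrite cardsT card_ord => /(_ Nk); rewrite !(eq_bigl _ _ (@finset.in_setT _)).
    move=> h; apply: le_trans h; rewrite (_ : expect _ = expect (fun e => F (rsum (x l) finset.setT e)))//.
    by congr expect; apply: funext => e; rewrite E.
  rewrite -mulr_sumr ler_wpM2l ?mulr_ge0 ?divr_ge0//.
  apply: le_trans YT; rewrite exchange_big; apply: ler_sum => i _ /=.
  rewrite (eq_bigr (fun l => U l i ^+ 2 * dot (row i Y) (row i Y))); last first.
    by move=> l _; rewrite /x dotZl dotZr; ring.
  rewrite -mulr_suml; have := congr1 (fun A : 'M[R]_N => A i i) hU.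
  rewrite !mxE eqxx => h; rewrite -[leRHS]mul1r (_ : \sum_l _ = 1)// -[RHS]h.
  by apply: eq_bigr => l _; rewrite mxE expr2.
have := @orth_invariant R N phi _ _ g ka phiS _ g0 phic hka W hW.
rewrite divr_gt0// /phi mul1mx => /(_ isT) h; apply: (le_trans h).
by rewrite /ka /g; lra.
Qed.

(** * Families with the same Gram matrix *)

Lemma rowsum_col_mx (R : realType) (n N M : nat) (F : 'rV[R]_n -> R)
    (X : 'M[R]_(N, n)) (Y : 'M[R]_(M, n)) :
  rowsum F (col_mx X Y) = rowsum F X + rowsum F Y.
Proof.
rewrite /rowsum big_split_ord; congr (_ + _); apply: eq_bigr => i _; congr F.
  by apply/rowP => j; rewrite !mxE (unsplitK (inl i)).
by apply/rowP => j; rewrite !mxE (unsplitK (inr i)).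
Qed.

Lemma rowsum0 (R : realType) (n N : nat) (F : 'rV[R]_n -> R) :
  F 0 = 0 -> rowsum F (0 : 'M[R]_(N, n)) = 0.
Proof. by move=> F0; rewrite /rowsum big1// => i _; rewrite row0. Qed.

(** C = B M^-1 A^T maps A to B and is a partial isometry with initial and final
projections A M^-1 A^T and B M^-1 B^T; its unitary dilation to twice the dimension
is orthogonal. *)
Lemma orth_extension (R : realType) (n N : nat) (A B : 'M[R]_(N, n)) :
  A^T *m A = B^T *m B -> A^T *m A \in unitmx ->
  exists2 W : 'M[R]_(N + N), orth W &
    W *m col_mx A (0 : 'M[R]_(N, n)) = col_mx B 0.
Proof.
move=> AB Mu; pose M := A^T *m A.
have Ms : M^T = M by rewrite /M trmx_mul trmxK.
have iMs : (invmx M)^T = invmx M by rewrite trmx_inv Ms.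
have BM : B^T *m B = M by rewrite -AB.
pose C := B *m invmx M *m A^T.
have CT : C^T = A *m invmx M *m B^T by rewrite /C !trmx_mul trmxK iMs mulmxA.
pose PA := A *m invmx M *m A^T; pose PB := B *m invmx M *m B^T.
have PAT : PA^T = PA by rewrite /PA !trmx_mul trmxK iMs mulmxA.
have PBT : PB^T = PB by rewrite /PB !trmx_mul trmxK iMs mulmxA.
have cancelA (m p : nat) (X : 'M[R]_(m, n)) (Y : 'M[R]_(n, p)) :
    X *m invmx M *m A^T *m (A *m invmx M *m Y) = X *m invmx M *m Y.
  rewrite !mulmxA -(mulmxA _ A^T A) -/M -(mulmxA _ M (invmx M)) mulmxV//.
  by rewrite mulmx1.
have cancelB (m p : nat) (X : 'M[R]_(m, n)) (Y : 'M[R]_(n, p)) :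
    X *m invmx M *m B^T *m (B *m invmx M *m Y) = X *m invmx M *m Y.
  rewrite !mulmxA -(mulmxA _ B^T B) BM -(mulmxA _ M (invmx M)) mulmxV//.
  by rewrite mulmx1.
have CC : C^T *m C = PA by rewrite CT /C cancelB.
have CCT : C *m C^T = PB by rewrite CT /C cancelA.
have PA2 : PA *m PA = PA by rewrite /PA cancelA.
have PB2 : PB *m PB = PB by rewrite /PB cancelB.
have CPB : C^T *m PB = C^T by rewrite CT /PB cancelB.
have PAC : PA *m C^T = C^T by rewrite CT /PA cancelA.
have PBC : PB *m C = C by rewrite /PB /C cancelB.
have CPA : C *m PA = C by rewrite /PA /C cancelA.
exists (block_mx C (1%:M - PB) (1%:M - PA) (- C^T)).
  have TA : (1%:M - PA)^T = 1%:M - PA by rewrite linearB /= trmx1 PAT.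
  have TB : (1%:M - PB)^T = 1%:M - PB by rewrite linearB /= trmx1 PBT.
  have TC : (- C^T)^T = - C by rewrite linearN /= trmxK.
  rewrite /orth tr_block_mx mulmx_block TA TB TC.
  have -> : C^T *m C + (1%:M - PA) *m (1%:M - PA) = 1%:M.
    by rewrite CC mulmxBl mul1mx mulmxBr mulmx1 PA2 subrr subr0 addrC subrK.
  have -> : C^T *m (1%:M - PB) + (1%:M - PA) *m - C^T = 0.
    by rewrite mulmxBr mulmx1 CPB subrr mulmxN mulmxBl mul1mx PAC subrr oppr0 addr0.
  have -> : (1%:M - PB) *m C + - C *m (1%:M - PA) = 0.
    by rewrite mulmxBl mul1mx PBC subrr mulNmx mulmxBr mulmx1 CPA subrr oppr0 addr0.
  have -> : (1%:M - PB) *m (1%:M - PB) + - C *m - C^T = 1%:M.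
    rewrite mulmxN mulNmx opprK CCT mulmxBl mul1mx mulmxBr mulmx1 PB2 subrr subr0.
    by rewrite subrK.
  by rewrite -scalar_mx_block.
rewrite mul_block_col !mulmx0 !addr0; congr (col_mx _ _).
  by rewrite /C -!mulmxA mulVmx// mulmx1.
by rewrite mulmxBl mul1mx /PA -!mulmxA mulVmx// mulmx1 subrr.
Qed.

(** The rows of a small multiple of the identity are added to both families: this
makes the Gram matrix invertible, as orth_extension requires, and contributes the
same terms to both sums. *)
Lemma rowsum_gram (R : realType) (n N k : nat) (F : 'rV[R]_n -> R) (d S T : R)
    (X Y : 'M[R]_(N, n)) :
  near_quadratic F d S -> 0 <= d -> 0 <= S -> (0 < n)%N ->
  (2 * (N + n) <= 2 ^ k)%N ->
  X^T *m X = Y^T *m Y -> frob2 X <= T -> 0 < T ->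
  `|rowsum F Y - rowsum F X| <= (d * k%:R + 8 * d + 4) * (2 * T).
Proof.
move=> nq d0 S0 n0 Nk XY XT T0.
have n0R : 0 < n%:R :> R by rewrite ltr0n.
(* The added rows have squared norms of sum n t ^ 2 = T. *)
pose t := Num.sqrt (T / n%:R).
have t0 : 0 < t by rewrite sqrtr_gt0 divr_gt0.
pose D : 'M[R]_n := t%:M.
pose A := col_mx X D; pose B := col_mx Y D.
have AB : A^T *m A = B^T *m B by rewrite !tr_col_mx !mul_row_col XY.
have Mu : A^T *m A \in unitmx.
  rewrite -row_free_unit; apply: inj_row_free => v hv.
  have : v *m A^T = 0.
    apply: dot_eq0; rewrite -dot_mulmx -mulmxA hv dot0l.
    by [].
  rewrite tr_col_mx mul_mx_row => /(congr1 rsubmx); rewrite row_mxKr linear0.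
  rewrite /D tr_scalar_mx mul_mx_scalar => /eqP.
  by rewrite scaler_eq0 gt_eqF// => /eqP.
have [W hW WA] := orth_extension AB Mu.
have F0 : F 0 = 0 by have [FZ _ _] := nq; rewrite -(scale0r 0) FZ expr0n mul0r.
have bound : frob2 (col_mx A (0 : 'M[R]_(N + n, n))) <= 2 * T.
  have E : frob2 (col_mx A (0 : 'M[R]_(N + n, n))) = frob2 X + frob2 D.
    have fr m (Z : 'M[R]_(m, n)) : frob2 Z = rowsum (fun x => dot x x) Z by [].
    by rewrite !fr /A !rowsum_col_mx rowsum0 ?dot0l// addr0.
  rewrite E (_ : frob2 D = T); first lra.
  rewrite frob2E /D tr_scalar_mx -scalar_mxM mxtrace_scalar -expr2 sqr_sqrtr.
    by rewrite -[LHS]mulr_natr divfK ?gt_eqF.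
  by rewrite divr_ge0 ?ltW.
have Nk' : ((N + n) + (N + n) <= 2 ^ k)%N by rewrite addnn -mul2n.
have T2 : 0 < 2 * T by rewrite mulr_gt0.
have := rowsum_orth nq d0 S0 Nk' hW bound T2.
rewrite WA !rowsum_col_mx (rowsum0 _ F0) !addr0.
by rewrite opprD addrACA subrr addr0.
Qed.

(** The coordinates of x^T x play the role of the functions v_j in linear_selection.
An annihilating combination of them says that the vectors sqrt (c_i) x_i with
c_i > 0 and the vectors sqrt (- c_i) x_i with c_i < 0 have the same Gram matrix. *)
Lemma near_quadratic_ball (R : realType) (n k : nat) (F : 'rV[R]_n -> R) (d S : R) :
  near_quadratic F d S -> 0 <= d -> 0 <= S -> (0 < n)%N ->
  (2 * ((n * n).+1 + n) <= 2 ^ k)%N ->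
  exists A : 'M[R]_n, forall x, dot x x <= 1 ->
    `|F x - dot (x *m A) x| <= (d * k%:R + 8 * d + 4) * 2.
Proof.
move=> nq d0 S0 n0 nk.
have [FZ Fd FS] := nq.
pose T := {x : 'rV[R]_n | dot x x <= 1}.
pose I := ('I_n * 'I_n)%type.
pose v (j : 'I_#|{: I}|) (x : T) : R :=
  sval x ord0 (enum_val j).1 * sval x ord0 (enum_val j).2.
have [l hl] : exists l : 'I_#|{: I}| -> R, forall x : T,
    `|F (sval x) - \sum_j l j * v j x| <= (d * k%:R + 8 * d + 4) * 2.
  apply: (@linear_selection R _ T v (fun x => F (sval x))).
  apply: (@annihilator_caratheodory R _ T v (fun x => F (sval x))) => N c x Nn hv.
  rewrite card_prod card_ord in Nn.
  have [c0|/existsNP[i0 /eqP ci0]] := pselect (forall i, c i = 0).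
    rewrite big1; last by move=> i _; rewrite c0 mul0r.
    by rewrite big1 ?mulr0// => i _; rewrite c0 normr0.
  pose cp i := Num.max (c i) 0; pose cm i := Num.max (- c i) 0.
  have cp0 i : 0 <= cp i by rewrite /cp le_max lexx orbT.
  have cm0 i : 0 <= cm i by rewrite /cm le_max lexx orbT.
  have cE i : c i = cp i - cm i by rewrite /cp /cm; case: (leP (c i) 0);
    case: (leP (- c i) 0); lra.
  have cpn i : cp i <= `|c i| by rewrite /cp ge_max normr_ge0 ler_norm.
  pose X : 'M[R]_(N, n) := \matrix_i (Num.sqrt (cp i) *: sval (x i)).
  pose Y : 'M[R]_(N, n) := \matrix_i (Num.sqrt (cm i) *: sval (x i)).
  have XE i : row i X = Num.sqrt (cp i) *: sval (x i) by rewrite rowK.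
  have YE i : row i Y = Num.sqrt (cm i) *: sval (x i) by rewrite rowK.
  have abs0 : 0 < \sum_i `|c i|.
    by rewrite (bigD1 i0)//= ltr_pwDl ?normr_gt0// sumr_ge0.
  have XY : X^T *m X = Y^T *m Y.
    apply/matrixP => a b; rewrite !mxE; apply/eqP; rewrite -subr_eq0 -sumrB.
    have := hv (enum_rank (a, b)); rewrite /v enum_rankK /= => {2}<-.
    apply/eqP/eq_bigr => i _; rewrite !mxE cE.
    rewrite mulrACA -expr2 sqr_sqrtr// mulrACA -expr2 sqr_sqrtr//.
    by rewrite mulrBl.
  have XT : frob2 X <= \sum_i `|c i|.
    apply: ler_sum => i _; rewrite XE dotZl dotZr mulrA -expr2 sqr_sqrtr//.
    apply: le_trans (cpn i); rewrite ler_piMr//; exact: (svalP (x i)).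
  have Nk : (2 * (N + n) <= 2 ^ k)%N.
    by rewrite (leq_trans _ nk)// leq_mul2l /= leq_add2r.
  have := rowsum_gram nq d0 S0 n0 Nk XY XT abs0.
  rewrite distrC => h; have {h} := le_trans (ler_norm _) h.
  rewrite mulrA; apply: le_trans.
  rewrite /rowsum -sumrB le_eqVlt; apply/orP; left; apply/eqP.
  apply: eq_bigr => i _; rewrite XE YE !FZ !sqr_sqrtr// cE; ring.
exists (\matrix_(i, j) l (enum_rank (i, j))) => x hx.
have := hl (exist _ x hx); rewrite /v /=.
rewrite (reindex (@enum_rank I)) /=; last by apply: onW_bij; exact: enum_rank_bij.
rewrite (_ : \sum_j _ = dot (x *m \matrix_(i, j) l (enum_rank (i, j))) x)//.
rewrite /dot; under [RHS]eq_bigr do rewrite mxE mulr_suml.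
rewrite exchange_big pair_bigA /=; apply: eq_bigr => p _.
by rewrite enum_rankK !mxE -surjective_pairing; ring.
Qed.

(** * Even functions on the Euclidean ball *)

(** The polarization is nearly linear in each variable along the segment from 0
to x / 2, and f (2 z) is 4 times its value at (z, z). *)
Lemma near_homogeneous (R : realType) (n : nat) (K : set 'rV[R]_n)
    (f : 'rV[R]_n -> R) (S : R) :
  cvx K -> symm K -> third_diff_le1 K f -> (forall x, K x -> `|f x| <= S) ->
  (forall x, f (- x) = f x) -> f 0 = 0 ->
  forall t x, 0 <= t -> t <= 1 -> K (8 *: x) -> `|f (t *: x) - t ^+ 2 * f x| <= 14.
Proof.
move=> cK sK f3 fS fe f0 t x t0 t1 Kx.
pose z := 2^-1 *: x.
have Kz : K (16 *: z) by rewrite /z scalerA (_ : 16 * 2^-1 = 8)//; field.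
have Ktz : K (16 *: (t *: z)).
  rewrite scalerA mulrC -scalerA; apply: mem_scale => //.
  by rewrite ger0_norm.
pose K' : set 'rV[R]_n := [set x | K (16 *: x)].
have cK' : cvx K' by exact: cvx_dilate.
have K0 : K' 0.
  by rewrite /K' /= scaler0 -(scale0r (8 *: x)); apply: mem_scale => //; rewrite normr0.
have pS y : K' y -> forall a, K' a -> `|polarization f a y| <= S / 2.
  by move=> Ky a Ka; exact: (polarization_bounded cK sK fS).
have step y : K' y -> `|polarization f (t *: z) y - t * polarization f z y| <= 7 / 4.
  move=> Ky; have := affine_defect cK' (pS y Ky) (polarization_nearly_affine cK sK f3 Ky)
    K0 Kz t0 t1.
  rewrite scaler0 add0r.
  have -> : polarization f 0 y = 0 by rewrite /polarization add0r sub0r fe subrr mul0r.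
  rewrite mulr0 add0r => h; apply: (le_trans h); lra.
have h1 := step _ Ktz; have h2 := step _ Kz.
rewrite (polarizationC z (t *: z) fe) in h1.
have fz a : f (a *: x) = 4 * polarization f (a *: z) (a *: z).
  rewrite /polarization subrr f0 subr0 mulrC divfK//; congr f.
  by apply/rowP => i; rewrite /z !mxE; field.
have := fz 1; rewrite !scale1r => ->; rewrite fz.
have h3 : `|t * polarization f (t *: z) z - t ^+ 2 * polarization f z z| <= 7 / 4.
  rewrite expr2 -mulrA -mulrBr normrM (ger0_norm t0).
  have := normr_ge0 (polarization f (t *: z) z - t * polarization f z z); nra.
by move: h1 h3; rewrite !ler_norml; lra.
Qed.

(** The extension, homogeneous of degree 2, of the restriction of f to the sphere of
radius 1 / 8. *)
Definition homogenize (R : realType) (n : nat) (f : 'rV[R]_n -> R)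
    (x : 'rV[R]_n) : R :=
  64 * dot x x * f ((8 * Num.sqrt (dot x x))^-1 *: x).

(** The Euclidean unit ball, described without square roots. *)
Definition dot_ball (R : realType) (n : nat) : set 'rV[R]_n := [set x | dot x x <= 1].
Arguments dot_ball : clear implicits.

Lemma dot_ball_cvx (R : realType) (n : nat) : cvx (dot_ball R n).
Proof.
move=> x y t; rewrite /dot_ball /= => x1 y1 t0 t1.
rewrite !(dotDl, dotDr, dotZl, dotZr) (dotC y x).
have : 2 * dot x y <= dot x x + dot y y.
  have := dot_ge0 (x - y); rewrite !(dotDl, dotDr, dotNl, dotNr) (dotC y x); lra.
have : 0 <= t * (1 - t) by rewrite mulr_ge0// subr_ge0.
nra.
Qed.

Lemma dot_ball_symm (R : realType) (n : nat) : symm (dot_ball R n).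
Proof. by move=> x; rewrite /dot_ball /= dotNl dotNr opprK. Qed.

Lemma homogenize_close (R : realType) (n : nat) (f : 'rV[R]_n -> R) (S : R) :
  third_diff_le1 (dot_ball R n) f -> (forall x, dot_ball R n x -> `|f x| <= S) ->
  (forall x, f (- x) = f x) -> f 0 = 0 ->
  forall x, dot_ball R n (8 *: x) -> `|homogenize f x - f x| <= 14.
Proof.
move=> f3 fS fe f0 x Kx.
have [x0|x0] := eqVneq (dot x x) 0.
  by rewrite /homogenize (dot_eq0 x0) dot0l mulr0 mul0r f0 subrr normr0.
have xp : 0 < dot x x by rewrite lt_neqAle eq_sym x0 dot_ge0.
set s := Num.sqrt (dot x x).
have s0 : 0 < s by rewrite sqrtr_gt0.
have ss : s ^+ 2 = dot x x by rewrite sqr_sqrtr// dot_ge0.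
have s1 : 8 * s <= 1.
  rewrite -(ler_pXn2r (n := 2))// ?nnegrE ?mulr_ge0 ?(ltW s0)// expr1n exprMn ss.
  by move: Kx; rewrite /dot_ball /= dotZl dotZr mulrA expr2.
pose u := (8 * s)^-1 *: x.
have xu : x = (8 * s) *: u by rewrite /u scalerA divff ?scale1r// gt_eqF// mulr_gt0.
have Ku : dot_ball R n (8 *: u).
  rewrite /dot_ball /= /u !(dotZl, dotZr) -ss invfM le_eqVlt; apply/orP; left.
  by apply/eqP; field; rewrite gt_eqF.
have s8 : 0 <= 8 * s by rewrite mulr_ge0// ltW.
have := near_homogeneous (@dot_ball_cvx R n) (@dot_ball_symm R n) f3 fS fe f0 s8 s1 Ku.
rewrite -xu distrC /homogenize -/s -/u exprMn ss.
by rewrite (_ : 8 ^+ 2 = 64)//; ring.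
Qed.

(** By homogeneity it is enough to treat pairs with |x| ^ 2 + |y| ^ 2 = 1 / 128.  For
these x, y, x + y and x - y lie in the ball of radius 1 / 8, where homogenize f is
within 14 of f, and sdiff_var bounds the defect of f; 91 = 7 + 6 * 14. *)
Lemma homogenize_near_quadratic (R : realType) (n : nat) (f : 'rV[R]_n -> R) (S : R) :
  third_diff_le1 (dot_ball R n) f -> (forall x, dot_ball R n x -> `|f x| <= S) ->
  (forall x, f (- x) = f x) -> f 0 = 0 ->
  near_quadratic (homogenize f) (91 * 128) (64 * S).
Proof.
move=> f3 fS fe f0.
have FZ a x : homogenize f (a *: x) = a ^+ 2 * homogenize f x.
  rewrite /homogenize dotZl dotZr.
  have [->|a0] := eqVneq a 0; first by rewrite !mul0r mulr0 mul0r expr0n mul0r.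
  have -> : f ((8 * Num.sqrt (a * (a * dot x x)))^-1 *: (a *: x)) =
      f ((8 * Num.sqrt (dot x x))^-1 *: x).
    rewrite mulrA -expr2 sqrtrM ?sqr_ge0// sqrtr_sqr scalerA.
    have [ap|an] := ltP 0 a.
      rewrite gtr0_norm//; congr f; congr (_ *: _).
      by rewrite mulrCA invfM mulrAC mulVf ?mul1r// gt_eqF.
    rewrite ler0_norm// -[RHS]fe -scaleNr; congr f; congr (_ *: _).
    by rewrite mulNr mulrN invrN mulNr mulrCA invfM mulrAC mulVf ?mul1r.
  ring.
split => //; last first.
  move=> x; have S0 : 0 <= S.
    by have := fS 0; rewrite /dot_ball /= dot0l f0 normr0; apply.
  rewrite /homogenize normrM ger0_norm ?mulr_ge0 ?dot_ge0//.
  rewrite (mulrAC 64 S); apply: ler_wpM2l; first by rewrite mulr_ge0 ?dot_ge0.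
  have [x0|x0] := eqVneq (dot x x) 0.
    by rewrite (dot_eq0 x0) scaler0 f0 normr0.
  have xp : 0 < dot x x by rewrite lt_neqAle eq_sym x0 dot_ge0.
  apply: fS; rewrite /dot_ball /= dotZl dotZr mulrA -expr2 exprVn exprMn.
  rewrite sqr_sqrtr ?dot_ge0// mulrC ler_pdivrMr ?mulr_gt0// mul1r.
  by rewrite ler_peMl ?dot_ge0//; lra.
move=> x y; set q := dot x x + dot y y.
have x0 := dot_ge0 x; have y0 := dot_ge0 y.
have [q0|q0] := eqVneq q 0.
  have xz : x = 0 by apply: dot_eq0; move: q0; rewrite /q; lra.
  have yz : y = 0 by apply: dot_eq0; move: q0; rewrite /q; lra.
  rewrite xz yz subr0 addr0 /homogenize dot0l !mulr0 !mul0r !mulr0 !subr0 addr0.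
  by rewrite normr0 q0 mulr0.
have qp : 0 < q by rewrite lt_neqAle eq_sym q0 addr_ge0.
pose s := Num.sqrt (128 * q)^-1.
have ss : s ^+ 2 = (128 * q)^-1 by rewrite sqr_sqrtr// invr_ge0 mulr_ge0// ltW.
have sq : s ^+ 2 * q = 128^-1 by rewrite ss; field; rewrite gt_eqF.
have s2 : 0 < s ^+ 2 by rewrite ss invr_gt0 mulr_gt0.
have Kn z : dot z z <= 2 * q -> dot_ball R n (8 *: (s *: z)).
  move=> zq; rewrite /dot_ball /= !(dotZl, dotZr).
  have : s ^+ 2 * dot z z <= s ^+ 2 * (2 * q) by rewrite ler_pM2l.
  have -> : s ^+ 2 * (2 * q) = 64^-1 by rewrite mulrCA sq; field.
  by rewrite expr2; lra.
have dxy := dot_add_le x y.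
have dxy' : dot (x - y) (x - y) <= 2 * q.
  have := dot_add_le x (- y); rewrite (dotNl y) dotNr opprK /q; lra.
have Kx : dot_ball R n (8 *: (s *: x)) by apply: Kn; rewrite /q; lra.
have Ky : dot_ball R n (8 *: (s *: y)) by apply: Kn; rewrite /q; lra.
have Kp : dot_ball R n (8 *: (s *: (x + y))) by apply: Kn; rewrite /q; lra.
have Km : dot_ball R n (8 *: (s *: (x - y))) by apply: Kn.
have K0 : dot_ball R n (8 *: 0) by rewrite /dot_ball /= scaler0 dot0l.
have cl := homogenize_close f3 fS fe f0.
have := cl _ Kx; have := cl _ Ky; have := cl _ Kp; have := cl _ Km.
have := sdiff_var (@dot_ball_cvx R n) (@dot_ball_symm R n) f3 Kx K0 Ky.
rewrite /sdiff add0r sub0r fe f0 -scalerDr -scalerBr !FZ => h1 h2 h3 h4 h5.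
have : `|s ^+ 2 * (homogenize f (x + y) + homogenize f (x - y) -
    2 * homogenize f x - 2 * homogenize f y)| <= 91.
  have E a b c d : s ^+ 2 * (a + b - 2 * c - 2 * d) = s ^+ 2 * a + s ^+ 2 * b -
      2 * (s ^+ 2 * c) - 2 * (s ^+ 2 * d) by ring.
  rewrite E.
  move: h1 h2 h3 h4 h5.
  set F1 := s ^+ 2 * homogenize f (x + y).
  set F2 := s ^+ 2 * homogenize f (x - y).
  set F3 := s ^+ 2 * homogenize f x; set F4 := s ^+ 2 * homogenize f y.
  move: (f (s *: (x + y))) (f (s *: (x - y))) (f (s *: x)) (f (s *: y)) => f1 f2 f3' f4.
  move: F1 F2 F3 F4 => F1 F2 F3 F4.
  by rewrite !ler_norml; lra.
rewrite normrM gtr0_norm// => h; rewrite -(ler_pM2l s2); apply: (le_trans h).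
by rewrite mulrCA sq mulfK.
Qed.

Lemma even_approx_ball (R : realType) (n k : nat) (f : 'rV[R]_n -> R) (S : R) :
  (0 < n)%N -> third_diff_le1 (dot_ball R n) f ->
  (forall x, dot_ball R n x -> `|f x| <= S) ->
  (forall x, f (- x) = f x) -> f 0 = 0 -> (2 * ((n * n).+1 + n) <= 2 ^ k)%N ->
  exists A : 'M[R]_n, forall x, dot_ball R n x ->
    `|f x - dot (x *m A) x| <= 64 * (14 + ((91 * 128) * k%:R + 8 * (91 * 128) + 4) * 2) + 21.
Proof.
move=> n0 f3 fS fe f0 nk.
have S0 : 0 <= S.
  by have := fS 0; rewrite /dot_ball /= dot0l f0 normr0; apply.
have [||A hA] := near_quadratic_ball (homogenize_near_quadratic f3 fS fe f0) _ _ n0 nk.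
- by [].
- by rewrite mulr_ge0.
exists A; apply: even_dilate => //; [exact: dot_ball_cvx|exact: dot_ball_symm|].
move=> x Kx.
have x1 : dot x x <= 1.
  by have := dot_ge0 x; move: Kx; rewrite /dot_ball /= dotZl dotZr; lra.
have := homogenize_close f3 fS fe f0 Kx; have := hA _ x1.
move: (_ * 2) => c.
by rewrite !ler_norml; lra.
Qed.

(** * Quadratic functions and polynomials *)

Definition quadratic (R : realType) (n : nat) (g : 'rV[R]_n -> R) : Prop :=
  exists (A : 'M[R]_n) (b : 'rV[R]_n) (c : R),
    forall x, g x = dot (x *m A) x + dot x b + c.

Lemma quadratic_sum (R : realType) (n : nat) (I : eqType) (r : seq I)
    (g : I -> 'rV[R]_n -> R) :
  (forall i, i \in r -> quadratic (g i)) -> quadratic (fun x => \sum_(i <- r) g i x).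
Proof.
elim: r => [_|i r IH hg].
  by exists 0, 0, 0 => x; rewrite big_nil mulmx0 dot0l dot0r !addr0.
have [A [b [c h]]] := hg i (mem_head _ _).
have [j jr|A' [b' [c' h']]] := IH; first by apply: hg; rewrite in_cons jr orbT.
exists (A + A'), (b + b'), (c + c') => x; rewrite big_cons h h'.
rewrite mulmxDr dotDl dotDr; ring.
Qed.

Lemma quadraticZ (R : realType) (n : nat) (a : R) (g : 'rV[R]_n -> R) :
  quadratic g -> quadratic (fun x => a * g x).
Proof.
move=> [A [b [c h]]]; exists (a *: A), (a *: b), (a * c) => x.
rewrite h -scalemxAr dotZl dotZr; ring.
Qed.

Lemma dot_delta (R : realType) (n : nat) (x : 'rV[R]_n) i :
  dot x (delta_mx ord0 i) = x ord0 i.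
Proof.
rewrite /dot (bigD1 i)//= big1 ?mxE ?eqxx ?mulr1 ?addr0// => j ji.
by rewrite mxE (negbTE ji) andbF mulr0.
Qed.

(** A monomial of degree at most 2 is 1, a coordinate, or a product of two
coordinates. *)
Lemma quadratic_monomial (R : realType) (n : nat) (m : mpoly.multinom n) :
  (mpoly.mdeg m <= 2)%N ->
  quadratic (fun x : 'rV[R]_n =>
    mpoly.meval (fun i => x ord0 i) (mpoly.mpolyX R m)).
Proof.
have peel (m' : mpoly.multinom n) : mpoly.mdeg m' != 0 -> exists i m'',
    m' = mpoly.mnm_add m'' (mpoly.mnm1 i) /\ mpoly.mdeg m' = (mpoly.mdeg m'').+1.
  move=> m0; have [i mi] : exists i, (0 < mpoly.fun_of_multinom m' i)%N.
    apply: contrapT => /forallNP h; move/eqP: m0; apply.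
    by rewrite mpoly.mdegE big1// => i _; apply/eqP; rewrite -leqn0 leqNgt; apply/negP/h.
  have le : mpoly.lem (mpoly.mnm1 i) m'.
    apply/mpoly.mnm_lepP => j; rewrite mpoly.mnm1E; case: eqP => [<-|] //.
  exists i, (mpoly.mnm_sub m' (mpoly.mnm1 i)); rewrite mpoly.submK//; split => //.
  by rewrite -{1}(mpoly.submK le) mpoly.mdegD mpoly.mdeg1 addn1.
move=> m2.
have [m0|m0] := eqVneq (mpoly.mdeg m) 0%N.
  exists 0, 0, 1 => x; move/eqP: m0; rewrite mpoly.mdeg_eq0 => /eqP ->.
  by rewrite mpoly.mpolyX0 mpoly.meval1 mulmx0 dot0l dot0r !add0r.
have [i [m1 [em em1]]] := peel m m0.
have [m10|m10] := eqVneq (mpoly.mdeg m1) 0%N.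
  exists 0, (delta_mx ord0 i), 0 => x; move/eqP: m10; rewrite mpoly.mdeg_eq0 => /eqP e.
  rewrite em e mpoly.mpolyXD mpoly.mevalM mpoly.mpolyX0 mpoly.meval1 mul1r.
  by rewrite mpoly.mevalXU mulmx0 dot0l add0r addr0 dot_delta.
have [j [m3 [em3 em13]]] := peel m1 m10.
have : mpoly.mdeg m3 == 0%N by rewrite em1 em13 in m2; rewrite -leqn0.
rewrite mpoly.mdeg_eq0 => /eqP e.
exists (delta_mx i j), 0, 0 => x.
rewrite em em3 e !mpoly.mpolyXD !mpoly.mevalM mpoly.mpolyX0 mpoly.meval1 mul1r.
rewrite !mpoly.mevalXU dot0r !addr0.
have -> : x *m delta_mx i j = x ord0 i *: delta_mx ord0 j.
  apply/rowP => k; rewrite !mxE (bigD1 i)//= big1 ?addr0 ?mxE ?eqxx//= => l li.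
  by rewrite !mxE (negbTE li) mulr0.
by rewrite dotZl dotC dot_delta mulrC.
Qed.

Lemma poly_quadratic (R : realType) (n : nat) (p : mpoly.mpoly n R) :
  poly_le R 2 n p -> quadratic (mpoly_fun p).
Proof.
move=> p3; rewrite (_ : mpoly_fun p = fun x => \sum_(m <- mpoly.msupp p)
    mpoly.mcoeff m p * mpoly.meval (fun i => x ord0 i) (mpoly.mpolyX R m)).
  apply: quadratic_sum => m mp; apply/quadraticZ/quadratic_monomial.
  by rewrite -ltnS (leq_trans (mpoly.msize_mdeg_lt mp)).
apply: funext => x; rewrite /mpoly_fun mpoly.mevalE; apply: eq_bigr => m _.
by rewrite mpoly.mevalX.
Qed.

Lemma quadratic_poly (R : realType) (n : nat) (g : 'rV[R]_n -> R) :
  quadratic g -> exists2 p, poly_le R 2 n p & forall x, mpoly_fun p x = g x.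
Proof.
move=> [A [b [c h]]].
pose P (p : mpoly.mpoly n R) := (mpoly.msize p <= 3)%N.
have PD p q : P p -> P q -> P (p + q).
  by move=> hp hq; rewrite /P (leq_trans (mpoly.msizeD_le _ _))// geq_max; apply/andP.
have P0 : P 0 by rewrite /P mpoly.msize0.
have PZ a p : P p -> P (a *: p).
  by move=> hp; rewrite /P (leq_trans (mpoly.msizeZ_le _ _)).
pose X i := mpoly.mpolyX R (mpoly.mnm1 i : mpoly.multinom n).
exists (\sum_i \sum_j A i j *: (X i * X j) + \sum_i b ord0 i *: X i + mpoly.mpolyC n c).
  rewrite /poly_le /=; apply: (PD _ _ (PD _ _ _ _)) => /=.
  - apply: (big_ind P P0 PD) => i _; apply: (big_ind P P0 PD) => j _; apply: (PZ _ _).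
    by rewrite /X -mpoly.mpolyXD /P mpoly.msizeX mpoly.mdegD !mpoly.mdeg1.
  - by apply: (big_ind P P0 PD) => i _; apply: (PZ _ _); rewrite /P mpoly.msizeX mpoly.mdeg1.
  - by rewrite /P mpoly.msizeC; case: eqP.
move=> x; rewrite h /mpoly_fun !mpoly.mevalD mpoly.mevalC; congr (_ + _ + _).
  rewrite raddf_sum /dot; under [RHS]eq_bigr do rewrite mxE mulr_suml.
  rewrite exchange_big; apply: eq_bigr => i _; rewrite raddf_sum.
  apply: eq_bigr => j _; rewrite /= mpoly.mevalZ mpoly.mevalM !mpoly.mevalXU; ring.
rewrite raddf_sum; apply: eq_bigr => i _ /=.
by rewrite mpoly.mevalZ mpoly.mevalXU mulrC.
Qed.

(** * Separation, ellipsoids, and convexification *)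

Lemma cvx_of_convex_set (R : realType) (n : nat) (K : set 'rV[R]_n) :
  convex_set K -> cvx K.
Proof.
move=> cK x y t Kx Ky t0 t1.
pose l : {i01 R} := Itv01 (ltac:(lra) : 0 <= 1 - t) (ltac:(lra) : 1 - t <= 1).
have := cK x y l (mem_set Kx) (mem_set Ky).
rewrite inE /conv /= => h; suff -> : (1 - t) *: x + t *: y =
  (1 - t) *: x + (1 - (1 - t)) *: y by [].
by rewrite subKr.
Qed.

Lemma coord_sub_continuous (R : realType) (n : nat) (x : 'rV[R]_n) (i : 'I_n) :
  continuous (fun y : 'rV[R]_n => x ord0 i - y ord0 i).
Proof.
move=> y.
have FF : Filter (nbhs y) := nbhs_filter y.
have h1 : cst (x ord0 i) z @[z --> y] --> x ord0 i by exact: cvg_cst.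
exact: (cvgB h1 (@coord_continuous R 1 n ord0 i y)).
Qed.

Lemma dist2_continuous (R : realType) (n : nat) (x : 'rV[R]_n) :
  continuous (fun y : 'rV[R]_n => dot (x - y) (x - y)).
Proof.
rewrite (_ : (fun y => _) =
    fun y : 'rV[R]_n => \sum_i (x ord0 i - y ord0 i) * (x ord0 i - y ord0 i)).
  apply: continuous_big => //; first exact: add_continuous.
  move=> i _ y; have FF : Filter (nbhs y) := nbhs_filter y.
  exact: (cvgM (@coord_sub_continuous R n x i y) (@coord_sub_continuous R n x i y)).
by apply: funext => y; apply: eq_bigr => i _; rewrite !mxE.
Qed.

Lemma dot_sub_scale (R : realType) (n : nat) (t : R) (u w : 'rV[R]_n) :
  dot (u - t *: w) (u - t *: w) = dot u u - 2 * t * dot w u + t ^+ 2 * dot w w.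
Proof.
rewrite !(dotDl, dotDr, dotNl, dotNr, dotZl, dotZr) (dotC u w); ring.
Qed.

(** The hyperplane is orthogonal to the segment from x to its nearest point in K; it is
normalized by a level strictly between the values at these two points, which is
positive because K contains 0. *)
Lemma separation (R : realType) (n : nat) (K : set 'rV[R]_n) (x : 'rV[R]_n) :
  compact K -> cvx K -> K 0 -> ~ K x ->
  exists2 phi, (forall y, K y -> dot y phi <= 1) & 1 < dot x phi.
Proof.
move=> kK cK K0 nKx.
have [y0 /set_mem Ky0 ymin] : exists2 y0, y0 \in K &
    forall t, t \in K -> dot (x - y0) (x - y0) <= dot (x - t) (x - t).
  apply: compact_EVT_min => //; first by exists 0.
  exact/continuous_subspaceT/dist2_continuous.
pose u := x - y0.
have u0 : 0 < dot u u.
  rewrite lt_neqAle dot_ge0 andbT eq_sym; apply/eqP => /dot_eq0/eqP.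
  by rewrite subr_eq0 => /eqP xy; apply: nKx; rewrite xy.
have side y : K y -> dot y u <= dot y0 u.
  move=> Ky; rewrite leNgt; apply/negP => lt.
  pose w := y - y0; have wu : 0 < dot w u by rewrite /w dotDl dotNl subr_gt0.
  have w0 := dot_ge0 w.
  pose t := Num.min 1 (dot w u / (dot w w + 1)).
  have q0 : 0 < dot w u / (dot w w + 1) by rewrite divr_gt0//; lra.
  have t0 : 0 < t by rewrite lt_min ltr01 q0.
  have t1 : t <= 1 by rewrite ge_min lexx.
  have tq : t * (dot w w + 1) <= dot w u.
    by rewrite -ler_pdivlMr ?ge_min ?lexx ?orbT//; lra.
  have := ymin _ (mem_set (cK _ _ _ Ky0 Ky (ltW t0) t1)).
  have -> : x - ((1 - t) *: y0 + t *: y) = u - t *: w.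
    by apply/rowP => i; rewrite /u /w !mxE; ring.
  rewrite -/u dot_sub_scale.
  have : t * (t * (dot w w + 1)) <= t * dot w u by rewrite ler_pM2l.
  have : 0 < t * dot w u by rewrite mulr_gt0.
  have : 0 < t * t by rewrite mulr_gt0.
  nra.
have y0u : 0 <= dot y0 u by rewrite -(dot0l u); exact: side.
(* The level halfway between the values of u at y0 and at x. *)
pose a := dot y0 u + dot u u / 2.
have a0 : 0 < a by rewrite /a; lra.
exists (a^-1 *: u).
  by move=> y /side; rewrite dotZr mulrC ler_pdivrMr// mul1r /a; lra.
rewrite dotZr mulrC ltr_pdivlMr// mul1r.
have -> : dot x u = dot y0 u + dot u u.
  by rewrite -dotDl (_ : y0 + u = x)// /u addrC subrK.
by rewrite /a; lra.
Qed.

Definition ellipsoid_form (R : realType) (n N : nat) (p : 'I_N -> R)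
    (u : 'I_N -> 'rV[R]_n) (x : 'rV[R]_n) : R := dot (x *m moment p u) x.

Lemma ellipsoid_formE (R : realType) (n N : nat) (p : 'I_N -> R)
    (u : 'I_N -> 'rV[R]_n) (x : 'rV[R]_n) :
  ellipsoid_form p u x = \sum_i p i * dot x (u i) ^+ 2.
Proof.
rewrite /ellipsoid_form mulmx_sumr dot_suml; apply: eq_bigr => i _.
rewrite -scalemxAr dotZl mulmxA; congr (_ * _).
have -> : x *m (u i)^T = (dot x (u i))%:M.
  apply/matrixP => a b; rewrite !ord1 !mxE eqxx mulr1n /dot.
  by apply: eq_bigr => j _; rewrite !mxE.
by rewrite mul_scalar_mx dotZl (dotC (u i)) expr2.
Qed.

(** M is the moment matrix of an optimal design for the polar body of K.  It averages
the squares of functionals bounded by 1 on K, so it is at most 1 on K; conversely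
the inequality <phi M^-1, phi> <= n (1 + e) on the polar body shows that no
functional phi there exceeds 1 at a point x with n (1 + e) <x M, x> <= 1, and such
an x is in K by separation. *)
Lemma john (R : realType) (n : nat) (K : set 'rV[R]_n) (S t e : R) :
  (0 < n)%N -> compact K -> cvx K -> symm K ->
  (forall x j, K x -> `|x ord0 j| <= S) -> 0 < t ->
  (forall i, K (t *: delta_mx ord0 i)) -> 0 < e ->
  exists M : 'M[R]_n, [/\ forall x, 0 <= dot (x *m M) x,
    forall x, K x -> dot (x *m M) x <= 1 &
    forall x, n%:R * (1 + e) * dot (x *m M) x <= 1 -> K x].
Proof.
move=> n0 kK cK sK KS t0 Kt e0.
have n0R : 0 < n%:R :> R by rewrite ltr0n.
pose P : set 'rV[R]_n := [set phi | forall x, K x -> dot x phi <= 1].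
have S0 : 0 < S.
  have /(KS _ (Ordinal n0)) := Kt (Ordinal n0).
  rewrite !mxE eqxx mulr1 gtr0_norm// => h; exact: lt_le_trans t0 h.
have [|||N [p [u [dpu Mu hM]]]] := @optimal_design R n P t^-1 S^-1 e n0 _ _ _ e0.
- move=> phi j Pphi; rewrite -(ler_pM2l t0) mulfV ?gt_eqF//.
  have := Pphi _ (Kt j); have := Pphi _ (sK _ (Kt j)).
  rewrite dotNl dotZl dotC dot_delta => h1 h2.
  rewrite -{1}(gtr0_norm t0) -normrM ler_norml; apply/andP; split; lra.
- by rewrite invr_gt0.
- move=> i x Kx; rewrite dotZr dot_delta mulrC ler_pdivrMr// mul1r.
  exact: le_trans (ler_norm _) (KS _ _ Kx).
have [p0 p1 Pu] := dpu.
have ge0 x : 0 <= dot (x *m moment p u) x.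
  rewrite -/(ellipsoid_form p u x) ellipsoid_formE sumr_ge0// => i _.
  by rewrite mulr_ge0 ?sqr_ge0.
exists (moment p u); split => // x.
  move=> Kx; rewrite -/(ellipsoid_form p u x) ellipsoid_formE -p1.
  apply: ler_sum => i _; rewrite ler_piMr//.
  have := Pu i _ Kx; have := Pu i _ (sK _ Kx); rewrite dotNl; nra.
move=> hx; apply: contrapT => nKx.
have K0 : K 0.
  have := mem_scale cK sK (a := 0) _ (Kt (Ordinal n0)).
  by rewrite scale0r normr0; apply.
have [phi Pphi] := separation kK cK K0 nKx.
set c := n%:R * (1 + e) in hx hM.
have c0 : 0 < c by rewrite mulr_gt0//; lra.
have := hM _ Pphi; pose psi := phi *m invmx (moment p u).
have psiM : psi *m moment p u = phi by rewrite /psi mulmxKV.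
move=> hphi hlt; have := ge0 (x - c^-1 *: psi).
rewrite mulmxBl -scalemxAl psiM !(dotDl, dotDr, dotNl, dotNr, dotZl, dotZr).
have -> : dot (x *m moment p u) psi = dot x phi.
  by rewrite dot_mulmx moment_sym psiM.
rewrite (dotC phi x) (dotC phi psi).
have -> : dot psi phi = dot (phi *m invmx (moment p u)) phi by [].
set q := dot _ phi in hphi *.
set s := dot (x *m _) x in hx *; set b := dot x phi in hlt *.
have d0 : 0 < c^-1 by rewrite invr_gt0.
have h1 : s <= c^-1 by rewrite -[c^-1]mul1r ler_pdivlMr// mulrC.
have h2 : c^-1 * (c^-1 * q) <= c^-1.
  by rewrite -{3}[c^-1]mulr1 ler_pM2l// mulrC ler_pdivrMr// mul1r.
have h3 : 0 < c^-1 * (b - 1) by rewrite mulr_gt0// subr_gt0.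
move: (c^-1) h1 h2 h3 => d h1 h2 h3; lra.
Qed.

Definition half_differences (R : realType) (n : nat) (K : set 'rV[R]_n) :
    set 'rV[R]_n := [set h | exists y z, [/\ K y, K z & h = 2^-1 *: (y - z)]].

(** Second differences of f show that the form q of g is at least - 2 E on the half
differences.  A vector h with <h M, h> > 0 can be scaled until
rho <h M, h> = 1, so q h >= - 2 E rho <h M, h>; if <h M, h> = 0, then all the
multiples of h are half differences and q h >= 0.  Adding 2 E rho M (x - x0)
therefore makes g convex, and subtracting E rho centres the correction. *)
Lemma convex_correction (R : realType) (n : nat) (K : set 'rV[R]_n)
    (f g : 'rV[R]_n -> R) (M : 'M[R]_n) (x0 : 'rV[R]_n) (rho E : R) :
  cvx K -> midpoint_convex_on K f -> quadratic g -> 0 <= E -> 0 < rho ->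
  (forall x, K x -> `|f x - g x| <= E) ->
  (forall x, 0 <= dot (x *m M) x) ->
  (forall x, rho * dot (x *m M) x <= 1 -> half_differences K x) ->
  (forall x, K x -> dot ((x - x0) *m M) (x - x0) <= 1) ->
  exists g', [/\ quadratic g', midpoint_convex_on K g' &
    forall x, K x -> `|f x - g' x| <= (1 + rho) * E].
Proof.
move=> cK fK [A [b [c gE]]] E0 r0 fg M0 hM K1.
pose s x := dot (x *m M) x; pose q x := dot (x *m A) x.
have sZ a x : s (a *: x) = a ^+ 2 * s x.
  by rewrite /s -scalemxAl dotZl dotZr; ring.
have qZ a x : q (a *: x) = a ^+ 2 * q x.
  by rewrite /q -scalemxAl dotZl dotZr; ring.
have qlow h : half_differences K h -> - (2 * E) <= q h.
  move=> [y [z [Ky Kz ->]]].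
  have Km : K (2^-1 *: (y + z)).
    rewrite (_ : _ *: _ = (1 - 2^-1) *: y + 2^-1 *: z).
      by apply: cK => //; lra.
    by apply/rowP => i; rewrite !mxE; field.
  have := fK _ _ Ky Kz; have := fg _ Ky; have := fg _ Kz; have := fg _ Km.
  have -> : q (2^-1 *: (y - z)) = (g y + g z - 2 * g (2^-1 *: (y + z))) / 2.
    rewrite !gE qZ -scalemxAl /q !(mulmxDl, mulNmx, dotDl, dotDr, dotNl, dotNr, dotZl, dotZr).
    by field.
  rewrite !ler_norml; lra.
have key h : 0 <= q h + 2 * E * rho * s h.
  have sh : 0 <= s h by exact: M0.
  have [s0|s0] := eqVneq (s h) 0.
    rewrite s0 mulr0 addr0 leNgt; apply/negP => qh.
    (* Were q h negative, a h would be a half difference with q (a h) = - 2 E - 1. *)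
    pose a := Num.sqrt ((2 * E + 1) / - q h).
    have a2 : a ^+ 2 = (2 * E + 1) / - q h.
      by rewrite sqr_sqrtr// divr_ge0//; lra.
    have := qlow (a *: h); rewrite qZ a2 (_ : _ / _ * _ = - (2 * E + 1)); last first.
      by field; rewrite ?oppr_eq0 lt_eqF.
    move=> /(_ (hM _ _)); rewrite -/(s (a *: h)) sZ s0 !mulr0.
    by move=> /(_ ler01); lra.
  have sp : 0 < s h by rewrite lt_neqAle eq_sym s0.
  pose a := Num.sqrt (rho * s h)^-1.
  have rs : 0 < rho * s h by rewrite mulr_gt0.
  have a2 : a ^+ 2 = (rho * s h)^-1 by rewrite sqr_sqrtr// invr_ge0 ltW.
  have := qlow (a *: h); rewrite qZ a2.
  move=> /(_ (hM _ _)); rewrite -/(s (a *: h)) sZ a2.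
  rewrite (_ : rho * _ = 1); last by field; rewrite s0 gt_eqF.
  rewrite lexx => /(_ isT).
  rewrite -(ler_pM2l rs) mulrA mulfV ?gt_eqF// mul1r; lra.
exists (fun x => g x + 2 * E * rho * s (x - x0) - E * rho); split.
- exists (A + (2 * E * rho) *: M),
    (b - (2 * E * rho) *: (x0 *m M^T + x0 *m M)),
    (c + 2 * E * rho * s x0 - E * rho) => x.
  rewrite gE /s mulmxDr -scalemxAr !mulmxDl !mulNmx.
  rewrite !(dotDl, dotDr, dotNl, dotNr, dotZl, dotZr).
  rewrite (dotC (x0 *m M) x) -(dot_mulmx x M x0).
  ring.
- move=> x y Kx Ky.
  have hE : 2 * (g (2^-1 *: (x + y)) + 2 * E * rho * s (2^-1 *: (x + y) - x0) - E * rho)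
      + 2 * (q (2^-1 *: (x - y)) + 2 * E * rho * s (2^-1 *: (x - y))) =
      g x + 2 * E * rho * s (x - x0) - E * rho +
      (g y + 2 * E * rho * s (y - x0) - E * rho).
    rewrite !gE qZ sZ -scalemxAl /q /s !mulmxDl -!scalemxAl !mulmxDl !mulNmx.
    rewrite !(dotDl, dotDr, dotNl, dotNr, dotZl, dotZr).
    by field.
  by rewrite -hE lerDl mulr_ge0.
- move=> x Kx; have := fg _ Kx; have := K1 _ Kx; have := M0 (x - x0).
  rewrite -/(s (x - x0)) => s0 s1.
  have Er : 0 <= E * rho by rewrite mulr_ge0// ltW.
  have e1 : E * rho * s (x - x0) <= E * rho by rewrite ler_piMr.
  have e2 : 0 <= E * rho * s (x - x0) by rewrite mulr_ge0.
  have -> : 2 * E * rho * s (x - x0) = 2 * (E * rho * s (x - x0)) by ring.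
  rewrite !ler_norml; lra.
Qed.

(** * Quadratic approximation *)

Lemma modulus_third_diff (R : realType) (n : nat) (K : set 'rV[R]_n)
    (f : 'rV[R]_n -> R) : (modulus 3 K f <= 1)%E -> third_diff_le1 K f.
Proof.
move=> m1 x h K0 K1 K2 K3.
have fd : finite_diff 3 h f x = f x - 3 * f (x + h) + 3 * f (x + 2 *: h) - f (x + 3 *: h).
  rewrite /finite_diff !big_ord_recl big_ord0 /bump /= !bin0 !bin1 binn.
  rewrite (_ : 'C(3, 1 + 1) = 3)//  scale0r addr0 scale1r.
  ring.
rewrite -fd -lee_fin; apply: le_trans m1; apply: ereal_sup_ubound.
exists (x, h) => //= j; case: j => [|[|[|[|j]]]] //= _.
- by rewrite scale0r addr0.
- by rewrite scale1r.
Qed.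

Lemma compact_coord_bounded (R : realType) (n : nat) (K : set 'rV[R]_n) :
  compact K -> exists S, forall x j, K x -> `|x ord0 j| <= S.
Proof.
move=> kK.
have h (j : 'I_n) : exists S : R, forall x, K x -> `|x ord0 j| <= S.
  have : compact ((fun x : 'rV[R]_n => x ord0 j) @` K).
    apply: continuous_compact => //; apply: continuous_subspaceT.
    exact: (@coord_continuous R 1 n ord0 j).
  move=> /compact_bounded[M [_ hM]]; exists (M + 1) => x Kx.
  by apply: hM; [rewrite ltrDl|exists x].
have [S hS] := choice h.
exists (\sum_j `|S j|) => x j Kx; apply: (le_trans (hS j x Kx)).
by rewrite (bigD1 j)//= (le_trans (ler_norm _))// lerDl sumr_ge0.
Qed.

Lemma continuous_on_bounded (R : realType) (n : nat) (K : set 'rV[R]_n)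
    (f : 'rV[R]_n -> R) : compact K -> continuous_on K f ->
  exists S, forall x, K x -> `|f x| <= S.
Proof.
move=> kK cf; have /compact_bounded[M [_ hM]] := continuous_compact cf kK.
by exists (M + 1) => x Kx; apply: hM; [rewrite ltrDl|exists x].
Qed.

Lemma interior_cross (R : realType) (n : nat) (K : set 'rV[R]_n) :
  K° !=set0 -> exists a t, 0 < t /\
    forall i, K (a + t *: delta_mx ord0 i) /\ K (a - t *: delta_mx ord0 i).
Proof.
move=> [a]; rewrite /interior => /nbhs_ballP[e /= e0 he].
exists a, (e / 2); split; first exact: divr_gt0.
move=> i.
have small (s : R) : `|s| < e -> K (a + s *: delta_mx ord0 i).
  move=> se; apply: he; split=> // k l; rewrite /ball /= /ball_ !mxE.
  rewrite opprD addrA subrr sub0r normrN normrM.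
  apply: le_lt_trans se; rewrite ler_piMr//.
  by case: (_ && _); rewrite ?normr1 ?normr0.
have e2 : `|e / 2| < e by rewrite ger0_norm ?divr_ge0 ?ltW// ltr_pdivrMr//; lra.
split; first exact: small.
by rewrite -scaleNr; apply: small; rewrite normrN.
Qed.

Lemma quadratic_shift (R : realType) (n : nat) (g : 'rV[R]_n -> R) (c : 'rV[R]_n) :
  quadratic g -> quadratic (fun x => g (x - c)).
Proof.
move=> [A [b [d gE]]].
exists A, (b - (c *m A^T + c *m A)), (d + dot (c *m A) c - dot c b) => x.
rewrite gE !mulmxDl !mulNmx !(dotDl, dotDr, dotNl, dotNr).
rewrite (dotC (c *m A) x) -(dot_mulmx x A c); ring.
Qed.

Lemma quadratic_of_parts (R : realType) (n : nat) (K : set 'rV[R]_n)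
    (f : 'rV[R]_n -> R) (E1 E2 : R) (A : 'M[R]_n) (l : 'rV[R]_n) :
  (forall x, K x -> `|(f x - f (- x)) / 2 - dot x l| <= E1) ->
  (forall x, K x -> `|(f x + f (- x)) / 2 - f 0 - dot (x *m A) x| <= E2) ->
  exists2 g, quadratic g & forall x, K x -> `|f x - g x| <= E1 + E2.
Proof.
move=> h1 h2; exists (fun x => dot (x *m A) x + dot x l + f 0).
  by exists A, l, (f 0).
by move=> x Kx; have := h1 _ Kx; have := h2 _ Kx; rewrite !ler_norml; lra.
Qed.

Lemma parts_third_diff (R : realType) (n : nat) (K : set 'rV[R]_n)
    (f : 'rV[R]_n -> R) : symm K -> third_diff_le1 K f ->
  third_diff_le1 K (fun x => (f x - f (- x)) / 2) /\
  third_diff_le1 K (fun x => (f x + f (- x)) / 2 - f 0).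
Proof.
move=> sK f3; have h x h : K x -> K (x + h) -> K (x + 2 *: h) -> K (x + 3 *: h) ->
    `|f (- x) - 3 * f (- (x + h)) + 3 * f (- (x + 2 *: h)) - f (- (x + 3 *: h))| <= 1.
  move=> K0 K1 K2 K3; have := f3 (- x) (- h) (sK _ K0).
  rewrite !scalerN -!opprD; apply; exact: sK.
split=> x d K0 K1 K2 K3; have := f3 _ _ K0 K1 K2 K3; have := h _ _ K0 K1 K2 K3;
  rewrite !ler_norml; lra.
Qed.

Lemma parts_bounded (R : realType) (n : nat) (K : set 'rV[R]_n)
    (f : 'rV[R]_n -> R) (S : R) : symm K -> K 0 -> (forall x, K x -> `|f x| <= S) ->
  (forall x, K x -> `|(f x - f (- x)) / 2| <= 2 * S) /\
  (forall x, K x -> `|(f x + f (- x)) / 2 - f 0| <= 2 * S).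
Proof.
move=> sK K0 fS; have := fS _ K0 => f0.
by split => x Kx; have := fS _ Kx; have := fS _ (sK _ Kx); move: f0;
  rewrite !ler_norml; lra.
Qed.

Lemma symmetric_quadratic_approx (R : realType) (n k : nat) (K : set 'rV[R]_n)
    (f : 'rV[R]_n -> R) (S S' t : R) :
  (0 < n)%N -> cvx K -> symm K -> third_diff_le1 K f ->
  (forall x, K x -> `|f x| <= S) ->
  (forall x j, K x -> `|x ord0 j| <= S') ->
  0 < t -> (forall i, K (t *: delta_mx ord0 i)) -> (n.+2 <= 2 ^ k)%N ->
  exists2 g, quadratic g & forall x, K x -> `|f x - g x| <=
    (63 * k%:R + 2) + (448 * k%:R * (1 + 4 * Num.sqrt n%:R) + 21).
Proof.
move=> n0 cK sK f3 fS KS t0 Kt nk.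
have K0 : K 0.
  have := mem_scale cK sK (a := 0) _ (Kt (Ordinal n0)).
  by rewrite scale0r normr0; apply.
have [d3 e3] := parts_third_diff sK f3.
have [dS eS] := parts_bounded sK K0 fS.
have [|l hl] := odd_approx cK sK d3 dS _ nk.
  by move=> x; rewrite opprK -mulNr opprB.
have [| |A hA] := even_approx n0 cK sK e3 eS KS t0 Kt _ _ nk.
- by move=> x; rewrite opprK (addrC (f (- x))).
- by rewrite oppr0; lra.
exact: quadratic_of_parts hl hA.
Qed.

Lemma ball_quadratic_approx (R : realType) (n k : nat) (f : 'rV[R]_n -> R) (S : R) :
  (0 < n)%N -> third_diff_le1 (dot_ball R n) f ->
  (forall x, dot_ball R n x -> `|f x| <= S) ->
  (2 * ((n * n).+1 + n) <= 2 ^ k)%N ->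
  exists2 g, quadratic g & forall x, dot_ball R n x -> `|f x - g x| <=
    (63 * k%:R + 2) + (64 * (14 + (91 * 128 * k%:R + 8 * (91 * 128) + 4) * 2) + 21).
Proof.
move=> n0 f3 fS nk.
have nk' : (n.+2 <= 2 ^ k)%N by apply: leq_trans nk; nia.
have K0 : dot_ball R n 0 by rewrite /dot_ball /= dot0l.
have sK := @dot_ball_symm R n.
have [d3 e3] := parts_third_diff sK f3.
have [dS eS] := parts_bounded sK K0 fS.
have [|l hl] := odd_approx (@dot_ball_cvx R n) sK d3 dS _ nk'.
  by move=> x; rewrite opprK -mulNr opprB.
have [| |A hA] := even_approx_ball n0 e3 eS _ _ nk.
- by move=> x; rewrite opprK (addrC (f (- x))).
- by rewrite oppr0; lra.
exact: quadratic_of_parts hl hA.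
Qed.

(** Families of points are halved k times, hence 2 ^ k has to reach their sizes: n + 2
for an annihilator, quadratic in n for a design.  So k of the order of log n will do. *)
Lemma exists_log_bound (R : realType) (n : nat) : (0 < n)%N ->
  exists k, [/\ (0 < k)%N, (2 * ((n * n).+1 + n) <= 2 ^ k)%N, (n.+2 <= 2 ^ k)%N &
    k%:R <= 5 / ln 2 * ln n.+1%:R :> R].
Proof.
move=> n0; pose j := up_log 2 n.+1.
have /= /andP[j1 j2] := @up_log_bounds 2 n.+1 isT n0; rewrite -/j in j1 j2.
have j0 : (0 < j)%N by rewrite lt0n; apply/eqP => jz; move: j2; rewrite jz; lia.
have big : (2 * ((n * n).+1 + n) <= 2 ^ (2 * j).+1)%N.
  rewrite expnS leq_mul2l /= mulnC expnM; apply: (@leq_trans (n.+1 ^ 2)%N); first nia.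
  by rewrite leq_exp2r.
exists (2 * j).+1; split => //; first by apply: leq_trans big; nia.
have l2 : 0 < ln 2 :> R by rewrite ln_gt0// ltr1n.
have ln2n : ln 2 <= ln n.+1%:R :> R by rewrite ler_ln ?posrE ?ltr0n// ler_nat.
have lj : j.-1%:R * ln 2 <= ln n.+1%:R :> R.
  rewrite mulr_natl -lnXn// -natrX ler_ln ?posrE ?ltr0n ?expn_gt0// ler_nat.
  exact: ltnW.
rewrite mulrAC ler_pdivlMr//.
have -> : (2 * j).+1%:R = 2 * j.-1%:R + 3 :> R.
  have -> : (2 * j).+1 = (2 * j.-1 + 3)%N by case: (j) j0 => // i _ /=; lia.
  by rewrite natrD natrM.
rewrite mulrDl; lra.
Qed.

(** * Whitney constants *)

Lemma sup_norm_le (R : realType) (n : nat) (K : set 'rV[R]_n) (h : 'rV[R]_n -> R) (E : R) :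
  (forall x, K x -> `|h x| <= E) -> (sup_norm K h <= E%:E)%E.
Proof.
by move=> hE; apply: ge_ereal_sup => _ [x Kx <-]; rewrite lee_fin; exact: hE.
Qed.

Lemma le_sup_norm (R : realType) (n : nat) (K : set 'rV[R]_n) (h : 'rV[R]_n -> R) x :
  K x -> (`|h x|%:E <= sup_norm K h)%E.
Proof. by move=> Kx; apply: ereal_sup_ubound; exists x. Qed.

Lemma approx_error_le (R : realType) (n : nat) (K : set 'rV[R]_n)
    (f g : 'rV[R]_n -> R) (E : R) :
  quadratic g -> (forall x, K x -> `|f x - g x| <= E) ->
  (approx_error 2 K f <= E%:E)%E.
Proof.
move=> /quadratic_poly[p p2 pg] fg.
apply: (@le_trans _ _ (sup_norm K (fun x => f x - mpoly_fun p x))).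
  by apply: ereal_inf_lbound; exists p.
by apply: sup_norm_le => x Kx; rewrite pg; exact: fg.
Qed.

Lemma convex_approx_error_le (R : realType) (n : nat) (K : set 'rV[R]_n)
    (f g : 'rV[R]_n -> R) (E : R) :
  quadratic g -> midpoint_convex_on K g -> (forall x, K x -> `|f x - g x| <= E) ->
  (convex_approx_error 2 K f <= E%:E)%E.
Proof.
move=> /quadratic_poly[p p2 pg] gK fg.
apply: (@le_trans _ _ (sup_norm K (fun x => f x - mpoly_fun p x))).
  apply: ereal_inf_lbound; exists p => //; split => //.
  by move=> x y Kx Ky; rewrite !pg; exact: gK.
by apply: sup_norm_le => x Kx; rewrite pg; exact: fg.
Qed.

Lemma approx_error_ge0 (R : realType) (n : nat) (K : set 'rV[R]_n)
    (f : 'rV[R]_n -> R) : K !=set0 -> (0 <= approx_error 2 K f)%E.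
Proof.
move=> [x Kx]; apply: le_ereal_inf_tmp => _ [p p2 <-].
by apply: le_trans (le_sup_norm _ Kx); rewrite lee_fin.
Qed.

(** The infimum in the approximation error need not be attained, so g is only nearly
optimal; the margin e in the factor is absorbed in the same limit. *)
Lemma convex_error_comparison (R : realType) (n : nat) (K : set 'rV[R]_n)
    (f : 'rV[R]_n -> R) (a : R) : K !=set0 -> 0 < a ->
  (forall e g E, 0 < e -> quadratic g -> 0 <= E ->
     (forall x, K x -> `|f x - g x| <= E) ->
     exists g', [/\ quadratic g', midpoint_convex_on K g' &
       forall x, K x -> `|f x - g' x| <= (a + e) * E]) ->
  (convex_approx_error 2 K f <= a%:E * approx_error 2 K f)%E.
Proof.
move=> K0 a0 H; have := approx_error_ge0 f K0.
case Ew : (approx_error 2 K f) => [w| |] // w0; last first.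
  by rewrite gt0_muley ?lte_fin// leey.
rewrite lee_fin in w0.
rewrite -EFinM; apply/lee_addgt0Pr => e e0; rewrite -EFinD.
pose eta := e / (2 * (w + 1)); pose d := Num.min 1 (e / (2 * a)).
have eta0 : 0 < eta by rewrite divr_gt0//; lra.
have etaE : eta * (w + 1) = e / 2 by rewrite /eta; field; rewrite gt_eqF//; lra.
have d0 : 0 < d by rewrite lt_min ltr01 divr_gt0// mulr_gt0.
have d1 : d <= 1 by rewrite ge_min lexx.
have da : a * d <= e / 2.
  have : d <= e / (2 * a) by rewrite ge_min lexx orbT.
  by rewrite ler_pdivlMr ?mulr_gt0//; lra.
have : (approx_error 2 K f < (w + d)%:E)%E by rewrite Ew lte_fin ltrDl.
move=> /ereal_inf_lt[_ [p p2 <-] lt].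
have fp x : K x -> `|f x - mpoly_fun p x| <= w + d.
  move=> Kx; rewrite -lee_fin; apply: le_trans (ltW lt).
  exact: (le_sup_norm (fun x => f x - mpoly_fun p x) Kx).
have [g' [qg' cg' fg']] := H _ _ _ eta0 (poly_quadratic p2) (addr_ge0 w0 (ltW d0)) fp.
apply: le_trans (convex_approx_error_le qg' cg' fg') _.
rewrite lee_fin.
have : eta * d <= eta * 1 by rewrite ler_pM2l.
lra.
Qed.

Lemma convex_whitney_le (R : realType) (n : nat) (K : set 'rV[R]_n) (a : R) :
  0 < a ->
  (forall f, midpoint_convex_on K f ->
    (convex_approx_error 2 K f <= a%:E * approx_error 2 K f)%E) ->
  (convex_whitney 3 K <= a%:E * whitney 3 K)%E.
Proof.
move=> a0 H; apply: ge_ereal_sup => _ [f [cf vf mf] <-].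
apply: (le_trans (H f vf)); rewrite lee_pmul2l ?lte_fin//.
by apply: ereal_sup_ubound; exists f.
Qed.

Lemma half_differences_compact (R : realType) (n : nat) (K : set 'rV[R]_n) :
  compact K -> compact (half_differences K).
Proof.
move=> kK.
have -> : half_differences K =
    (fun p : 'rV[R]_n * 'rV[R]_n => 2^-1 *: (p.1 - p.2)) @` (K `*` K).
  apply/seteqP; split => [_ [y [z [Ky Kz ->]]]|_ [[y z] [/= Ky Kz] <-]].
    by exists (y, z).
  by exists y, z.
apply: continuous_compact; last exact: compact_setX.
apply: continuous_subspaceT => p.
have FF : Filter (nbhs p) := nbhs_filter p.
have h1 : (fun q : 'rV[R]_n * 'rV[R]_n => q.1) z @[z --> p] --> p.1 by exact: cvg_fst.
have h2 : (fun q : 'rV[R]_n * 'rV[R]_n => q.2) z @[z --> p] --> p.2 by exact: cvg_snd.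
have h0 : cst (2^-1 : R) z @[z --> p] --> (2^-1 : R) by exact: cvg_cst.
exact: (cvgZ h0 (cvgB h1 h2)).
Qed.

(** Half differences form a symmetric convex body even when K has no centre. *)
Lemma half_differences_john (R : realType) (n : nat) (K : set 'rV[R]_n) (e : R) :
  (0 < n)%N -> convex_body K -> 0 < e ->
  exists M : 'M[R]_n, [/\ forall x, 0 <= dot (x *m M) x,
    forall x, half_differences K x -> dot (x *m M) x <= 1 &
    forall x, n%:R * (1 + e) * dot (x *m M) x <= 1 -> half_differences K x].
Proof.
move=> n0 [kK cK iK] e0; have {}cK := cvx_of_convex_set cK.
have [a [t [t0 Kt]]] := interior_cross iK.
have kH := half_differences_compact kK.
have [S hS] := compact_coord_bounded kH.
apply: (@john R n (half_differences K) S t e) => //.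
- move=> _ _ s [y [z [Ky Kz ->]]] [y' [z' [Ky' Kz' ->]]] s0 s1.
  exists ((1 - s) *: y + s *: y'), ((1 - s) *: z + s *: z'); split.
  + exact: cK.
  + exact: cK.
  + by apply/rowP => i; rewrite !mxE; ring.
- move=> _ [y [z [Ky Kz ->]]]; exists z, y; split => //.
  by rewrite -scalerN opprB.
move=> i; have [K1 K2] := Kt i.
exists (a + t *: delta_mx ord0 i), (a - t *: delta_mx ord0 i); split => //.
by apply/rowP => j; rewrite !mxE; field.
Qed.

Lemma convex_body_neq0 (R : realType) (n : nat) (K : set 'rV[R]_n) :
  convex_body K -> K !=set0.
Proof. by move=> [_ _ [x /interior_subset Kx]]; exists x. Qed.

(** A point x of K and its reflection give the half difference x - c, so the
ellipsoid of the half differences, centred at c, contains K. *)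
Lemma convex_whitney_symmetric (R : realType) (n : nat) (K : set 'rV[R]_n) :
  (0 < n)%N -> convex_body K -> centrally_symmetric K ->
  (convex_whitney 3 K <= (2 * n%:R)%:E * whitney 3 K)%E.
Proof.
move=> n0 bK [c hc]; have n1 : 1 <= n%:R :> R by rewrite ler1n.
have nK := convex_body_neq0 bK; have [kK cK iK] := bK.
apply: convex_whitney_le => [|f fK]; first by rewrite mulr_gt0//; lra.
apply: convex_error_comparison => // [|e g E e0 qg E0 fg]; first by rewrite mulr_gt0//; lra.
have en : 0 < e / n%:R by rewrite divr_gt0//; lra.
have [M [M0 M1 M2]] := half_differences_john n0 bK en.
have r0 : 0 < n%:R * (1 + e / n%:R) :> R by rewrite mulr_gt0//; lra.
have [|g' [q' m' fg']] := @convex_correction R n K f g M c _ E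
  (cvx_of_convex_set cK) fK qg E0 r0 fg M0 M2.
  move=> x Kx; apply: M1; exists x, (2 *: c - x); split => //; first exact: hc.
  by apply/rowP => i; rewrite !mxE; field.
exists g'; split => // x Kx; apply: (le_trans (fg' x Kx)); apply: ler_wpM2r => //.
rewrite mulrDr mulr1 mulrC divfK; first lra.
by rewrite gt_eqF//; lra.
Qed.

Lemma whitney_symmetric (R : realType) (n k : nat) (K : set 'rV[R]_n) :
  (0 < n)%N -> convex_body K -> centrally_symmetric K -> (n.+2 <= 2 ^ k)%N ->
  (whitney 3 K <= ((63 * k%:R + 2) +
     (448 * k%:R * (1 + 4 * Num.sqrt n%:R) + 21))%:E)%E.
Proof.
move=> n0 [kK cK iK] [c hc] nk; have {}cK := cvx_of_convex_set cK.
apply: ge_ereal_sup => _ [f [cf mf] <-].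
have f3 := modulus_third_diff mf.
have [S fS] := continuous_on_bounded kK cf.
have [S' KS] := compact_coord_bounded kK.
have [a [t [t0 Kt]]] := interior_cross iK.
pose K' : set 'rV[R]_n := [set x | K (c + x)]; pose f' x := f (c + x).
have cK' : cvx K'.
  move=> x y s Kx Ky s0 s1; rewrite /K' /=.
  have := cK _ _ _ Kx Ky s0 s1.
  suff -> : (1 - s) *: (c + x) + s *: (c + y) = c + ((1 - s) *: x + s *: y) by [].
  by apply/rowP => i; rewrite !mxE; ring.
have sK' : symm K'.
  move=> x Kx; rewrite /K' /=; have := hc _ Kx.
  suff -> : 2 *: c - (c + x) = c - x by [].
  by apply/rowP => i; rewrite !mxE; ring.
have f3' : third_diff_le1 K' f'.
  move=> x h K0 K1 K2 K3; rewrite /f' !addrA; apply: f3 => //.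
  - by rewrite -addrA.
  - by rewrite -addrA.
  - by rewrite -addrA.
have Kt' i : K' (t *: delta_mx ord0 i).
  rewrite /K' /=; have [K1 K2] := Kt i; have := hc _ K2.
  move=> K3; have h0 : 0 <= 2^-1 :> R by lra.
  have h1 : 2^-1 <= 1 :> R by lra.
  have := cK _ _ _ K1 K3 h0 h1.
  suff -> : (1 - 2^-1) *: (a + t *: delta_mx ord0 i) +
    2^-1 *: (2 *: c - (a - t *: delta_mx ord0 i)) = c + t *: delta_mx ord0 i by [].
  by apply/rowP => j; rewrite !mxE; field.
have KS' x j : K' x -> `|x ord0 j| <= S' + `|c ord0 j|.
  move=> Kx; have := KS _ j Kx; rewrite mxE => h.
  by have := ler_normB (c ord0 j + x ord0 j) (c ord0 j); rewrite addrAC subrr add0r; lra.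
have KS'' x j : K' x -> `|x ord0 j| <= S' + \sum_i `|c ord0 i|.
  move=> Kx; apply: le_trans (KS' x j Kx) _; rewrite lerD2l (bigD1 j)//= lerDl.
  exact: sumr_ge0.
have [|g qg fg] := symmetric_quadratic_approx n0 cK' sK' f3' _ KS'' t0 Kt' nk (S := S).
  by move=> x Kx; exact: fS.
apply: approx_error_le (quadratic_shift c qg) _ => x Kx.
have := fg (x - c); rewrite /f' /K' /= addrC subrK; exact.
Qed.

(** The form M is at most 4 on differences of points of K.  If y0 - z0 nearly
maximizes it, then the median identity for the midpoint x0 of y0 and z0 gives
M (x - x0) <= 4 - 4 / 4 = 3 up to a small error.  The dimension 1 must be excluded,
because 1 + 3 n <= 2 n ^ 2 fails there. *)
Lemma convex_whitney_general (R : realType) (n : nat) (K : set 'rV[R]_n) :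
  (1 < n)%N -> convex_body K ->
  (convex_whitney 3 K <= (2 * n%:R ^+ 2)%:E * whitney 3 K)%E.
Proof.
move=> n1 bK; have n2 : 2 <= n%:R :> R by rewrite ler_nat.
have n0 : (0 < n)%N by apply: ltnW.
have nK := convex_body_neq0 bK; have [kK cK iK] := bK.
have {}cK := cvx_of_convex_set cK.
have a0 : 0 < 2 * n%:R ^+ 2 :> R by rewrite mulr_gt0// exprn_gt0//; lra.
apply: convex_whitney_le => [//|f fK].
apply: convex_error_comparison => // e g E e0 qg E0 fg.
pose b := Num.min 1 (e / (4 * n%:R)).
have b0 : 0 < b by rewrite lt_min ltr01 divr_gt0//; lra.
have b1 : b <= 1 by rewrite ge_min lexx.
have be : b * (4 * n%:R) <= e by rewrite -ler_pdivlMr ?ge_min ?lexx ?orbT//; lra.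
have [M [M0 M1 M2]] := half_differences_john n0 bK b0.
pose s x := dot (x *m M) x.
have sZ a x : s (a *: x) = a ^+ 2 * s x.
  by rewrite /s -scalemxAl dotZl dotZr; ring.
have spar a c : s (a + c) + s (a - c) = 2 * s a + 2 * s c.
  rewrite /s !(mulmxDl, mulNmx) !(dotDl, dotDr, dotNl, dotNr); ring.
have s4 y z : K y -> K z -> s (y - z) <= 4.
  move=> Ky Kz; have : s (2^-1 *: (y - z)) <= 1 by apply: M1; exists y, z.
  by rewrite sZ exprVn (_ : 2 ^+ 2 = 4); [lra|ring].
pose D : set R := [set d | exists y z, [/\ K y, K z & d = s (y - z)]].
have supD : has_sup D.
  split; first by have [x Kx] := nK; exists (s (x - x)), x, x.
  by exists 4 => _ [y [z [Ky Kz ->]]]; exact: s4.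
have D4 : sup D <= 4.
  by apply: ge_sup => [|_ [y [z [Ky Kz ->]]]]; [case: supD|exact: s4].
have [_ [y0 [z0 [Ky0 Kz0 ->]]] hD] := sup_adherent b0 supD.
pose x0 := 2^-1 *: (y0 + z0).
have sx0 x : K x -> s (x - x0) <= 3 + b / 4.
  move=> Kx.
  have h1 : s (x - y0) <= sup D by apply: sup_upper_bound => //; exists x, y0.
  have h2 : s (x - z0) <= sup D by apply: sup_upper_bound => //; exists x, z0.
  have -> : s (x - x0) = s (x - y0) / 2 + s (x - z0) / 2 - s (y0 - z0) / 4.
    have -> : x - x0 = 2^-1 *: ((x - z0) + (x - y0)).
      by apply/rowP => i; rewrite /x0 !mxE; field.
    have -> : y0 - z0 = (x - z0) - (x - y0).
      by apply/rowP => i; rewrite !mxE; ring.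
    by have := spar (x - z0) (x - y0); rewrite sZ exprVn (_ : 2 ^+ 2 = 4); [lra|ring].
  lra.
pose q := 3 + b / 4.
have q0 : 0 < q by rewrite /q; lra.
have r0 : 0 < q * (n%:R * (1 + b)) by rewrite !mulr_gt0//; lra.
have sM x : dot (x *m (q^-1 *: M)) x = q^-1 * s x by rewrite -scalemxAr dotZl.
have [| | |g' [q' m' fg']] := @convex_correction R n K f g (q^-1 *: M) x0 _ E
  cK fK qg E0 r0 fg.
- move=> x; rewrite sM; apply: mulr_ge0; last exact: M0.
  by rewrite invr_ge0 ltW.
- move=> x; rewrite sM => h; apply: M2; apply: le_trans h; rewrite -/s -/(s x).
  rewrite le_eqVlt; apply/orP; left; apply/eqP; field.
  by rewrite gt_eqF.
- by move=> x Kx; rewrite sM mulrC ler_pdivrMr// mul1r; exact: sx0.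
exists g'; split => // x Kx; apply: (le_trans (fg' x Kx)); apply: ler_wpM2r => //.
have bn : 0 <= b * n%:R by rewrite mulr_ge0// ltW.
have bbn : b * (b * n%:R) <= b * n%:R by rewrite ler_piMl.
have -> : q * (n%:R * (1 + b)) =
    3 * n%:R + 13 / 4 * (b * n%:R) + b * (b * n%:R) / 4 by rewrite /q; field.
have : 0 <= (n%:R - 2) * (2 * n%:R + 1) :> R by rewrite mulr_ge0//; lra.
nra.
Qed.

(** A convex body of the line is a segment. *)
Lemma symmetric_dim1 (R : realType) (K : set 'rV[R]_1) :
  convex_body K -> centrally_symmetric K.
Proof.
move=> bK; have nK := convex_body_neq0 bK; have [kK cK iK] := bK.
have {}cK := cvx_of_convex_set cK.
have cc : {within K, continuous (fun x : 'rV[R]_1 => x ord0 ord0)}.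
  by apply: continuous_subspaceT; exact: (@coord_continuous R 1 1 ord0 ord0).
have [u /set_mem Ku umax] := compact_EVT_max nK kK cc.
have [l /set_mem Kl lmin] := compact_EVT_min nK kK cc.
exists (2^-1 *: (u + l)) => x Kx.
have xu := umax _ (mem_set Kx); have lx := lmin _ (mem_set Kx).
have [e|e] := eqVneq (u ord0 ord0) (l ord0 ord0).
  suff -> : 2 *: (2^-1 *: (u + l)) - x = x by [].
  by apply/rowP => i; rewrite !ord1 !mxE; lra.
have ul : l ord0 ord0 < u ord0 ord0.
  by rewrite lt_neqAle eq_sym e (le_trans lx).
have d0 : 0 < u ord0 ord0 - l ord0 ord0 by rewrite subr_gt0.
pose t := (u ord0 ord0 - x ord0 ord0) / (u ord0 ord0 - l ord0 ord0).
have t0 : 0 <= t by rewrite divr_ge0 ?subr_ge0// ltW.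
have t1 : t <= 1 by rewrite ler_pdivrMr// mul1r; lra.
have := cK _ _ _ Kl Ku t0 t1.
suff -> : (1 - t) *: l + t *: u = 2 *: (2^-1 *: (u + l)) - x by [].
have te : t * (u ord0 ord0 - l ord0 ord0) = u ord0 ord0 - x ord0 ord0.
  by rewrite /t divfK// gt_eqF.
by apply/rowP => i; rewrite !ord1 !mxE; lra.
Qed.

Lemma euclidean_unit_ballE (R : realType) (n : nat) : euclidean_unit_ball R n = dot_ball R n.
Proof.
have E (x : 'rV[R]_n) : euclidean_norm x ^+ 2 = dot x x.
  rewrite /euclidean_norm sqr_sqrtr; first by apply: eq_bigr => i _; rewrite expr2.
  by apply: sumr_ge0 => i _; rewrite sqr_ge0.
apply/seteqP; split => x; rewrite /euclidean_unit_ball /dot_ball /= -E => h.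
  by rewrite expr_le1// sqrtr_ge0.
by rewrite -(@expr_le1 _ 2)// sqrtr_ge0.
Qed.

Lemma dot_ball_compact (R : realType) (n : nat) : compact (dot_ball R n).
Proof.
apply: bounded_closed_compact.
  exists 1; split; first exact: num_real.
  move=> M M1 x x1; apply: le_trans (ltW M1).
  rewrite [leLHS]/Num.norm /= mx_normrE; apply: bigmax_le => // -[i j] _ /=.
  rewrite ord1 -(@expr_le1 _ 2)// -normrX ger0_norm ?sqr_ge0//.
  apply: le_trans x1; rewrite /dot (bigD1 j)//= expr2 lerDl.
  by apply: sumr_ge0 => k _; rewrite -expr2 sqr_ge0.
have -> : dot_ball R n = (fun y => dot (0 - y) (0 - y)) @^-1` [set a | a <= 1].
  by apply/seteqP; split => x; rewrite /dot_ball /= sub0r dotNl dotNr opprK.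
by apply: preimage_closed; [move=> y _; exact: dist2_continuous|exact: closed_le].
Qed.

Lemma convex_whitney_ball (R : realType) (n k : nat) :
  (0 < n)%N -> (2 * ((n * n).+1 + n) <= 2 ^ k)%N ->
  (convex_whitney 3 (euclidean_unit_ball R n) <= (2 * ((63 * k%:R + 2) +
    (64 * (14 + (91 * 128 * k%:R + 8 * (91 * 128) + 4) * 2) + 21)))%:E)%E.
Proof.
move=> n0 nk; rewrite euclidean_unit_ballE.
apply: ge_ereal_sup => _ [f [cf vf mf] <-].
have f3 := modulus_third_diff mf.
have [S fS] := continuous_on_bounded (@dot_ball_compact R n) cf.
have [g qg fg] := ball_quadratic_approx n0 f3 fS nk.
move: fg; set E := (X in (2 * X)%:E) => fg.
have K0 : dot_ball R n 0 by rewrite /dot_ball /= dot0l.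
have E0 : 0 <= E by apply: le_trans (fg 0 K0).
have [| | |g' [qg' mg' fg']] := @convex_correction R n (dot_ball R n) f g 1%:M 0 1 E
  (@dot_ball_cvx R n) vf qg E0 ltr01 fg.
- by move=> x; rewrite mulmx1 dot_ge0.
- move=> x; rewrite mul1r mulmx1 => x1; exists x, (- x); split => //.
    exact: dot_ball_symm.
  by apply/rowP => i; rewrite !mxE; field.
- by move=> x Kx; rewrite mulmx1 subr0.
by apply: convex_approx_error_le qg' mg' _ => x /fg'; rewrite (_ : 1 + 1 = 2).
Qed.

Unset Implicit Arguments.

Theorem corollary1p7 (R : realType) :
  exists c : R, 0 < c /\
  forall n : nat, (0 < n)%N ->
  [/\ (convex_whitney 3 (euclidean_unit_ball R n) <= (c * ln (n.+1%:R))%:E)%E,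
      (forall K : set 'rV[R]_n, convex_body K -> centrally_symmetric K ->
         (convex_whitney 3 K <= (2 * n%:R)%:E * whitney 3 K)%E /\
         ((2 * n%:R)%:E * whitney 3 K
            <= (c * (n%:R `^ (3 / 2)) * ln (n.+1%:R))%:E)%E) &
      (forall K : set 'rV[R]_n, convex_body K ->
         (convex_whitney 3 K <= (2 * n%:R ^+ 2)%:E * whitney 3 K)%E)].
Proof.
(* The constants of the two bounds in k, using 1 <= k and 1 <= sqrt n. *)
pose c1 : R := 2 * (63 + 2 + 64 * (14 + (91 * 128 + 8 * (91 * 128) + 4) * 2) + 21).
pose c2 : R := 2 * (63 + 2 + 448 * 5 + 21).
have c10 : 0 < c1 by rewrite /c1; lra.
have c20 : 0 < c2 by rewrite /c2; lra.
have l2 : 0 < ln 2 :> R by rewrite ln_gt0// ltr1n.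
exists ((c1 + c2) * (5 / ln 2)); split; first by rewrite mulr_gt0 ?divr_gt0 ?addr_gt0.
move=> n n0.
have [k [k0 k1 k2 kl]] := exists_log_bound R n0.
have k1R : 1 <= k%:R :> R by rewrite ler1n.
have n1R : 1 <= n%:R :> R by rewrite ler1n.
split.
- apply: (le_trans (convex_whitney_ball R n0 k1)); rewrite lee_fin.
  apply: (@le_trans _ _ (c1 * k%:R)); first by rewrite /c1; lra.
  rewrite -mulrA; apply: (@le_trans _ _ ((c1 + c2) * k%:R)).
    by rewrite ler_wpM2r//; lra.
  by rewrite ler_pM2l ?addr_gt0.
- move=> K bK sK; split; first exact: convex_whitney_symmetric.
  have := whitney_symmetric n0 bK sK k2.
  rewrite -(@lee_pmul2l _ (2 * n%:R)%:E) ?lte_fin ?mulr_gt0 ?ltr0n//.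
  move=> /le_trans; apply; rewrite -EFinM lee_fin.
  set s := Num.sqrt n%:R.
  have s1 : 1 <= s :> R.
    by rewrite -(@expr_ge1 _ 2)// ?sqrtr_ge0// sqr_sqrtr.
  have -> : n%:R `^ (3 / 2) = n%:R * s :> R.
    rewrite (_ : 3 / 2 = 1 + 2^-1); last by field.
    rewrite powRD; last by apply/implyP => _; rewrite pnatr_eq0 -lt0n.
    by rewrite powRr1// powR12_sqrt.
  set Z := n%:R * s.
  have Z0 : 0 <= Z by rewrite /Z mulr_ge0// sqrtr_ge0.
  have ks : k%:R <= k%:R * s by rewrite ler_peMr.
  apply: (@le_trans _ _ (c2 * k%:R * Z)).
    rewrite /Z (_ : c2 * k%:R * (n%:R * s) = 2 * n%:R * (c2 / 2 * (k%:R * s))).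
      rewrite ler_pM2l ?mulr_gt0 ?ltr0n// /c2; lra.
    by field.
  rewrite [leRHS](_ : _ = (c1 + c2) * (5 / ln 2 * ln n.+1%:R) * Z); last by ring.
  apply: ler_wpM2r => //; apply: (@le_trans _ _ ((c1 + c2) * k%:R)).
    by rewrite ler_wpM2r//; lra.
  by rewrite ler_pM2l ?addr_gt0.
- move=> K bK; have [n1|n1] := ltnP 1 n; first exact: convex_whitney_general.
  have e : n = 1%N by apply/eqP; rewrite eqn_leq n1 n0.
  move: K bK; rewrite e => K bK; rewrite expr1n -[2 * 1]/(2 * 1%:R).
  exact: convex_whitney_symmetric bK (symmetric_dim1 bK).
Qed.
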